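(* Let $\sigma(t)=(\lambda_h(t),\Lambda_h(t))$, $t\in\mathbb R$, be the real-analytic time parametrization of the separatrix described in the context, with $\sigma(0)=(\lambda_0,0)$, $\lambda_0\in(\tfrac23\pi,\pi)$. Let $a_\pm=-\tfrac12\pm\tfrac{\sqrt2}{2}$ and $$A=\int_0^{a_+}\frac{1}{1-x}\sqrt{\frac{x}{3(x+1)(a_+-x)(x-a_-)}}\,dx\ (\approx0.177744),\qquad \Pi_A=\{t\in\mathbb C:|\operatorname{Im}t|<A\}.$$ Then: (i) $\sigma$ extends analytically to $\Pi_A$; (ii) $\sigma$ has only two singularities in $\partial\Pi_A$, at $t=\pm iA$; (iii) there exists $\nu>0$ such that, for $t\in\mathbb C$ with $|t-iA|<\nu$ and $\arg(t-iA)\in(-\tfrac{3\pi}2,\tfrac\pi2)$, $$\lambda_h(t)=\pi+3\alpha_+(t-iA)^{2/3}+\mathcal O\big((t-iA)^{4/3}\big),\qquad \Lambda_h(t)=-\frac{2\alpha_+}{3}\frac{1}{(t-iA)^{1/3}}+\mathcal O\big((t-iA)^{1/3}\big),$$ with $\alpha_+\in\mathbb C$ such that $\alpha_+^3=\tfrac12$; and analogously, for $|t+iA|<\nu$ and $\arg(t+iA)\in(-\tfrac\pi2,\tfrac{3\pi}2)$, the same expansions hold with $iA$ replaced by $-iA$ and $\alpha_+$ replaced by $\alpha_-=\overline{\alpha_+}$.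
   Context: Consider the one-degree-of-freedom Hamiltonian $H_{\mathrm{pend}}(\lambda,\Lambda)=-\tfrac32\Lambda^2+V(\lambda)$, $V(\lambda)=1-\cos\lambda-\frac1{\sqrt{2+2\cos\lambda}}$, with equations $\dot\lambda=-3\Lambda$, $\dot\Lambda=-\sin\lambda\big(1-(2+2\cos\lambda)^{-3/2}\big)$. It has a saddle at $(0,0)$ and two homoclinic orbits (separatrices) in the energy level $H_{\mathrm{pend}}=-\tfrac12$; the ''right'' separatrix has $\lambda\in(0,\pi)$. $\sigma(t)=(\lambda_h(t),\Lambda_h(t))$ is the solution parametrizing this right separatrix with initial condition $\sigma(0)=(\lambda_0,0)$, $\lambda_0\in(\tfrac23\pi,\pi)$ (so $\sigma(t)\to(0,0)$ as $t\to\pm\infty$). *)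

(* Defs.v *)
From Stdlib Require Import Reals.
From Coquelicot Require Import Coquelicot.
Open Scope R_scope.

(* Potential of the pendulum Hamiltonian H = -3/2 Lambda^2 + V(lambda). *)
Definition Vpend (l : R) : R := 1 - cos l - 1 / sqrt (2 + 2 * cos l).

(* Right-hand side of  dLambda/dt = - sin l (1 - (2 + 2 cos l)^(-3/2)). *)
Definition Fpend (l : R) : R := - sin l * (1 - 1 / (sqrt (2 + 2 * cos l)) ^ 3).

Definition a_plus : R := -1/2 + sqrt 2 / 2.
Definition a_minus : R := -1/2 - sqrt 2 / 2.

Definition A_integrand (x : R) : R :=
  1 / (1 - x) * sqrt (x / (3 * (x + 1) * (a_plus - x) * (x - a_minus))).

Definition Cderivable (f : C -> C) (z : C) : Prop :=
  ex_derive (K := C_AbsRing) (V := C_NormedModule) f z.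

(* Principal argument in (-pi, pi), valid off the closed negative real axis. *)
Definition ArgP (z : C) : R := 2 * atan (Im z / (Cmod z + Re z)).

(* w lies in the sector  { arg(rot * w) in (-pi, pi) }  (w <> 0). *)
Definition in_sector (rot w : C) : Prop :=
  ~ (Im (Cmult rot w) = 0 /\ Re (Cmult rot w) <= 0).

Definition cpow_br (rot : C) (shift p : R) (w : C) : C :=
  let th := ArgP (Cmult rot w) + shift in
  (Rpower (Cmod w) p * cos (p * th), Rpower (Cmod w) p * sin (p * th)).

(* Branch with arg(w) in (-3pi/2, pi/2): rot = i, shift = -pi/2. *)
Definition pow_up (p : R) (w : C) : C := cpow_br Ci (- PI / 2) p w.
(* Branch with arg(w) in (-pi/2, 3pi/2): rot = -i, shift = pi/2. *)
Definition pow_dn (p : R) (w : C) : C := cpow_br (Copp Ci) (PI / 2) p w.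

(* Main.v *)
(* Put c = cos (lambda / 2). On the energy level of the separatrix
     (dc/dt)^2 = 3 (1 - c)^2 (1 + c) (c - a_+) (c - a_-) / c,
   and c = X / (X + m) with X = cosh^2 z, m = 1 + 2 sqrt 2 uniformizes both branch points c = a_+
   (at z = 0) and c = 0 (at z = i pi/2). In the coordinate z the complex time is a primitive T of an
   explicit function G, holomorphic on |Im z| < pi/2 and near +-i pi/2, where T - T(+-i pi/2) has a
   zero of order three; the substitution in the integral gives T(i pi/2) = iA.
   Since Im G > 0 on the quarter strip {Re z > 0, 0 < Im z < pi/2}, T is injective there, and by
   symmetry on {Re z > 0}; hence T is injective on the set Omega of points of the strip at which
   Re T has the sign of Re z. The extension of the separatrix is lambda(z), Lambda(z) composed with
   the inverse of T on Omega. The boundary values of T on suitable rectangles show that T(Omega)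
   contains the closed strip |Im t| <= A except +-iA, and a slit disc around iA. Near i pi/2 the
   comparison of T - iA with a multiple of sinh^3 (z - i pi/2) gives the expansions; as Lambda is
   unbounded there, +-iA are singularities. *)

Require Import Defs.
From Stdlib Require Import Reals Lra Psatz Classical ClassicalEpsilon.
From Coquelicot Require Import Coquelicot.
Open Scope R_scope.

(** * Complex differentiation *)

(** The form of the uniformization is forced: c = X / (X + m) sends X = 0 to c = 0 and X = infinity
    to the saddle c = 1, and requiring X = 1 at c = a_+ gives m = 1 / a_+ - 1. The roots of X and X
    - 1 in dt/dX then combine with dX = 2 cosh z sinh z dz, so that dt/dz contains only the roots of
    X + b and X + d; their branch points on the line Im z = pi/2 stay away from i pi/2. The
    differential equation is never continued along complex paths. One inverse of [TT] serves the
    whole domain, so single-valuedness becomes injectivity and the size of the domain becomes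
    surjectivity. Both rest on mean value estimates: Re (k (T b - T a)) is controlled by [GG] at one
    point of the segment. Surjectivity asks that the image of the boundary of a rectangle avoid a
    convex target; neither the strip without +-iA nor the slit disc is convex, so each is covered by
    halves. At the corner z = i pi/2 + u the natural small quantity is s = sinh u, since X = - s^2
    exactly; remainders are kept as explicit multiples of powers of |s|. That the extension
    restricts to the given real solution follows from uniqueness for the real differential
    equation. *)

Definition Cder (f : C -> C) (z l : C) : Prop :=
  is_derive (K := C_AbsRing) (V := AbsRing_NormedModule C_AbsRing) f z l.

Definition Ccont (f : C -> C) (z : C) : Prop :=
  continuous (T := AbsRing_UniformSpace C_AbsRing) (U := AbsRing_UniformSpace C_AbsRing) f z.

Lemma locally_Cmod (z : C) (P : C -> Prop) :
  locally (T := AbsRing_UniformSpace C_AbsRing) z P <->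
  exists e, 0 < e /\ forall y, Cmod (y - z) < e -> P y.
Proof.
  split.
  - intros [e He]. exists e. split; [apply cond_pos|]. intros y Hy. apply He. exact Hy.
  - intros (e & He & H). exists (mkposreal e He). intros y Hy. apply H. exact Hy.
Qed.

Lemma Cder_eps (f : C -> C) (z l : C) :
  Cder f z l <->
  forall e, 0 < e -> exists d, 0 < d /\
    forall y, Cmod (y - z) < d -> Cmod (f y - f z - (y - z) * l) <= e * Cmod (y - z).
Proof.
  split.
  - intros [_ H] e He.
    destruct (proj1 (locally_Cmod _ _) (H z (fun P HP => HP) (mkposreal e He))) as (d & Hd & H').
    exists d. split; [exact Hd|]. exact H'.
  - intros H. split; [apply is_linear_scal_l|].
    intros x Hx.
    pose proof (is_filter_lim_locally_unique _ _ Hx) as E. subst x.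
    intros e. apply (proj2 (locally_Cmod _ _)).
    destruct (H e (cond_pos e)) as (d & Hd & H').
    exists d. split; [exact Hd|]. exact H'.
Qed.

Lemma Ccont_eps (f : C -> C) (z : C) :
  Ccont f z <->
  forall e, 0 < e -> exists d, 0 < d /\ forall y, Cmod (y - z) < d -> Cmod (f y - f z) < e.
Proof.
  split.
  - intros H e He. apply (proj1 (locally_Cmod z (fun y => Cmod (f y - f z) < e))).
    refine (H (fun w => Cmod (w - f z) < e) _). apply (proj2 (locally_Cmod _ _)). exists e. split;
      [exact He|]. auto.
  - intros H P HP. destruct (proj1 (locally_Cmod _ _) HP) as (e & He & H1).
    destruct (H e He) as (d & Hd & H2).
    apply (proj2 (locally_Cmod z (fun y => P (f y)))). exists d. split; auto.
Qed.

(** [Cder] views [C] as a normed module over itself, which is what the product and chain rules need;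
    [Cderivable] uses the module structure [C_NormedModule]. Both come down to the same
    epsilon-delta inequality in [Cmod]. *)
Lemma Cder_Cderivable (f : C -> C) (z l : C) : Cder f z l -> Cderivable f z.
Proof.
  intros H. exists l. split; [apply is_linear_scal_l|].
  intros x Hx.
  pose proof (is_filter_lim_locally_unique _ _ Hx) as E. subst x.
  intros e. apply (proj2 (locally_Cmod _ _)).
  destruct (proj1 (Cder_eps _ _ _) H e (cond_pos e)) as (d & Hd & H').
  exists d. split; [exact Hd|]. exact H'.
Qed.

Lemma Cderivable_Ccont (f : C -> C) (z : C) : Cderivable f z -> Ccont f z.
Proof.
  intros H. pose proof (ex_derive_continuous f z H) as Hc.
  intros P HP.
  apply Hc. apply locally_C. exact HP.
Qed.

Lemma Cder_cont (f : C -> C) (z l : C) : Cder f z l -> Ccont f z.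
Proof.
  intros H. apply (ex_derive_continuous (K := C_AbsRing) (V := AbsRing_NormedModule C_AbsRing)).
  exists l. exact H.
Qed.

Lemma Cder_val (f : C -> C) (z l l' : C) : Cder f z l -> l = l' -> Cder f z l'.
Proof. intros H E. subst. exact H. Qed.

Lemma Cder_const (c z : C) : Cder (fun _ => c) z 0.
Proof. apply (is_derive_const (K := C_AbsRing) (V := AbsRing_NormedModule C_AbsRing)). Qed.

Lemma Cder_id (z : C) : Cder (fun x => x) z 1.
Proof. apply (is_derive_id (K := C_AbsRing)). Qed.

Lemma Cder_plus (f g : C -> C) (z a b : C) :
  Cder f z a -> Cder g z b -> Cder (fun x => f x + g x)%C z (a + b)%C.
Proof. apply (is_derive_plus (K := C_AbsRing) (V := AbsRing_NormedModule C_AbsRing)). Qed.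

Lemma Cder_opp (f : C -> C) (z a : C) : Cder f z a -> Cder (fun x => - f x)%C z (- a)%C.
Proof. apply (is_derive_opp (K := C_AbsRing) (V := AbsRing_NormedModule C_AbsRing)). Qed.

Lemma Cder_mult (f g : C -> C) (z a b : C) :
  Cder f z a -> Cder g z b -> Cder (fun x => f x * g x)%C z (a * g z + f z * b)%C.
Proof.
  intros Hf Hg. apply (is_derive_mult (K := C_AbsRing) f g z a b Hf Hg). exact Cmult_comm.
Qed.

Lemma Cder_comp (f g : C -> C) (z a b : C) :
  Cder f (g z) a -> Cder g z b -> Cder (fun x => f (g x)) z (b * a)%C.
Proof. apply (is_derive_comp (K := C_AbsRing) (V := AbsRing_NormedModule C_AbsRing)). Qed.

Lemma Cder_minus (f g : C -> C) (z a b : C) :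
  Cder f z a -> Cder g z b -> Cder (fun x => f x - g x)%C z (a - b)%C.
Proof. intros Hf Hg. apply Cder_plus; [exact Hf|]. apply Cder_opp, Hg. Qed.

Lemma Cder_scal (f : C -> C) (c z a : C) : Cder f z a -> Cder (fun x => c * f x)%C z (c * a)%C.
Proof.
  intros H. eapply Cder_val; [apply (Cder_mult (fun _ => c) f z 0 a); [apply Cder_const|exact H]|].
  ring.
Qed.

Lemma Cder_inv_id (z : C) : z <> 0 -> Cder Cinv z (- / (z * z))%C.
Proof.
  intros Hz. apply Cder_eps. intros e He.
  assert (Hm : 0 < Cmod z) by (apply Cmod_gt_0; exact Hz).
  (* The error is (y - z)^2 / (y z^2). The first bound keeps |y| > |z| / 2, and the second then
     makes the remaining quotient at most e. *)
  exists (Rmin (Cmod z / 2) (e * Cmod z ^ 3 / 2)). split.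
  { apply Rmin_glb_lt; [lra|]. pose proof (pow_lt _ 3 Hm). nra. }
  intros y Hy.
  assert (H1 : Cmod (y - z) < Cmod z / 2) by (eapply Rlt_le_trans; [exact Hy|apply Rmin_l]).
  assert (H2 : Cmod (y - z) < e * Cmod z ^ 3 / 2) by (eapply Rlt_le_trans; [exact Hy|apply Rmin_r]).
  assert (Hy2 : Cmod z / 2 < Cmod y).
  { pose proof (Cmod_triangle y (z - y)). replace (y + (z - y))%C with z in H by ring.
    rewrite <- (Cmod_opp (z - y)) in H. replace (- (z - y))%C with (y - z)%C in H by ring. lra. }
  assert (Hy0 : y <> 0) by (apply (proj2 (Cmod_gt_0 y)); lra).
  replace (/ y - / z - (y - z) * - / (z * z))%C with ((y - z) * ((y - z) / (y * z * z)))%C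
    by (field; auto).
  rewrite Cmod_mult, Rmult_comm. apply Rmult_le_compat_r; [apply Cmod_ge_0|].
  rewrite Cmod_div by (apply Cmult_neq_0; [apply Cmult_neq_0|]; assumption).
  rewrite !Cmod_mult. apply Rle_div_l; [apply Rmult_lt_0_compat; nra|].
  apply Rlt_le. eapply Rlt_le_trans; [exact H2|].
  replace (e * Cmod z ^ 3 / 2) with (e * (Cmod z / 2 * Cmod z * Cmod z)) by field.
  apply Rmult_le_compat_l; [lra|]. apply Rmult_le_compat_r; [lra|]. apply Rmult_le_compat_r; lra.
Qed.

Lemma Cder_inv (f : C -> C) (z a : C) :
  Cder f z a -> f z <> 0 -> Cder (fun x => / f x)%C z (- a / (f z * f z))%C.
Proof.
  intros Hf H0. eapply Cder_val; [apply (Cder_comp Cinv f z); [apply Cder_inv_id, H0|exact Hf]|].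
  field. exact H0.
Qed.

Lemma Ccont_const (c z : C) : Ccont (fun _ => c) z.
Proof. apply (continuous_const (U := AbsRing_UniformSpace C_AbsRing) (V := AbsRing_UniformSpace C_AbsRing)). Qed.

Lemma Ccont_plus (f g : C -> C) (z : C) :
  Ccont f z -> Ccont g z -> Ccont (fun x => f x + g x)%C z.
Proof. apply (continuous_plus (U := AbsRing_UniformSpace C_AbsRing) (K := C_AbsRing) (V := AbsRing_NormedModule C_AbsRing)). Qed.

Lemma Ccont_opp (f : C -> C) (z : C) : Ccont f z -> Ccont (fun x => - f x)%C z.
Proof. apply (continuous_opp (U := AbsRing_UniformSpace C_AbsRing) (K := C_AbsRing) (V := AbsRing_NormedModule C_AbsRing)). Qed.

Lemma Ccont_mult (f g : C -> C) (z : C) :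
  Ccont f z -> Ccont g z -> Ccont (fun x => f x * g x)%C z.
Proof. apply (continuous_mult (U := AbsRing_UniformSpace C_AbsRing) (K := C_AbsRing)). Qed.

Lemma Ccont_inv (f : C -> C) (z : C) : Ccont f z -> f z <> 0 -> Ccont (fun x => / f x)%C z.
Proof.
  intros Hf H0. apply (continuous_comp (U := AbsRing_UniformSpace C_AbsRing)
    (V := AbsRing_UniformSpace C_AbsRing) (W := AbsRing_UniformSpace C_AbsRing) f Cinv z Hf).
  eapply Cder_cont, Cder_inv_id, H0.
Qed.

Lemma Ccont_comp (f g : C -> C) (z : C) :
  Ccont f (g z) -> Ccont g z -> Ccont (fun x => f (g x)) z.
Proof.
  intros Hf Hg. apply (continuous_comp (U := AbsRing_UniformSpace C_AbsRing)
    (V := AbsRing_UniformSpace C_AbsRing) (W := AbsRing_UniformSpace C_AbsRing) g f z Hg Hf).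
Qed.

Lemma is_derive_val (f : R -> R) (x l l' : R) : is_derive f x l -> l = l' -> is_derive f x l'.
Proof. intros H E. subst. exact H. Qed.

Lemma is_derive_continuity_pt (f : R -> R) (x l : R) : is_derive f x l -> continuity_pt f x.
Proof.
  intros H. apply continuity_pt_filterlim.
  apply (ex_derive_continuous (K := R_AbsRing) (V := R_NormedModule)). exists l. exact H.
Qed.

(** Continuity of the derivative is carried along because primitives are built by differentiating
    under an integral sign. *)
Definition C1_on (D : C -> Prop) (f : C -> C) : Prop :=
  exists f' : C -> C, forall z, D z -> Cder f z (f' z) /\ Ccont f' z.

Lemma C1_const (D : C -> Prop) (c : C) : C1_on D (fun _ => c).
Proof. exists (fun _ => RtoC 0). intros z _. split; [apply Cder_const|apply Ccont_const]. Qed.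

Lemma C1_plus (D : C -> Prop) (f g : C -> C) :
  C1_on D f -> C1_on D g -> C1_on D (fun x => f x + g x)%C.
Proof.
  intros [f' Hf] [g' Hg]. exists (fun x => f' x + g' x)%C. intros z Hz.
  destruct (Hf z Hz), (Hg z Hz). split; [apply Cder_plus|apply Ccont_plus]; assumption.
Qed.

Lemma C1_mult (D : C -> Prop) (f g : C -> C) :
  C1_on D f -> C1_on D g -> C1_on D (fun x => f x * g x)%C.
Proof.
  intros [f' Hf] [g' Hg]. exists (fun x => f' x * g x + f x * g' x)%C. intros z Hz.
  destruct (Hf z Hz) as [Hf1 Hf2], (Hg z Hz) as [Hg1 Hg2]. split; [apply Cder_mult; assumption|].
  apply Ccont_plus; apply Ccont_mult; try assumption; eapply Cder_cont; eassumption.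
Qed.

Lemma C1_inv (D : C -> Prop) (f : C -> C) :
  C1_on D f -> (forall z, D z -> f z <> 0) -> C1_on D (fun x => / f x)%C.
Proof.
  intros [f' Hf] H0. exists (fun x => - f' x / (f x * f x))%C. intros z Hz.
  destruct (Hf z Hz) as [Hf1 Hf2]. split; [apply Cder_inv; auto|].
  pose proof (Cder_cont _ _ _ Hf1).
  apply Ccont_mult; [apply Ccont_opp; assumption|].
  apply (Ccont_inv (fun x => f x * f x)%C); [apply Ccont_mult; assumption|].
  apply Cmult_neq_0; apply H0, Hz.
Qed.

Lemma C1_comp (D E : C -> Prop) (f g : C -> C) :
  C1_on E f -> C1_on D g -> (forall z, D z -> E (g z)) -> C1_on D (fun x => f (g x)).
Proof.
  intros [f' Hf] [g' Hg] H. exists (fun x => g' x * f' (g x))%C. intros z Hz.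
  destruct (Hg z Hz) as [Hg1 Hg2]. destruct (Hf (g z) (H z Hz)) as [Hf1 Hf2].
  split; [apply Cder_comp; assumption|].
  apply Ccont_mult; [assumption|]. apply (Ccont_comp f'); [assumption|]. eapply Cder_cont; eassumption.
Qed.

(* [k = 1] and [k = - i] give the real and the imaginary part of [f] along a line. *)
Lemma Cder_line (f : C -> C) (a h k l : C) (u : R) :
  Cder f (a + u * h)%C l -> is_derive (fun v : R => Re (k * f (a + v * h))%C) u (Re (k * (l * h))%C).
Proof.
  intros H. apply is_derive_Reals. intros e He.
  set (B := (Cmod k * Cmod h + 1)).
  pose proof (Cmod_ge_0 k). pose proof (Cmod_ge_0 h).
  assert (HB : 0 < B) by (unfold B; nra).
  destruct (proj1 (Cder_eps _ _ _) H (e / (2 * B))) as (d & Hd & H').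
  { apply Rdiv_lt_0_compat; lra. }
  assert (Hd' : 0 < d / (Cmod h + 1)) by (apply Rdiv_lt_0_compat; lra).
  exists (mkposreal _ Hd'). intros t Ht0 Ht. simpl in Ht.
  specialize (H' (a + (u + t) * h)%C).
  replace (a + (u + t) * h - (a + u * h))%C with (t * h)%C in H' by ring.
  rewrite Cmod_mult, Cmod_R in H'.
  assert (Htp : 0 < Rabs t) by (apply Rabs_pos_lt; exact Ht0).
  assert (Rabs t * Cmod h < d).
  { apply Rmult_lt_compat_r with (r := Cmod h + 1) in Ht; [|lra].
    unfold Rdiv in Ht. rewrite Rmult_assoc, Rinv_l in Ht by lra. nra. }
  specialize (H' H2).
  replace ((Re (k * f (a + (u + t)%R * h))%C - Re (k * f (a + u * h))%C) / t - Re (k * (l * h))%C)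
    with (Re (k * (f (a + (u + t) * h) - f (a + u * h) - t * h * l))%C / t).
  2:{ rewrite RtoC_plus. destruct (f (a + (u + t) * h)%C) as [p q]. destruct (f (a + u * h)%C) as [p' q'].
      destruct k, l, h. unfold Re; simpl. field. exact Ht0. }
  rewrite Rabs_div by exact Ht0. apply Rlt_div_l; [exact Htp|].
  eapply Rle_lt_trans; [apply re_le_Cmod|]. rewrite Cmod_mult.
  eapply Rle_lt_trans; [apply Rmult_le_compat_l; [assumption|exact H']|].
  replace (Cmod k * (e / (2 * B) * (Rabs t * Cmod h))) with (e * Rabs t * ((Cmod k * Cmod h) / (2 * B)))
    by (field; lra).
  rewrite <- (Rmult_1_r (e * Rabs t)) at 2. apply Rmult_lt_compat_l; [nra|].
  apply Rlt_div_l; [lra|]. unfold B. nra.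
Qed.

(** * Primitives on star-shaped domains *)

Definition open_eps (D : C -> Prop) : Prop :=
  forall z, D z -> exists e, 0 < e /\ forall y, Cmod (y - z) < e -> D y.

Definition star0 (D : C -> Prop) : Prop :=
  forall z (u : R), D z -> 0 <= u <= 1 -> D (u * z)%C.

(** The integral of f along the segment from 0 to z, taken componentwise. *)
Definition prim (f : C -> C) (z : C) : C :=
  (RInt (fun u : R => Re (z * f (u * z))%C) 0 1, RInt (fun u : R => Im (z * f (u * z))%C) 0 1).

Local Notation CA := (AbsRing_UniformSpace C_AbsRing).
Local Notation R2 := (prod_UniformSpace R_UniformSpace R_UniformSpace).

Lemma continuous_RtoC_fst (p : R2) : continuous (T := R2) (U := CA) (fun q => RtoC (fst q)) p.
Proof.
  intros P HP. destruct (proj1 (locally_Cmod _ _) HP) as (e & He & H).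
  exists (mkposreal e He). intros y [Hy1 Hy2]. apply H.
  rewrite <- RtoC_minus, Cmod_R. exact Hy1.
Qed.

Lemma continuous_RtoC_snd (p : R2) : continuous (T := R2) (U := CA) (fun q => RtoC (snd q)) p.
Proof.
  intros P HP. destruct (proj1 (locally_Cmod _ _) HP) as (e & He & H).
  exists (mkposreal e He). intros y [Hy1 Hy2]. apply H.
  rewrite <- RtoC_minus, Cmod_R. exact Hy2.
Qed.

Lemma continuous_Re_CA (z : C) : continuous (T := CA) (U := R_UniformSpace) Re z.
Proof.
  intros P [e He]. apply (proj2 (locally_Cmod _ _)). exists e. split; [apply cond_pos|].
  intros y Hy. apply He.
  eapply Rle_lt_trans; [|exact Hy]. eapply Rle_trans; [|apply re_le_Cmod].
  unfold Re, Cminus, Cplus, Copp. simpl. right. reflexivity.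
Qed.

Lemma c2_mult (f g : R * R -> C) (p : R * R) :
  continuous (T := R2) (U := CA) f p -> continuous (T := R2) (U := CA) g p ->
  continuous (T := R2) (U := CA) (fun q => f q * g q)%C p.
Proof. apply (continuous_mult (U := R2) (K := C_AbsRing)). Qed.

Lemma c2_plus (f g : R * R -> C) (p : R * R) :
  continuous (T := R2) (U := CA) f p -> continuous (T := R2) (U := CA) g p ->
  continuous (T := R2) (U := CA) (fun q => f q + g q)%C p.
Proof. apply (continuous_plus (U := R2) (K := C_AbsRing) (V := AbsRing_NormedModule C_AbsRing)). Qed.

Lemma c2_const (c : C) (p : R * R) : continuous (T := R2) (U := CA) (fun _ => c) p.
Proof. apply (continuous_const (U := R2) (V := CA)). Qed.

Lemma c2_comp (f : C -> C) (g : R * R -> C) (p : R * R) :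
  continuous (T := R2) (U := CA) g p -> Ccont f (g p) ->
  continuous (T := R2) (U := CA) (fun q => f (g q)) p.
Proof. intros Hg Hf. apply (continuous_comp (U := R2) (V := CA) (W := CA) g f p Hg Hf). Qed.

Lemma c2_Re (f : R * R -> C) (p : R * R) :
  continuous (T := R2) (U := CA) f p -> continuous (T := R2) (U := R_UniformSpace) (fun q => Re (f q)) p.
Proof.
  intros Hf. apply (continuous_comp (U := R2) (V := CA) (W := R_UniformSpace) f Re p Hf).
  apply continuous_Re_CA.
Qed.

Lemma continuous_snd_section (F : R * R -> R) (s t : R) :
  continuous (T := R2) (U := R_UniformSpace) F (s, t) ->
  continuous (T := R_UniformSpace) (U := R_UniformSpace) (fun v => F (s, v)) t.
Proof.
  intros H P HP. destruct (H P HP) as [e He]. exists e. intros y Hy. apply (He (s, y)).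
  split; [apply ball_center|exact Hy].
Qed.

Section Primitive.

Variables (D : C -> Prop) (f f' : C -> C).
Hypotheses (Dopen : open_eps D) (Dstar : star0 D).
Hypotheses (Hf : forall z, D z -> Cder f z (f' z) /\ Ccont f' z).

Lemma prim_integrand_cont (w k : C) (t : R) :
  D w -> 0 <= t <= 1 -> continuous (fun v : R => Re (k * (w * f (v * w)))%C) t.
Proof.
  intros Hw Ht.
  apply (continuous_ext (fun v : R => Re ((k * w) * f (0 + v * w))%C)).
  { intros x. f_equal. rewrite Cplus_0_l. ring. }
  apply (ex_derive_continuous (K := R_AbsRing) (V := R_NormedModule)). eexists.
  apply (Cder_line f 0 w (k * w)). apply Hf. rewrite Cplus_0_l. apply Dstar; assumption.
Qed.

(** With w = z + s h this is the s-derivative of Re (k w f(t w)). It is at the same time the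
    t-derivative of Re (k h t f(t w)), the coincidence on which [prim_line] rests. *)
Let Q (z h k : C) (q : R * R) : R :=
  let w := (z + fst q * h)%C in
  Re (k * ((f (snd q * w) + w * (snd q * f' (snd q * w))) * h))%C.

Lemma prim_integrand_der (z h k : C) (s t : R) :
  D (t * (z + s * h))%C ->
  is_derive (fun v : R => Re (k * ((z + v * h) * f (t * (z + v * h))))%C) s (Q z h k (s, t)).
Proof.
  intros HD.
  apply (Cder_line (fun x => x * f (t * x))%C z h k).
  eapply Cder_val.
  - apply (Cder_mult (fun x => x) (fun x => f (t * x)%C)); [apply Cder_id|].
    apply (Cder_comp f (fun x => t * x)%C); [apply Hf, HD|]. apply Cder_scal, Cder_id.
  - simpl. ring.
Qed.

Lemma prim_line_cont (z h k : C) (s t : R) :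
  D (t * (z + s * h))%C -> continuous (T := R2) (U := R_UniformSpace) (Q z h k) (s, t).
Proof.
  intros HD. unfold Q. apply c2_Re.
  assert (Hw : continuous (T := R2) (U := CA) (fun q => z + fst q * h)%C (s, t)).
  { apply c2_plus; [apply c2_const|]. apply c2_mult; [apply continuous_RtoC_fst|apply c2_const]. }
  assert (Hv : continuous (T := R2) (U := CA) (fun q => snd q * (z + fst q * h))%C (s, t)).
  { apply c2_mult; [apply continuous_RtoC_snd|exact Hw]. }
  destruct (Hf _ HD) as [H1 H2].
  apply c2_mult; [apply c2_const|]. apply c2_mult; [|apply c2_const].
  apply c2_plus.
  - apply (c2_comp f _ (s, t) Hv). eapply Cder_cont, H1.
  - apply c2_mult; [exact Hw|]. apply c2_mult; [apply continuous_RtoC_snd|].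
    apply (c2_comp f' _ (s, t) Hv). exact H2.
Qed.

(** Differentiation under the integral sign leaves the integral over [0, 1] of h d/dt (t f(t w)),
    which is h f(w). This takes the place of path independence. *)
Lemma prim_line (z h k : C) (s : R) :
  D (z + s * h)%C ->
  is_derive (fun v : R => RInt (fun t : R => Re (k * ((z + v * h) * f (t * (z + v * h))))%C) 0 1) s
            (Re (k * (h * f (z + s * h)))%C).
Proof.
  intros HD.
  assert (Hloc : locally s (fun v : R => D (z + v * h)%C)).
  { destruct (Dopen _ HD) as (e & He & H).
    assert (He' : 0 < e / (Cmod h + 1)) by (apply Rdiv_lt_0_compat; pose proof (Cmod_ge_0 h); lra).
    exists (mkposreal _ He'). intros v Hv. apply H.
    replace (z + v * h - (z + s * h))%C with ((v - s)%R * h)%C by (rewrite RtoC_minus; ring).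
    rewrite Cmod_mult, Cmod_R. pose proof (Cmod_ge_0 h). pose proof (Rabs_pos (v - s)).
    change (Rabs (v - s) < e / (Cmod h + 1)) in Hv.
    apply Rlt_div_r in Hv; [nra|lra]. }
  assert (Hloc2 : forall t : R, D (t * (z + s * h))%C ->
            locally_2d (fun u v : R => D (v * (z + u * h))%C) s t).
  { intros t Ht. apply locally_2d_locally.
    assert (Hv : continuous (T := R2) (U := CA) (fun q => snd q * (z + fst q * h))%C (s, t)).
    { apply c2_mult; [apply continuous_RtoC_snd|].
      apply c2_plus; [apply c2_const|]. apply c2_mult; [apply continuous_RtoC_fst|apply c2_const]. }
    apply (Hv D). apply (proj2 (locally_Cmod _ _)). apply Dopen. exact Ht. }
  set (F := fun v t : R => Re (k * ((z + v * h) * f (t * (z + v * h))))%C).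
  assert (HD1 : forall t : R, 0 <= t <= 1 -> D (t * (z + s * h))%C) by (intros; apply Dstar; assumption).
  assert (HI : is_RInt (fun t => Derive (fun v => F v t) s) 0 1 (Re (k * (h * f (z + s * h)))%C)).
  { apply (is_RInt_ext (fun t => Q z h k (s, t))).
    { rewrite Rmin_left, Rmax_right by lra. intros t Ht. symmetry. apply is_derive_unique.
      apply prim_integrand_der, HD1. lra. }
    set (w := (z + s * h)%C).
    (* The right-hand side is the increment from t = 0 to t = 1 of Re (k h t f(t w)), with t written
       as 0 + t 1 to fit [Cder_line]. *)
    replace (Re (k * (h * f w))%C) with
      (minus (Re ((k * h) * ((0 + 1%R * 1) * f ((0 + 1%R * 1) * w)))%C)
             (Re ((k * h) * ((0 + 0%R * 1) * f ((0 + 0%R * 1) * w)))%C)).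
    2:{ rewrite Cplus_0_l, !Cmult_1_l.
        replace (k * h * ((0 + 0 * 1) * f ((0 + 0 * 1) * w)))%C with (RtoC 0) by ring.
        unfold minus, plus, opp. simpl. rewrite Ropp_0, Rplus_0_r.
        unfold Re. simpl. ring. }
    apply (is_RInt_derive (fun t : R => Re ((k * h) * ((0 + t * 1) * f ((0 + t * 1) * w)))%C)).
    - rewrite Rmin_left, Rmax_right by lra. intros t Ht.
      eapply is_derive_val; [apply (Cder_line (fun x => x * f (x * w))%C 0 1 (k * h))|].
      { eapply Cder_mult; [apply Cder_id|].
          apply (Cder_comp f (fun x => x * w)%C).
          - apply Hf. rewrite Cplus_0_l, Cmult_1_r. apply HD1. exact Ht.
          - apply (Cder_mult (fun x => x) (fun _ => w)); [apply Cder_id|apply Cder_const]. }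
      unfold Q. cbn [fst snd]. fold w. rewrite Cplus_0_l, !Cmult_1_r. f_equal. ring.
    - rewrite Rmin_left, Rmax_right by lra. intros t Ht.
      apply continuous_snd_section. apply prim_line_cont. apply HD1. exact Ht. }
  rewrite <- (is_RInt_unique _ _ _ _ HI).
  apply (is_derive_RInt_param F).
  - eapply filter_imp; [|exact Hloc]. intros v Hv t Ht.
    rewrite Rmin_left, Rmax_right in Ht by lra.
    eexists. apply prim_integrand_der. apply Dstar; assumption.
  - rewrite Rmin_left, Rmax_right by lra. intros t Ht.
    apply (continuity_2d_pt_ext_loc (fun u v => Q z h k (u, v))).
    + eapply locally_2d_impl; [|apply (Hloc2 t (HD1 t Ht))].
      apply locally_2d_forall. intros u v Huv. symmetry. apply is_derive_unique.
      apply prim_integrand_der, Huv.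
    + apply continuity_2d_pt_filterlim.
      eapply filterlim_ext; [|apply (prim_line_cont z h k s t (HD1 t Ht))].
      intros [u v]. reflexivity.
  - eapply filter_imp; [|exact Hloc]. intros v Hv. apply (ex_RInt_continuous (V := R_CompleteNormedModule)).
    rewrite Rmin_left, Rmax_right by lra. intros t Ht. apply prim_integrand_cont; assumption.
Qed.

Lemma prim_Cder (z : C) : D z -> Cder (prim f) z (f z).
Proof.
  intros Hz. apply Cder_eps. intros e He.
  destruct (Dopen _ Hz) as (d1 & Hd1 & HD1).
  destruct (proj1 (Ccont_eps f z) (Cder_cont _ _ _ (proj1 (Hf z Hz))) (e / 2)) as (d2 & Hd2 & HC2);
    [lra|].
  exists (Rmin d1 d2). split; [apply Rmin_glb_lt; assumption|].
  intros y Hy. set (h := (y - z)%C) in *.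
  assert (Hs : forall s : R, 0 <= s <= 1 -> D (z + s * h)%C /\ Cmod (f (z + s * h) - f z) < e / 2).
  { intros s Hs.
    assert (Cmod (z + s * h - z) < Rmin d1 d2).
    { replace (z + s * h - z)%C with (s * h)%C by ring.
      rewrite Cmod_mult, Cmod_R, Rabs_pos_eq by lra. pose proof (Cmod_ge_0 h). nra. }
    split.
    - apply HD1. eapply Rlt_le_trans; [exact H|apply Rmin_l].
    - apply HC2. eapply Rlt_le_trans; [exact H|apply Rmin_r]. }
  (* The mean value point depends on k, so the real part (k = 1) and the imaginary part (k = - i)
     are estimated separately, each with half of e. *)
  assert (Hk : forall k : C, Cmod k = 1 ->
    Rabs (RInt (fun t : R => Re (k * (y * f (t * y)))%C) 0 1
          - RInt (fun t : R => Re (k * (z * f (t * z)))%C) 0 1 - Re (k * (h * f z))%C) <= e / 2 * Cmod h).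
  { intros k Hk.
    set (phi := fun v : R => RInt (fun t : R => Re (k * ((z + v * h) * f (t * (z + v * h))))%C) 0 1).
    destruct (MVT_gen phi 0 1 (fun s => Re (k * (h * f (z + s * h)))%C)) as (s & Hs1 & Hs2).
    - rewrite Rmin_left, Rmax_right by lra. intros s Hs1. apply prim_line, Hs. lra.
    - rewrite Rmin_left, Rmax_right by lra. intros s Hs1.
      eapply is_derive_continuity_pt. apply prim_line, Hs. lra.
    - rewrite Rmin_left, Rmax_right in Hs1 by lra.
      assert (E1 : phi 1 = RInt (fun t : R => Re (k * (y * f (t * y)))%C) 0 1).
      { unfold phi. replace (z + 1%R * h)%C with y by (unfold h; ring). reflexivity. }
      assert (E0 : phi 0 = RInt (fun t : R => Re (k * (z * f (t * z)))%C) 0 1).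
      { unfold phi. replace (z + 0%R * h)%C with z by ring. reflexivity. }
      rewrite <- E1, <- E0, Hs2.
      replace (Re (k * (h * f (z + s * h)))%C * (1 - 0) - Re (k * (h * f z))%C)
        with (Re (k * (h * (f (z + s * h) - f z)))%C).
      2:{ destruct (f (z + s * h)%C), (f z), k, h. unfold Re; simpl. ring. }
      eapply Rle_trans; [apply re_le_Cmod|]. rewrite !Cmod_mult, Hk, Rmult_1_l, Rmult_comm.
      apply Rmult_le_compat_r; [apply Cmod_ge_0|]. left. apply Hs, Hs1. }
  set (dd := (prim f y - prim f z - h * f z)%C).
  assert (HRe : Rabs (Re dd) <= e / 2 * Cmod h).
  { eapply Rle_trans; [|apply (Hk 1 Cmod_1)]. right. f_equal.
    change (Re dd) with (RInt (fun u : R => Re (y * f (u * y))%C) 0 1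
      - RInt (fun u : R => Re (z * f (u * z))%C) 0 1 - Re (h * f z)%C).
    rewrite Cmult_1_l. f_equal. f_equal; apply RInt_ext; intros; f_equal; ring. }
  assert (HIm : Rabs (Im dd) <= e / 2 * Cmod h).
  { eapply Rle_trans; [|apply (Hk (- Ci)%C)].
    2:{ rewrite Cmod_opp. apply Cmod_Ci. }
    right. f_equal.
    assert (EI : forall c : C, Re (- Ci * c)%C = Im c).
    { intros [p q]. unfold Re, Im, Ci. simpl. ring. }
    change (Im dd) with (RInt (fun u : R => Im (y * f (u * y))%C) 0 1
      - RInt (fun u : R => Im (z * f (u * z))%C) 0 1 - Im (h * f z)%C).
    rewrite EI. f_equal. f_equal; apply RInt_ext; intros; symmetry; apply EI. }
  replace dd with (RtoC (Re dd) + Ci * RtoC (Im dd))%C.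
  2:{ destruct dd as [p q]. unfold Re, Im, Ci, RtoC, Cplus, Cmult. simpl. f_equal; ring. }
  eapply Rle_trans; [apply Cmod_triangle|]. rewrite Cmod_mult, Cmod_Ci, !Cmod_R. lra.
Qed.

Lemma prim_ex_RInt (k z : C) : D z -> ex_RInt (fun t : R => Re (k * (z * f (t * z)))%C) 0 1.
Proof.
  intros Hz. apply (ex_RInt_continuous (V := R_CompleteNormedModule)).
  rewrite Rmin_left, Rmax_right by lra. intros t Ht. apply prim_integrand_cont; assumption.
Qed.

Lemma prim_conj (z : C) :
  (forall y, D y -> f (Cconj y) = Cconj (f y)) -> D z -> prim f (Cconj z) = Cconj (prim f z).
Proof.
  intros Hc Hz.
  assert (E : forall u : R, 0 < u < 1 -> (Cconj z * f (u * Cconj z))%C = Cconj (z * f (u * z))%C).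
  { intros u Hu. replace (u * Cconj z)%C with (Cconj (u * z)%C).
    - rewrite Hc by (apply Dstar; [exact Hz|lra]). destruct z, (f (u * (r, r0))%C).
      unfold Cconj, Cmult. simpl. f_equal; ring.
    - destruct z. unfold Cconj, Cmult, RtoC. simpl. f_equal; ring. }
  unfold prim. change (Cconj (?a, ?b)) with (a, - b). f_equal.
  - apply RInt_ext. rewrite Rmin_left, Rmax_right by lra. intros u Hu. rewrite E by exact Hu. reflexivity.
  - rewrite <- (RInt_opp (V := R_CompleteNormedModule)).
    + apply RInt_ext. rewrite Rmin_left, Rmax_right by lra. intros u Hu. rewrite E by exact Hu. reflexivity.
    + apply (ex_RInt_ext (fun t : R => Re (- Ci * (z * f (t * z)))%C)).
      * intros u _. unfold Re, Im, Ci. simpl. ring.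
      * apply prim_ex_RInt, Hz.
Qed.

Lemma prim_odd (z : C) :
  (forall y, D y -> f (- y) = f y) -> D z -> prim f (- z)%C = (- prim f z)%C.
Proof.
  intros Hc Hz.
  assert (E : forall u : R, 0 < u < 1 -> (- z * f (u * - z))%C = (- (z * f (u * z)))%C).
  { intros u Hu. replace (u * - z)%C with (- (u * z))%C by ring.
    rewrite Hc by (apply Dstar; [exact Hz|lra]). ring. }
  unfold prim. change (Copp (?a, ?b)) with (- a, - b). f_equal.
  - rewrite <- (RInt_opp (V := R_CompleteNormedModule)).
    + apply RInt_ext. rewrite Rmin_left, Rmax_right by lra. intros u Hu. rewrite E by exact Hu. reflexivity.
    + apply (ex_RInt_ext (fun t : R => Re (1 * (z * f (t * z)))%C)).
      * intros u _. f_equal. ring.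
      * apply prim_ex_RInt, Hz.
  - rewrite <- (RInt_opp (V := R_CompleteNormedModule)).
    + apply RInt_ext. rewrite Rmin_left, Rmax_right by lra. intros u Hu. rewrite E by exact Hu. reflexivity.
    + apply (ex_RInt_ext (fun t : R => Re (- Ci * (z * f (t * z)))%C)).
      * intros u _. unfold Re, Im, Ci. simpl. ring.
      * apply prim_ex_RInt, Hz.
Qed.

End Primitive.

(** * Complex square root and hyperbolic functions *)

Lemma Ceq (z w : C) : Re z = Re w -> Im z = Im w -> z = w.
Proof. destruct z, w. unfold Re, Im. simpl. intros; subst; reflexivity. Qed.

Ltac Cparts := apply Ceq; unfold Re, Im, Ci; simpl; ring.

Lemma Cmod_sqr (z : C) : Cmod z * Cmod z = Re z * Re z + Im z * Im z.
Proof. pose proof (Cmod2_alt z) as H. simpl in H. lra. Qed.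

Lemma Cmod_tri_inv (z w : C) : Cmod z <= Cmod w + Cmod (z - w).
Proof. pose proof (Cmod_triangle w (z - w)). replace (w + (z - w))%C with z in H by ring. exact H. Qed.

Lemma Cmod_sym (z w : C) : Cmod (z - w) = Cmod (w - z).
Proof. rewrite <- Cmod_opp. f_equal. ring. Qed.

Lemma Cmod_le_abs (z : C) : Cmod z <= Rabs (Re z) + Rabs (Im z).
Proof.
  pose proof (Cmod_sqr z). pose proof (Cmod_ge_0 z).
  pose proof (Rabs_pos (Re z)). pose proof (Rabs_pos (Im z)).
  assert (Rabs (Re z) * Rabs (Re z) = Re z * Re z) by (rewrite <- Rabs_mult; apply Rabs_pos_eq; nra).
  assert (Rabs (Im z) * Rabs (Im z) = Im z * Im z) by (rewrite <- Rabs_mult; apply Rabs_pos_eq; nra).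
  nra.
Qed.

Lemma im_le_Cmod (z : C) : Rabs (Im z) <= Cmod z.
Proof. eapply Rle_trans; [apply Rmax_r|apply Rmax_Cmod]. Qed.

Lemma Re_pos_neq0 (z : C) : 0 < Re z -> z <> 0.
Proof. intros H E. subst. unfold Re in H. simpl in H. lra. Qed.

(** The plane without the closed negative real axis, stated through the quantity that appears under
    the root in [csqrt] and in the denominator in [ArgP]. *)
Definition slit (z : C) : Prop := 0 < Cmod z + Re z.

Lemma slit_Re (z : C) : 0 < Re z -> slit z.
Proof. intros H. unfold slit. pose proof (Cmod_ge_0 z). lra. Qed.

Lemma slit_intro (z : C) : (Im z = 0 -> 0 < Re z) -> slit z.
Proof.
  intros H. unfold slit. destruct (Req_dec (Im z) 0) as [E|E].
  - pose proof (Cmod_ge_0 z). specialize (H E). lra.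
  - pose proof (Cmod_sqr z). pose proof (Cmod_ge_0 z). assert (0 < Im z * Im z) by nra. nra.
Qed.

Lemma slit_open (z : C) : slit z -> exists e, 0 < e /\ forall y, Cmod (y - z) < e -> slit y.
Proof.
  unfold slit. intros H. exists ((Cmod z + Re z) / 2). split; [lra|]. intros y Hy.
  pose proof (Cmod_tri_inv z y). rewrite Cmod_sym in H0.
  pose proof (re_le_Cmod (y - z)). apply Rabs_le_between in H1.
  change (Re (y - z)%C) with (Re y - Re z) in H1. lra.
Qed.

(** The principal branch by the half-angle formula; on [slit] it is the root with positive real
    part. *)
Definition csqrt (z : C) : C :=
  let r := sqrt ((Cmod z + Re z) / 2) in (r, Im z / (2 * r)).

Lemma csqrt_Re_pos (z : C) : slit z -> 0 < Re (csqrt z).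
Proof. intros H. unfold csqrt, Re at 1. simpl. apply sqrt_lt_R0. unfold slit in H. lra. Qed.

Lemma csqrt_neq0 (z : C) : slit z -> csqrt z <> 0.
Proof. intros H. apply Re_pos_neq0, csqrt_Re_pos, H. Qed.

Lemma csqrt_sqr (z : C) : slit z -> (csqrt z * csqrt z)%C = z.
Proof.
  intros H. pose proof (csqrt_Re_pos z H) as Hr.
  unfold slit in H.
  assert (Es : Re (csqrt z) * Re (csqrt z) = (Cmod z + Re z) / 2).
  { unfold csqrt, Re at 1 2. simpl. apply sqrt_sqrt. lra. }
  assert (Ei : Im (csqrt z) = Im z / (2 * Re (csqrt z))) by reflexivity.
  set (r := Re (csqrt z)) in *.
  assert (Ei2 : r * Im (csqrt z) = Im z / 2) by (rewrite Ei; field; lra).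
  pose proof (Cmod_sqr z).
  assert (E4 : 4 * (Im (csqrt z) * Im (csqrt z)) * (r * r) = Im z * Im z).
  { transitivity ((2 * (r * Im (csqrt z))) * (2 * (r * Im (csqrt z)))); [ring|].
    rewrite Ei2. field. }
  apply Ceq.
  - change (Re (csqrt z * csqrt z)%C) with (r * r - Im (csqrt z) * Im (csqrt z)).
    rewrite Es in *. nra.
  - change (Im (csqrt z * csqrt z)%C) with (r * Im (csqrt z) + Im (csqrt z) * r). lra.
Qed.

Lemma csqrt_unique (z w : C) : slit z -> 0 < Re w -> (w * w)%C = z -> csqrt z = w.
Proof.
  intros H Hw E. pose proof (csqrt_Re_pos z H). pose proof (csqrt_sqr z H).
  apply Ceq_minus. destruct (Ceq_dec (csqrt z - w)%C 0) as [E0|E0]; [exact E0|].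
  exfalso. apply (Cmult_neq_0 (csqrt z - w)%C (csqrt z + w)%C E0).
  - apply Re_pos_neq0. change (0 < Re (csqrt z) + Re w). lra.
  - replace ((csqrt z - w) * (csqrt z + w))%C with (csqrt z * csqrt z - w * w)%C by ring.
    rewrite H1, E. ring.
Qed.

Lemma csqrt_R (x : R) : 0 < x -> csqrt x = RtoC (sqrt x).
Proof.
  intros H. apply csqrt_unique.
  - apply slit_Re. exact H.
  - apply sqrt_lt_R0, H.
  - rewrite <- RtoC_mult, sqrt_sqrt by lra. reflexivity.
Qed.

Lemma csqrt_conj (z : C) : csqrt (Cconj z) = Cconj (csqrt z).
Proof.
  unfold csqrt. rewrite Cmod_conj. unfold Cconj, Re, Im. simpl. f_equal.
  unfold Rdiv. ring.
Qed.

Lemma csqrt_Im_pos (z : C) : 0 < Im z -> 0 < Im (csqrt z).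
Proof.
  intros H. assert (Hs : slit z) by (apply slit_intro; lra).
  pose proof (csqrt_Re_pos z Hs). change (Im (csqrt z)) with (Im z / (2 * Re (csqrt z))).
  apply Rdiv_lt_0_compat; lra.
Qed.

(** With q and s the roots of y and z one has y - z = (q - s)(q + s), and the error is - (y - z)^2 /
    (2 s (q + s)^2). Both |s| and |q + s| are at least r = Re s, because roots have positive real
    part. *)
Lemma csqrt_Cder (z : C) : slit z -> Cder csqrt z (/ (2 * csqrt z))%C.
Proof.
  intros H. apply Cder_eps. intros e He.
  destruct (slit_open z H) as (d & Hd & Hd').
  pose proof (csqrt_Re_pos z H) as Hr. set (s := csqrt z) in *. set (r := Re s) in *.
  assert (0 < r * r) by nra. assert (0 < r * r * r) by nra.
  exists (Rmin d (e * (r * r * r))). split; [apply Rmin_glb_lt; nra|].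
  intros y Hy.
  assert (H2 : slit y) by (apply Hd'; eapply Rlt_le_trans; [exact Hy|apply Rmin_l]).
  assert (H3 : Cmod (y - z) < e * (r * r * r)) by (eapply Rlt_le_trans; [exact Hy|apply Rmin_r]).
  pose proof (csqrt_Re_pos y H2) as Hq.
  assert (Eq : (csqrt y * csqrt y)%C = y) by (apply csqrt_sqr, H2).
  assert (Es : (s * s)%C = z) by (apply csqrt_sqr, H).
  set (q := csqrt y) in *.
  assert (Hsum : r <= Cmod (q + s)).
  { eapply Rle_trans; [|apply re_le_Cmod]. change (Re (q + s)%C) with (Re q + r).
    rewrite Rabs_pos_eq; lra. }
  assert (Hs : r <= Cmod s) by (eapply Rle_trans; [|apply re_le_Cmod]; rewrite Rabs_pos_eq; fold r; lra).
  assert (N1 : (q + s)%C <> 0) by (apply (proj2 (Cmod_gt_0 _)); lra).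
  assert (N2 : s <> 0) by (apply (proj2 (Cmod_gt_0 _)); lra).
  assert (N3 : RtoC 2 <> 0) by (intros E; apply RtoC_inj in E; lra).
  assert (EE : (q - s - (y - z) * / (2 * s) = (y - z) * (- (y - z) / (2 * s * ((q + s) * (q + s)))))%C).
  { rewrite <- Eq, <- Es. field. repeat split; assumption. }
  rewrite EE, Cmod_mult, Rmult_comm. apply Rmult_le_compat_r; [apply Cmod_ge_0|].
  rewrite Cmod_div by (repeat apply Cmult_neq_0; assumption).
  rewrite Cmod_opp, !Cmod_mult, Cmod_R, Rabs_pos_eq by lra.
  set (a := Cmod (q + s)) in *. set (b := Cmod s) in *.
  assert (r * r <= a * a) by nra. assert (r * (r * r) <= b * (a * a)) by (apply Rmult_le_compat; nra).
  apply Rle_div_l; nra.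
Qed.

Lemma C1_csqrt : C1_on slit csqrt.
Proof.
  exists (fun z => / (2 * csqrt z))%C. intros z Hz. split; [apply csqrt_Cder, Hz|].
  apply (Ccont_inv (fun z => 2 * csqrt z)%C).
  - apply Ccont_mult; [apply Ccont_const|]. eapply Cder_cont, csqrt_Cder, Hz.
  - apply Cmult_neq_0; [|apply csqrt_neq0, Hz]. intros E; apply RtoC_inj in E; lra.
Qed.

Definition cexp (z : C) : C := (exp (Re z) * cos (Im z), exp (Re z) * sin (Im z)).

Lemma cexp_plus (z w : C) : cexp (z + w) = (cexp z * cexp w)%C.
Proof.
  unfold cexp. change (Re (z + w)%C) with (Re z + Re w). change (Im (z + w)%C) with (Im z + Im w).
  rewrite exp_plus, cos_plus, sin_plus. unfold Cmult. simpl. f_equal; ring.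
Qed.

Lemma cexp_0 : cexp 0 = 1.
Proof. unfold cexp, Re, Im. simpl. rewrite exp_0, cos_0, sin_0. unfold RtoC. f_equal; ring. Qed.

Lemma is_derive_eps (f : R -> R) (l : R) : is_derive f 0 l ->
  forall e, 0 < e -> exists d, 0 < d /\ forall x, Rabs x < d -> Rabs (f x - f 0 - x * l) <= e * Rabs x.
Proof.
  intros [_ H] e He.
  destruct (H 0 (fun P HP => HP) (mkposreal e He)) as [d Hd].
  exists d. split; [apply cond_pos|]. intros x Hx.
  assert (Hb : ball 0 d x) by (unfold ball; simpl; unfold AbsRing_ball; simpl;
    unfold minus, plus, opp, abs; simpl; rewrite Ropp_0, Rplus_0_r; exact Hx).
  specialize (Hd x Hb). unfold norm, minus, plus, opp, scal, mult, abs in Hd. simpl in Hd.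
  unfold mult in Hd. simpl in Hd. unfold abs in Hd. simpl in Hd.
  rewrite Ropp_0, Rplus_0_r in Hd. exact Hd.
Qed.

Lemma cexp_Cder_0 : Cder cexp 0 1.
Proof.
  apply Cder_eps. intros e He.
  destruct (is_derive_eps exp 1) with (e := e / 6) as (d1 & Hd1 & H1).
  { eapply is_derive_val; [apply is_derive_Reals, derivable_pt_lim_exp|]. apply exp_0. } { lra. }
  destruct (is_derive_eps cos 0) with (e := e / 12) as (d2 & Hd2 & H2).
  { eapply is_derive_val; [apply is_derive_Reals, derivable_pt_lim_cos|]. rewrite sin_0. ring. } { lra. }
  destruct (is_derive_eps sin 1) with (e := e / 12) as (d3 & Hd3 & H3).
  { eapply is_derive_val; [apply is_derive_Reals, derivable_pt_lim_sin|]. apply cos_0. } { lra. }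
  rewrite exp_0 in H1. rewrite cos_0 in H2. rewrite sin_0 in H3.
  (* The last two conditions give |e^x - 1| <= e / 6 and e^x <= 2. The errors of the two components
     then add up to at most 2 e / 3 times |y|. *)
  assert (Hd : exists d,
    0 < d /\ d <= d1 /\ d <= d2 /\ d <= d3 /\ d * (1 + e / 6) <= e / 6 /\ d * (1 + e/6) <= 1).
  { exists (Rmin (Rmin d1 (Rmin d2 d3)) (Rmin (e / 6 / (1 + e / 6)) (/ (1 + e / 6)))).
    assert (0 < 1 + e / 6) by lra.
    split; [|repeat split].
    - repeat apply Rmin_glb_lt; try assumption.
      + apply Rdiv_lt_0_compat; lra.
      + apply Rinv_0_lt_compat; lra.
    - eapply Rle_trans; [apply Rmin_l|apply Rmin_l].
    - eapply Rle_trans; [apply Rmin_l|]. eapply Rle_trans; [apply Rmin_r|apply Rmin_l].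
    - eapply Rle_trans; [apply Rmin_l|]. eapply Rle_trans; [apply Rmin_r|apply Rmin_r].
    - apply Rle_div_r; [assumption|]. eapply Rle_trans; [apply Rmin_r|apply Rmin_l].
    - apply Rle_div_r; [assumption|]. eapply Rle_trans; [apply Rmin_r|].
      eapply Rle_trans; [apply Rmin_r|]. right. field. lra. }
  destruct Hd as (d & Hd0 & Hda & Hdb & Hdc & Hdd & Hde).
  exists d. split; [exact Hd0|]. intros y Hy.
  rewrite cexp_0. replace (y - 0)%C with y in * by ring. rewrite Cmult_1_r.
  pose proof (re_le_Cmod y) as Rx. pose proof (im_le_Cmod y) as Ry.
  set (x := Re y) in *. set (v := Im y) in *. set (M := Cmod y) in *.
  specialize (H1 x ltac:(lra)). specialize (H2 v ltac:(lra)). specialize (H3 v ltac:(lra)).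
  pose proof (Rabs_pos x). pose proof (Rabs_pos v).
  assert (HE : Rabs (exp x - 1) <= (1 + e / 6) * M).
  { replace (exp x - 1) with ((exp x - 1 - x * 1) + x) by ring.
    eapply Rle_trans; [apply Rabs_triang|]. nra. }
  assert (HE2 : exp x <= 2) by (apply Rabs_le_between in HE; nra).
  pose proof (exp_pos x).
  eapply Rle_trans; [apply Cmod_le_abs|].
  change (Re (cexp y - 1 - y)%C) with (exp x * cos v - 1 - x).
  change (Im (cexp y - 1 - y)%C) with (exp x * sin v + -0 - v).
  assert (Rabs (exp x * cos v - 1 - x) <= e / 6 * M + 2 * (e / 12 * M)).
  { replace (exp x * cos v - 1 - x) with ((exp x - 1 - x * 1) + exp x * (cos v - 1 - v * 0)) by ring.
    eapply Rle_trans; [apply Rabs_triang|]. rewrite Rabs_mult, (Rabs_pos_eq (exp x)) by lra.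
    apply Rplus_le_compat; [nra|]. apply Rmult_le_compat; try apply Rabs_pos; nra. }
  assert (Rabs (exp x * sin v + -0 - v) <= 2 * (e / 12 * M) + M * (e / 6)).
  { replace (exp x * sin v + -0 - v) with (exp x * (sin v - 0 - v * 1) + v * (exp x - 1)) by ring.
    eapply Rle_trans; [apply Rabs_triang|]. rewrite !Rabs_mult, (Rabs_pos_eq (exp x)) by lra.
    apply Rplus_le_compat.
    - apply Rmult_le_compat; try apply Rabs_pos; nra.
    - apply Rmult_le_compat; try apply Rabs_pos; nra. }
  assert (0 <= e * M) by (apply Rmult_le_pos; [lra|apply Cmod_ge_0]).
  lra.
Qed.

Lemma cexp_Cder (z : C) : Cder cexp z (cexp z).
Proof.
  apply Cder_eps. intros e He.
  pose proof (Cmod_ge_0 (cexp z)) as Hp.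
  destruct (proj1 (Cder_eps _ _ _) cexp_Cder_0 (e / (Cmod (cexp z) + 1))) as (d & Hd & H).
  { apply Rdiv_lt_0_compat; lra. }
  exists d. split; [exact Hd|]. intros y Hy.
  specialize (H (y - z)%C). replace (y - z - 0)%C with (y - z)%C in H by ring.
  specialize (H Hy). rewrite cexp_0, Cmult_1_r in H.
  assert (E : cexp y = (cexp z * cexp (y - z))%C) by (rewrite <- cexp_plus; f_equal; ring).
  replace (cexp y - cexp z - (y - z) * cexp z)%C with (cexp z * (cexp (y - z) - 1 - (y - z)))%C
    by (rewrite E; ring).
  rewrite Cmod_mult. eapply Rle_trans; [apply Rmult_le_compat_l; [apply Cmod_ge_0|exact H]|].
  rewrite <- Rmult_assoc. apply Rmult_le_compat_r; [apply Cmod_ge_0|].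
  replace (Cmod (cexp z) * (e / (Cmod (cexp z) + 1))) with ((Cmod (cexp z) * e) / (Cmod (cexp z) + 1))
    by (field; lra).
  apply Rle_div_l; nra.
Qed.

Definition ccosh (z : C) : C := (cosh (Re z) * cos (Im z), sinh (Re z) * sin (Im z)).
Definition csinh (z : C) : C := (sinh (Re z) * cos (Im z), cosh (Re z) * sin (Im z)).

Lemma ccosh_exp (z : C) : ccosh z = (/ 2 * (cexp z + cexp (- z)))%C.
Proof.
  unfold ccosh, cexp, cosh, sinh. change (Re (- z)%C) with (- Re z). change (Im (- z)%C) with (- Im z).
  rewrite cos_neg, sin_neg. apply Ceq; unfold Re, Im; simpl; field.
Qed.

Lemma csinh_exp (z : C) : csinh z = (/ 2 * (cexp z - cexp (- z)))%C.
Proof.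
  unfold csinh, cexp, cosh, sinh. change (Re (- z)%C) with (- Re z). change (Im (- z)%C) with (- Im z).
  rewrite cos_neg, sin_neg. apply Ceq; unfold Re, Im; simpl; field.
Qed.

Lemma Cder_ext (f g : C -> C) (z l : C) : (forall x, f x = g x) -> Cder f z l -> Cder g z l.
Proof. intros H. apply (is_derive_ext (K := C_AbsRing) (V := AbsRing_NormedModule C_AbsRing)). exact H. Qed.

Lemma ccosh_Cder (z : C) : Cder ccosh z (csinh z).
Proof.
  apply (Cder_ext (fun z => / 2 * (cexp z + cexp (- z)))%C); [intros; symmetry; apply ccosh_exp|].
  eapply Cder_val.
  - apply Cder_scal, Cder_plus; [apply cexp_Cder|].
    apply (Cder_comp cexp Copp); [apply cexp_Cder|]. apply (Cder_opp (fun x => x)), Cder_id.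
  - rewrite csinh_exp. ring.
Qed.

Lemma csinh_Cder (z : C) : Cder csinh z (ccosh z).
Proof.
  apply (Cder_ext (fun z => / 2 * (cexp z - cexp (- z)))%C); [intros; symmetry; apply csinh_exp|].
  eapply Cder_val.
  - apply Cder_scal, Cder_minus; [apply cexp_Cder|].
    apply (Cder_comp cexp Copp); [apply cexp_Cder|]. apply (Cder_opp (fun x => x)), Cder_id.
  - rewrite ccosh_exp. ring.
Qed.

Lemma C1_ccosh (D : C -> Prop) : C1_on D ccosh.
Proof.
  exists csinh. intros z _. split; [apply ccosh_Cder|]. eapply Cder_cont, csinh_Cder.
Qed.

Lemma C1_csinh (D : C -> Prop) : C1_on D csinh.
Proof.
  exists ccosh. intros z _. split; [apply csinh_Cder|]. eapply Cder_cont, ccosh_Cder.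
Qed.

Lemma ccosh_sqr (z : C) : (ccosh z * ccosh z)%C = (1 + csinh z * csinh z)%C.
Proof.
  assert (E : (cexp z * cexp (- z))%C = 1).
  { rewrite <- cexp_plus, <- cexp_0. f_equal. ring. }
  rewrite ccosh_exp, csinh_exp.
  transitivity (/ 2 * (cexp z - cexp (- z)) * (/ 2 * (cexp z - cexp (- z))) + cexp z * cexp (- z))%C.
  - field.
  - rewrite E. ring.
Qed.

Lemma cosh2_sinh2 (x : R) : cosh x * cosh x = 1 + sinh x * sinh x.
Proof.
  unfold cosh, sinh. assert (E : exp x * exp (- x) = 1) by (rewrite <- exp_plus, Rplus_opp_r; apply exp_0).
  nra.
Qed.

Lemma sinh_odd (x : R) : sinh (- x) = - sinh x.
Proof. unfold sinh. rewrite Ropp_involutive. lra. Qed.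

Lemma cosh_gt_0 (x : R) : 0 < cosh x.
Proof. unfold cosh. pose proof (exp_pos x). pose proof (exp_pos (- x)). lra. Qed.

Lemma sinh_gt_0 (x : R) : 0 < x -> 0 < sinh x.
Proof. intros H. unfold sinh. pose proof (exp_increasing (- x) x). lra. Qed.

Lemma sinh_ge_id (x : R) : 0 <= x -> x <= sinh x.
Proof.
  intros H. destruct (Req_dec x 0) as [->|Hx]; [rewrite sinh_0; lra|].
  destruct (MVT_gen sinh 0 x cosh) as (c & Hc & E).
  - intros; apply is_derive_Reals, derivable_pt_lim_sinh.
  - intros. eapply is_derive_continuity_pt; apply is_derive_Reals, derivable_pt_lim_sinh.
  - rewrite sinh_0 in E. pose proof (cosh2_sinh2 c). pose proof (cosh_gt_0 c).
    assert (1 <= cosh c) by nra. nra.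
Qed.

Lemma ccosh_opp (z : C) : ccosh (- z) = ccosh z.
Proof. rewrite !ccosh_exp. replace (- - z)%C with z by ring. ring. Qed.

Lemma ccosh_conj (z : C) : ccosh (Cconj z) = Cconj (ccosh z).
Proof.
  unfold ccosh, Cconj, Re, Im. simpl. rewrite cos_neg, sin_neg. f_equal. ring.
Qed.

Lemma csinh_conj (z : C) : csinh (Cconj z) = Cconj (csinh z).
Proof.
  unfold csinh, Cconj, Re, Im. simpl. rewrite cos_neg, sin_neg. f_equal. ring.
Qed.

Definition ipi2 : C := (0, PI / 2).

Lemma ccosh_shift (u : C) : ccosh (ipi2 + u) = (Ci * csinh u)%C.
Proof.
  unfold ccosh, csinh. change (Re (ipi2 + u)%C) with (0 + Re u).
  change (Im (ipi2 + u)%C) with (PI / 2 + Im u).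
  rewrite Rplus_0_l, cos_plus, sin_plus, cos_PI2, sin_PI2. Cparts.
Qed.

Lemma csinh_shift (u : C) : csinh (ipi2 + u) = (Ci * ccosh u)%C.
Proof.
  unfold ccosh, csinh. change (Re (ipi2 + u)%C) with (0 + Re u).
  change (Im (ipi2 + u)%C) with (PI / 2 + Im u).
  rewrite Rplus_0_l, cos_plus, sin_plus, cos_PI2, sin_PI2. Cparts.
Qed.

(** * Openness and surjectivity on rectangles *)

(** The mean value theorem holds only for one real component at a time, and k selects it. Taking k
    conjugate to f b - f a gives the norm bound [Cmvt_le]; taking k = - i / (b - a) gives
    injectivity when Im f' > 0. *)
Lemma Cmvt (f f' : C -> C) (a b k : C) :
  (forall u : R, 0 <= u <= 1 -> Cder f (a + u * (b - a))%C (f' (a + u * (b - a))%C)) ->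
  exists u : R, 0 < u < 1 /\
    Re (k * (f b - f a))%C = Re (k * (f' (a + u * (b - a)) * (b - a)))%C.
Proof.
  intros H.
  destruct (MVT_cor2 (fun u : R => Re (k * f (a + u * (b - a)))%C)
    (fun u => Re (k * (f' (a + u * (b - a)) * (b - a)))%C) 0 1) as (u & Hu & Hu').
  - lra.
  - intros u Hu. apply is_derive_Reals, (Cder_line f a (b - a) k), H, Hu.
  - exists u. split; [exact Hu'|].
    replace (a + 1%R * (b - a))%C with b in Hu by ring.
    replace (a + 0%R * (b - a))%C with a in Hu by ring.
    rewrite Rminus_0_r, Rmult_1_r in Hu. rewrite <- Hu.
    destruct k, (f b), (f a). unfold Re; simpl. ring.
Qed.

Lemma Cmvt_le (f f' : C -> C) (a b : C) (M : R) :
  (forall u : R, 0 <= u <= 1 -> Cder f (a + u * (b - a))%C (f' (a + u * (b - a))%C)) ->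
  (forall u : R, 0 < u < 1 -> Cmod (f' (a + u * (b - a))%C) <= M) ->
  Cmod (f b - f a) <= M * Cmod (b - a).
Proof.
  intros H HM. set (w := (f b - f a)%C).
  destruct (Cmvt f f' a b (Cconj w) H) as (u & Hu & E). fold w in E.
  assert (E1 : Re (Cconj w * w)%C = Cmod w * Cmod w).
  { rewrite Cmod_sqr. destruct w. unfold Re, Im; simpl. ring. }
  rewrite E1 in E.
  assert (Hle : Cmod w * Cmod w <= Cmod w * (M * Cmod (b - a))).
  { rewrite E. eapply Rle_trans; [apply Rle_abs|]. eapply Rle_trans; [apply re_le_Cmod|].
    rewrite !Cmod_mult, Cmod_conj. apply Rmult_le_compat_l; [apply Cmod_ge_0|].
    apply Rmult_le_compat_r; [apply Cmod_ge_0|]. apply HM, Hu. }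
  destruct (Req_dec (Cmod w) 0) as [E0|E0].
  - rewrite E0. apply Rmult_le_pos; [|apply Cmod_ge_0].
    eapply Rle_trans; [apply Cmod_ge_0|apply (HM (1 / 2)); lra].
  - pose proof (Cmod_ge_0 w). apply Rmult_le_reg_l with (Cmod w); lra.
Qed.

(** The map y -> f y - y f'(z) has derivative f' - f'(z), which is small near z; the mean value
    inequality makes it a contraction with factor e. *)
Lemma strict_derivative (f f' : C -> C) (z : C) (r e : R) :
  0 < r -> 0 < e -> (forall y, Cmod (y - z) < r -> Cder f y (f' y)) -> Ccont f' z ->
  exists d, 0 < d <= r /\ forall a b, Cmod (a - z) < d -> Cmod (b - z) < d ->
    Cmod (f b - f a - (b - a) * f' z) <= e * Cmod (b - a).
Proof.
  intros Hr He Hf Hc. destruct (proj1 (Ccont_eps _ _) Hc e He) as (d & Hd & H).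
  exists (Rmin r d). split; [split; [apply Rmin_glb_lt; assumption|apply Rmin_l]|].
  intros a b Ha Hb.
  assert (Hseg : forall u : R, 0 <= u <= 1 -> Cmod (a + u * (b - a) - z) < Rmin r d).
  { intros u Hu. replace (a + u * (b - a) - z)%C with ((1 - u)%R * (a - z) + u * (b - z))%C
      by (rewrite RtoC_minus; ring).
    eapply Rle_lt_trans; [apply Cmod_triangle|]. rewrite !Cmod_mult, !Cmod_R, !Rabs_pos_eq by lra.
    destruct (Req_dec u 0) as [->|]; [lra|]. nra. }
  replace (f b - f a - (b - a) * f' z)%C with ((f b - b * f' z) - (f a - a * f' z))%C by ring.
  apply (Cmvt_le (fun y => f y - y * f' z)%C (fun y => f' y - f' z)%C).
  - intros u Hu. eapply Cder_val.
    + apply Cder_minus.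
      * apply Hf. eapply Rlt_le_trans; [apply Hseg, Hu|apply Rmin_l].
      * apply (Cder_mult (fun x => x) (fun _ => f' z)); [apply Cder_id|apply Cder_const].
    + simpl. ring.
  - intros u Hu. left. apply H. eapply Rlt_le_trans; [apply Hseg; lra|apply Rmin_r].
Qed.

Definition rect (x0 x1 y0 y1 : R) (z : C) : Prop := x0 <= Re z <= x1 /\ y0 <= Im z <= y1.

Lemma rect_gap (f : C -> C) (x0 x1 y0 y1 : R) (t : C) :
  (forall z, rect x0 x1 y0 y1 z -> Ccont f z) ->
  (forall z, rect x0 x1 y0 y1 z -> f z <> t) ->
  exists d, 0 < d /\ forall z, rect x0 x1 y0 y1 z -> d <= Cmod (f z - t).
Proof.
  intros Hc Hn.
  (* A gauge for compactness: the same number d serves as the size of a neighbourhood of p and as a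
     lower bound for |f - t| on it. A uniform lower bound for the gauge is then the gap. *)
  assert (Hd : forall p : R * R, exists d : posreal, rect x0 x1 y0 y1 p ->
     forall x y, Rabs (x - fst p) < d -> Rabs (y - snd p) < d -> d <= Cmod (f (x, y) - t)).
  { intros p. destruct (classic (rect x0 x1 y0 y1 p)) as [Hp|Hp].
    2:{ exists (mkposreal 1 Rlt_0_1). intros; contradiction. }
    assert (H0 : 0 < Cmod (f p - t)).
    { apply Cmod_gt_0. intros E. apply (Hn p Hp). apply Ceq_minus. exact E. }
    destruct (proj1 (Ccont_eps f p) (Hc p Hp) (Cmod (f p - t) / 2)) as (d & Hd & H); [lra|].
    assert (H1 : 0 < Rmin (d / 2) (Cmod (f p - t) / 2)) by (apply Rmin_glb_lt; lra).
    exists (mkposreal _ H1). simpl. intros _ x y Hx Hy.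
    eapply Rle_trans; [apply Rmin_r|].
    assert (Cmod ((x, y) - p) < d).
    { eapply Rle_lt_trans; [apply Cmod_le_abs|].
      pose proof (Rmin_l (d / 2) (Cmod (f p - t) / 2)).
      change (Re ((x, y) - p)%C) with (x - fst p). change (Im ((x, y) - p)%C) with (y - snd p). lra. }
    specialize (H _ H2).
    pose proof (Cmod_triangle (f (x, y) - t) (- (f (x, y) - f p))) as H3.
    rewrite Cmod_opp in H3. replace (f (x, y) - t + - (f (x, y) - f p))%C with (f p - t)%C in H3 by ring.
    lra. }
  set (delta := fun x y => proj1_sig (constructive_indefinite_description _ (Hd (x, y)))).
  destruct (compactness_value_2d x0 x1 y0 y1 delta) as [d Hdd].
  exists d. split; [apply cond_pos|]. intros [x y] [Hx Hy]. unfold Re, Im in Hx, Hy; simpl in Hx, Hy.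
  apply Rnot_lt_le. intros Hlt. apply (Hdd x y Hx Hy). intros (u & v & Hu & Hv & H1 & H2 & H3).
  unfold delta in *. destruct (constructive_indefinite_description _ (Hd (u, v))) as [dd H]; simpl in *.
  specialize (H (conj Hu Hv) x y H1 H2). lra.
Qed.

(* Newton's iteration with the frozen slope [g]: the residual halves at each step, so by
   compactness it cannot stay away from 0. *)
Lemma local_surjection (f : C -> C) (z g : C) (r : R) :
  0 < r -> g <> 0 -> (forall a, Cmod (a - z) <= r -> Ccont f a) ->
  (forall a b, Cmod (a - z) <= r -> Cmod (b - z) <= r ->
     Cmod (f b - f a - (b - a) * g) <= Cmod g / 2 * Cmod (b - a)) ->
  forall t, Cmod (t - f z) <= Cmod g * r / 4 -> exists a, Cmod (a - z) <= r /\ f a = t.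
Proof.
  intros Hr Hg Hc Hf t Ht. apply NNPP. intros Hno.
  assert (Hg0 : 0 < Cmod g) by (apply Cmod_gt_0; exact Hg).
  assert (Hin : forall y, rect (Re z - r / 2) (Re z + r / 2) (Im z - r / 2) (Im z + r / 2) y ->
                  Cmod (y - z) <= r).
  { intros y [Hx Hy]. eapply Rle_trans; [apply Cmod_le_abs|].
    change (Re (y - z)%C) with (Re y - Re z). change (Im (y - z)%C) with (Im y - Im z).
    assert (Rabs (Re y - Re z) <= r / 2) by (apply Rabs_le; lra).
    assert (Rabs (Im y - Im z) <= r / 2) by (apply Rabs_le; lra). lra. }
  set (step := fun a => (a - (f a - t) / g)%C).
  set (s := fun n => Nat.iter n step z).
  (* The n-th step has length at most (r / 4) 2^(-n). The steps sum to at most r / 2, so the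
     iterates stay in the square of half-side r / 2, which lies in the disc of radius r. *)
  assert (Hit : forall n, Cmod (s n - z) <= r / 2 * (1 - (1 / 2) ^ n) /\
                     Cmod (f (s n) - t) <= Cmod g * r / 4 * (1 / 2) ^ n).
  { induction n as [|n [IH1 IH2]].
    - simpl. split; [|rewrite Cmod_sym; lra]. replace (z - z)%C with (RtoC 0) by ring. rewrite Cmod_0. lra.
    - assert (Es : s (S n) = step (s n)) by reflexivity.
      set (a := s n) in *. set (h := ((f a - t) / g)%C).
      assert (Hh : Cmod h <= r / 4 * (1 / 2) ^ n).
      { unfold h. rewrite Cmod_div by exact Hg. apply Rle_div_l; [lra|]. lra. }
      assert (Hp : 0 < (1 / 2) ^ n) by (apply pow_lt; lra).
      assert (H1 : Cmod (s (S n) - z) <= r / 2 * (1 - (1 / 2) ^ S n)).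
      { rewrite Es. unfold step. fold h. replace (a - h - z)%C with ((a - z) + - h)%C by ring.
        eapply Rle_trans; [apply Cmod_triangle|]. rewrite Cmod_opp. simpl. nra. }
      split; [exact H1|].
      assert (Hp1 : 0 < (1 / 2) ^ S n) by (apply pow_lt; lra).
      specialize (Hf a (s (S n)) ltac:(nra) ltac:(nra)).
      rewrite Es in Hf at 2 3. unfold step in Hf. fold h in Hf.
      replace (a - h - a)%C with (- h)%C in Hf by ring. rewrite Cmod_opp in Hf.
      replace (f (s (S n)) - f a - - h * g)%C with (f (s (S n)) - t)%C in Hf
        by (unfold h; field; exact Hg).
      eapply Rle_trans; [exact Hf|]. simpl. nra. }
  destruct (rect_gap f (Re z - r / 2) (Re z + r / 2) (Im z - r / 2) (Im z + r / 2) t) as (d & Hd & H).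
  - intros y Hy. apply Hc, Hin, Hy.
  - intros y Hy E. apply Hno. exists y. split; [apply Hin, Hy|exact E].
  - assert (HB : 0 < Cmod g * r / 4) by nra.
    destruct (pow_lt_1_zero (1 / 2)) with (y := d / (Cmod g * r / 4)) as [n Hn].
    { rewrite Rabs_pos_eq; lra. } { apply Rdiv_lt_0_compat; assumption. }
    specialize (Hn n (le_n n)). destruct (Hit n) as [H1 H2].
    assert (Hp : 0 < (1 / 2) ^ n) by (apply pow_lt; lra).
    rewrite Rabs_pos_eq in Hn by lra. apply Rlt_div_r in Hn; [|exact HB].
    assert (Hs : Cmod (s n - z) <= r / 2) by nra.
    pose proof (re_le_Cmod (s n - z)) as Hre. pose proof (im_le_Cmod (s n - z)) as Him.
    apply Rabs_le_between in Hre. apply Rabs_le_between in Him.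
    change (Re (s n - z)%C) with (Re (s n) - Re z) in Hre.
    change (Im (s n - z)%C) with (Im (s n) - Im z) in Him.
    specialize (H (s n)). unfold rect in H. specialize (H ltac:(lra)). lra.
Qed.

Definition convexC (P : C -> Prop) : Prop :=
  forall a b (u : R), P a -> P b -> 0 <= u <= 1 -> P (a + u * (b - a))%C.

Lemma local_onto (f f' : C -> C) (z : C) (r : R) :
  0 < r -> (forall y, Cmod (y - z) < r -> Cder f y (f' y)) -> Ccont f' z -> f' z <> 0 ->
  exists e, 0 < e /\ forall t, Cmod (t - f z) < e -> exists a, Cmod (a - z) < r /\ f a = t.
Proof.
  intros Hr Hf Hc H0. assert (Hg : 0 < Cmod (f' z)) by (apply Cmod_gt_0; exact H0).
  destruct (strict_derivative f f' z r (Cmod (f' z) / 2)) as (d & Hd & H); try assumption; [lra|].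
  exists (Cmod (f' z) * (d / 2) / 4). split; [nra|]. intros t Ht.
  destruct (local_surjection f z (f' z) (d / 2)) with (t := t) as (a & Ha & E).
  - lra.
  - exact H0.
  - intros a Ha. eapply Cder_cont, Hf. lra.
  - intros a b Ha Hb. apply H; lra.
  - lra.
  - exists a. split; [lra|exact E].
Qed.

(** Induction along a real interval: the property survives limits from the left and propagates a
    little to the right. It carries the open-closed argument of [rect_onto] and the uniqueness
    argument of [zero_forward]. *)
Lemma interval_induction (P : R -> Prop) (b : R) :
  P 0 ->
  (forall t, 0 < t <= b -> (forall s, 0 <= s < t -> P s) -> P t) ->
  (forall t, 0 <= t < b -> (forall s, 0 <= s <= t -> P s) ->
     exists d, 0 < d /\ forall s, t < s < t + d -> P s) ->
  forall t, 0 <= t <= b -> P t.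
Proof.
  intros H0 Hlim Hstep t Ht.
  set (E := fun u => 0 <= u <= b /\ forall v, 0 <= v <= u -> P v).
  assert (HE0 : E 0) by (split; [lra|intros v Hv; replace v with 0 by lra; exact H0]).
  destruct (completeness E) as [l [Hl1 Hl2]].
  { exists b. intros u Hu. apply Hu. } { exists 0. exact HE0. }
  assert (Hl0 : 0 <= l) by (apply Hl1, HE0).
  assert (Hl3 : l <= b) by (apply Hl2; intros u Hu; apply Hu).
  assert (Hlt : forall v, 0 <= v < l -> P v).
  { intros v Hv. apply NNPP. intros Hn.
    assert (l <= v); [|lra]. apply Hl2. intros u [Hu1 Hu2]. apply Rnot_lt_le. intros Huv.
    apply Hn, Hu2. lra. }
  assert (Hle : forall v, 0 <= v <= l -> P v).
  { intros v [Hv [Hv'| ->]]; [apply Hlt; lra|]. destruct Hv as [Hv| <-]; [|exact H0].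
    apply Hlim; [lra|exact Hlt]. }
  destruct (Rle_or_lt b l) as [Hb|Hb]; [apply Hle; lra|].
  destruct (Hstep l ltac:(lra) Hle) as (d & Hd & H).
  assert (HEm : E (Rmin b (l + d / 2))).
  { pose proof (Rmin_l b (l + d / 2)). pose proof (Rmin_r b (l + d / 2)).
    split; [split; [apply Rmin_glb; lra|lra]|]. intros v Hv.
    destruct (Rle_or_lt v l) as [L|L]; [apply Hle; lra|apply H; lra]. }
  apply Hl1 in HEm. assert (l < Rmin b (l + d / 2)) by (apply Rmin_glb_lt; lra). lra.
Qed.

(* Open-closed argument along the segments of [P], on which [f] only takes interior values. *)
Lemma rect_onto (f f' : C -> C) (x0 x1 y0 y1 : R) (P : C -> Prop) :
  (forall z, rect x0 x1 y0 y1 z -> Ccont f z) ->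
  (forall z, x0 < Re z < x1 -> y0 < Im z < y1 -> Cder f z (f' z) /\ Ccont f' z /\ f' z <> 0) ->
  (forall z, rect x0 x1 y0 y1 z -> P (f z) -> x0 < Re z < x1 /\ y0 < Im z < y1) ->
  convexC P -> (exists z, rect x0 x1 y0 y1 z /\ P (f z)) ->
  forall t, P t -> exists z, (x0 < Re z < x1 /\ y0 < Im z < y1) /\ f z = t.
Proof.
  intros Hc Hd Hb HP (z0 & Hz0 & HPz0) t Ht.
  set (g := fun u : R => (f z0 + u * (t - f z0))%C).
  set (att := fun u : R => exists z, rect x0 x1 y0 y1 z /\ f z = g u).
  assert (Hgd : forall u v, Cmod (g u - g v) = Rabs (u - v) * Cmod (t - f z0)).
  { intros u v. rewrite <- Cmod_R, <- Cmod_mult, RtoC_minus. f_equal. unfold g. ring. }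
  pose proof (Cmod_ge_0 (t - f z0)) as HB. set (B := Cmod (t - f z0)) in *.
  assert (Hq : forall e, 0 < e -> 0 < e / (2 * (B + 1)) /\ e / (2 * (B + 1)) * (2 * (B + 1)) = e).
  { intros e He. split; [apply Rdiv_lt_0_compat; lra|field; lra]. }
  assert (Hint : forall u, 0 <= u <= 1 -> att u ->
            exists z, (x0 < Re z < x1 /\ y0 < Im z < y1) /\ f z = g u).
  { intros u Hu (z & Hz & Ez). exists z. split; [|exact Ez]. apply Hb; [exact Hz|].
    rewrite Ez. apply HP; assumption. }
  assert (H1 : att 1).
  { apply (interval_induction att 1); [exists z0; split; [exact Hz0|unfold g; ring]| | |lra].
    - intros l Hl Hlt. apply NNPP. intros Hn.
      destruct (rect_gap f x0 x1 y0 y1 (g l)) as (d & Hd0 & Hgap); [exact Hc| |].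
      { intros z Hz Ez. apply Hn. exists z. split; assumption. }
      destruct (Hq d Hd0) as [Hq1 Hq2].
      (* A parameter so close to l that g v, an attained value, lies within d of g l, against the
         gap. The summand 1 in B + 1 covers the case t = f z0. *)
      set (v := Rmax 0 (l - d / (2 * (B + 1)))).
      assert (Hv : 0 <= v < l) by (unfold v, Rmax; destruct Rle_dec; lra).
      assert (Hv2 : l - d / (2 * (B + 1)) <= v) by apply Rmax_r.
      destruct (Hlt v Hv) as (z & Hz & Ez). specialize (Hgap z Hz).
      rewrite Ez, Hgd, Rabs_minus_sym, Rabs_pos_eq in Hgap by lra. nra.
    (* The preimage of g l is interior because the boundary values avoid P, so [local_onto] covers a
       neighbourhood of g l. *)
    - intros l Hl Hle. destruct (Hint l ltac:(lra) (Hle l ltac:(lra))) as (z & [Hzx Hzy] & Ez).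
      set (r := Rmin (Rmin (Re z - x0) (x1 - Re z)) (Rmin (Im z - y0) (y1 - Im z))).
      assert (Hr : 0 < r) by (unfold r; repeat apply Rmin_glb_lt; lra).
      assert (Hin : forall y, Cmod (y - z) < r -> x0 < Re y < x1 /\ y0 < Im y < y1).
      { intros y Hy. unfold r in Hy.
        pose proof (re_le_Cmod (y - z)) as Hre. pose proof (im_le_Cmod (y - z)) as Him.
        apply Rabs_le_between in Hre. apply Rabs_le_between in Him.
        change (Re (y - z)%C) with (Re y - Re z) in Hre.
        change (Im (y - z)%C) with (Im y - Im z) in Him.
        apply Rmin_Rgt_l in Hy. destruct Hy as [Hy1 Hy2].
        apply Rmin_Rgt_l in Hy1. apply Rmin_Rgt_l in Hy2. lra. }
      destruct (Hd z Hzx Hzy) as (_ & Hf1 & Hf2).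
      destruct (local_onto f f' z r Hr) as (e & He & H); try assumption.
      { intros y Hy. apply Hd; apply Hin, Hy. }
      destruct (Hq e He) as [Hq1 Hq2].
      exists (e / (2 * (B + 1))). split; [exact Hq1|]. intros v Hv.
      destruct (H (g v)) as (a & Ha & Ea).
      + rewrite Ez, Hgd, Rabs_pos_eq by lra. nra.
      + exists a. split; [|exact Ea]. destruct (Hin a Ha). unfold rect. lra. }
  destruct (Hint 1 ltac:(lra) H1) as (z & Hz & Ez). exists z. split; [exact Hz|].
  rewrite Ez. unfold g. ring.
Qed.

(** Only V (f y) = y on D is assumed. [local_onto] writes every t near f z as f a with a near z,
    which turns the difference quotient of V into that of f. *)
Lemma inverse_Cder (f f' V : C -> C) (D : C -> Prop) (z : C) :
  open_eps D -> (forall y, D y -> Cder f y (f' y) /\ Ccont f' y) ->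
  (forall y, D y -> V (f y) = y) -> D z -> f' z <> 0 -> Cder V (f z) (/ f' z)%C.
Proof.
  intros HD Hf HV Hz H0.
  assert (Hg : 0 < Cmod (f' z)) by (apply Cmod_gt_0; exact H0). set (g := f' z) in *.
  apply Cder_eps. intros e He.
  destruct (HD z Hz) as (r & Hr & Hball).
  (* The first entry gives |f a - f z| >= |g| |a - z| / 2, and the second converts the error of f
     into the required error of V. *)
  set (e1 := Rmin (Cmod g / 2) (e * Cmod g * Cmod g / 2)).
  assert (He1 : 0 < e1) by (unfold e1; apply Rmin_glb_lt; [lra|apply Rdiv_lt_0_compat; [|lra];
    repeat apply Rmult_lt_0_compat; assumption]).
  destruct (strict_derivative f f' z r e1) as (d & Hd & H).
  { exact Hr. } { exact He1. } { intros y Hy. apply Hf, Hball, Hy. } { apply Hf, Hz. }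
  destruct (local_onto f f' z d) as (e2 & He2 & H2).
  { lra. } { intros y Hy. apply Hf, Hball. lra. } { apply Hf, Hz. } { exact H0. }
  exists e2. split; [exact He2|]. intros t Ht.
  destruct (H2 t Ht) as (a & Ha & Ea). rewrite <- Ea.
  rewrite HV by (apply Hball; lra). rewrite HV by exact Hz.
  specialize (H z a). replace (z - z)%C with (RtoC 0) in H by ring. rewrite Cmod_0 in H.
  specialize (H ltac:(lra) Ha). fold g in H.
  pose proof (Rmin_l (Cmod g / 2) (e * Cmod g * Cmod g / 2)) as M1.
  pose proof (Rmin_r (Cmod g / 2) (e * Cmod g * Cmod g / 2)) as M2. fold e1 in M1, M2.
  replace (a - z - (f a - f z) * / g)%C with (- ((f a - f z - (a - z) * g) / g))%C
    by (field; exact H0).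
  rewrite Cmod_opp, Cmod_div by exact H0.
  pose proof (Cmod_ge_0 (a - z)) as Hn0.
  pose proof (Cmod_tri_inv ((a - z) * g) (f a - f z)) as T1.
  rewrite (Cmod_sym ((a - z) * g)), Cmod_mult in T1.
  pose proof (Rmult_le_compat_r _ _ _ Hn0 M1) as M1'.
  pose proof (Rmult_le_compat_r _ _ _ Hn0 M2) as M2'.
  assert (L : Cmod (a - z) * (Cmod g / 2) <= Cmod (f a - f z)) by lra.
  apply Rle_div_l; [exact Hg|]. eapply Rle_trans; [exact H|]. eapply Rle_trans; [exact M2'|].
  apply Rmult_le_compat_l with (r := e * Cmod g) in L; [lra|nra].
Qed.

(** * The complex time in the uniformizing coordinate *)

Lemma prim_0 (f : C -> C) : prim f 0 = 0.
Proof.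
  unfold prim.
  rewrite (RInt_ext _ (fun _ => 0)) by (intros; rewrite Cmult_0_l; reflexivity).
  rewrite (RInt_ext (fun u : R => Im (0 * f (u * 0))%C) (fun _ => 0))
    by (intros; rewrite Cmult_0_l; reflexivity).
  rewrite RInt_const. unfold scal; simpl; unfold mult; simpl. unfold RtoC. f_equal; ring.
Qed.

(* With c = X / (X + mm) one has 1 + c = 2 (X + bb) / (X + mm), c - a_- = (1 - a_-) (X + dd) / (X + mm)
   and c - a_+ = (1 - a_+) (X - 1) / (X + mm). *)
Definition mm : R := 1 + 2 * sqrt 2.
Definition bb : R := mm / 2.
Definition dd : R := mm * mm / 7.
(** This is 2 sqrt (2/21), the constant left in dt/dz after the substitution; the 21 comes from 3 *
    2 * (1 - a_+)(1 - a_-) with (1 - a_+)(1 - a_-) = 7/4. *)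
Definition KK : R := sqrt (8 / 21).
(** Fixed by dlambda/dz = - 3 Lambda dt/dz, that is, by the relation [NN_KK]. *)
Definition NN : R := sqrt (7 * mm / 3).

Lemma sqrt2_sqr : sqrt 2 * sqrt 2 = 2.
Proof. apply sqrt_sqrt. lra. Qed.

Lemma sqrt2_bounds : 1.4 < sqrt 2 < 1.5.
Proof. pose proof sqrt2_sqr. pose proof (sqrt_pos 2). nra. Qed.

Lemma mm_bounds : 3.8 < mm < 4.
Proof. unfold mm. pose proof sqrt2_bounds. lra. Qed.

Lemma mm_sqr : mm * mm = 2 * mm + 7.
Proof. unfold mm. pose proof sqrt2_sqr. nra. Qed.

Lemma bb_bounds : 1.9 < bb < 2.
Proof. unfold bb. pose proof mm_bounds. lra. Qed.

Lemma dd_bounds : 2 < dd < 2.2.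
Proof. unfold dd. rewrite mm_sqr. pose proof mm_bounds. lra. Qed.

Lemma KK_sqr : KK * KK = 8 / 21.
Proof. apply sqrt_sqrt. lra. Qed.

Lemma KK_bounds : 0 < KK < 1.
Proof. pose proof KK_sqr. assert (0 < KK) by (apply sqrt_lt_R0; lra). nra. Qed.

Lemma NN_sqr : NN * NN = 7 * mm / 3.
Proof. apply sqrt_sqrt. pose proof mm_bounds. lra. Qed.

Lemma NN_pos : 0 < NN.
Proof. apply sqrt_lt_R0. pose proof mm_bounds. lra. Qed.

Ltac constants :=
  let Hm := fresh "Hmm" in let Hb := fresh "Hbb" in let Hd := fresh "Hdd" in
  let HK := fresh "HKK" in let HN := fresh "HNN" in
  pose proof mm_bounds as Hm; pose proof bb_bounds as Hb; pose proof dd_bounds as Hd;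
  pose proof KK_bounds as HK; pose proof NN_pos as HN.

Definition strip (z : C) : Prop := - (PI / 2) < Im z < PI / 2.
(** The vertical band puts +-i pi/2 in the interior, so that the corner can be analysed from all
    sides. It is narrow enough that sinh^2 (Re z) < 1 < b, which keeps it clear of the branch points
    of the roots, and the union remains star-shaped about 0. *)
Definition dom (z : C) : Prop := strip z \/ - (1 / 2) < Re z < 1 / 2.

Lemma strip_dom (z : C) : strip z -> dom z.
Proof. intros H. left. exact H. Qed.

Lemma open_strip : open_eps strip.
Proof.
  intros z Hz. unfold strip in *.
  exists (Rmin (Im z + PI / 2) (PI / 2 - Im z)). split; [apply Rmin_glb_lt; lra|].
  intros y Hy. apply Rmin_Rgt_l in Hy. pose proof (im_le_Cmod (y - z)) as H.
  apply Rabs_le_between in H. change (Im (y - z)%C) with (Im y - Im z) in H. lra.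
Qed.

Lemma open_dom : open_eps dom.
Proof.
  intros z [Hz|Hz].
  - destruct (open_strip z Hz) as (e & He & H). exists e. split; [exact He|].
    intros y Hy. left. apply H, Hy.
  - exists (Rmin (Re z + 1 / 2) (1 / 2 - Re z)). split; [apply Rmin_glb_lt; lra|].
    intros y Hy. apply Rmin_Rgt_l in Hy. pose proof (re_le_Cmod (y - z)) as H.
    apply Rabs_le_between in H. change (Re (y - z)%C) with (Re y - Re z) in H. right. lra.
Qed.

Lemma Re_scal (u : R) (z : C) : Re (u * z)%C = u * Re z.
Proof. destruct z. unfold Re. simpl. ring. Qed.

Lemma Im_scal (u : R) (z : C) : Im (u * z)%C = u * Im z.
Proof. destruct z. unfold Im. simpl. ring. Qed.

Lemma star_dom : star0 dom.
Proof.
  intros z u [Hz|Hz] Hu; [left|right]; unfold strip in *; rewrite ?Re_scal, ?Im_scal;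
    pose proof PI_RGT_0; (destruct Hu as [[Hu|<-] Hu1]; [split; nra|lra]).
Qed.

Lemma dom_conj (z : C) : dom z -> dom (Cconj z).
Proof.
  intros [H|H]; [left|right]; unfold strip in *.
  - change (Im (Cconj z)%C) with (- Im z). lra.
  - exact H.
Qed.

Lemma sinh_half (x : R) : - (1 / 2) < x < 1 / 2 -> sinh x * sinh x < 1.
Proof.
  intros Hx.
  assert (He : exp (1 / 2) < 2).
  { pose proof (exp_pos (1 / 2)). pose proof exp_le_3.
    assert (exp (1 / 2) * exp (1 / 2) = exp 1) by (rewrite <- exp_plus; f_equal; lra). nra. }
  assert (E : exp x * exp (- x) = 1) by (rewrite <- exp_plus, Rplus_opp_r; apply exp_0).
  pose proof (exp_increasing x (1 / 2)). pose proof (exp_increasing (- x) (1 / 2)).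
  pose proof (exp_pos x). pose proof (exp_pos (- x)). unfold sinh. nra.
Qed.

Definition XX (z : C) : C := (ccosh z * ccosh z)%C.

Lemma Re_XX (z : C) :
  Re (XX z) = cos (Im z) * cos (Im z) - sinh (Re z) * sinh (Re z) * (sin (Im z) * sin (Im z) - cos (Im z) * cos (Im z)).
Proof.
  unfold XX, ccosh. unfold Re at 1. simpl. pose proof (cosh2_sinh2 (Re z)).
  transitivity ((cosh (Re z) * cosh (Re z)) * (cos (Im z) * cos (Im z)) - sinh (Re z) * sin (Im z) * (sinh (Re z) * sin (Im z))); [ring|].
  rewrite H. ring.
Qed.

Lemma Im_XX (z : C) : Im (XX z) = 2 * (cosh (Re z) * sinh (Re z)) * (cos (Im z) * sin (Im z)).
Proof. unfold XX, ccosh. unfold Im at 1. simpl. ring. Qed.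

Lemma sin2_cos2' (y : R) : sin y * sin y + cos y * cos y = 1.
Proof. pose proof (sin2_cos2 y). unfold Rsqr in H. exact H. Qed.

Lemma cos_strip (z : C) : strip z -> 0 < cos (Im z).
Proof. intros [H1 H2]. apply cos_gt_0; lra. Qed.

Lemma Re_ccosh_pos (z : C) : strip z -> 0 < Re (ccosh z).
Proof.
  intros H. pose proof (cos_strip z H). pose proof (cosh_gt_0 (Re z)).
  unfold ccosh, Re at 1. simpl. nra.
Qed.

(** In the strip, Im X = 0 forces sinh x sin y = 0, and then X >= 0. In the band, Re X >= - sinh^2 x
    > -1. *)
Lemma XX_slit (z : C) (e : R) : dom z -> 1 < e -> slit (XX z + e).
Proof.
  intros Hz He. apply slit_intro.
  change (Im (XX z + e)%C) with (Im (XX z) + 0). change (Re (XX z + e)%C) with (Re (XX z) + e).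
  rewrite Im_XX, Re_XX. intros E. pose proof (sin2_cos2' (Im z)) as Hsc.
  destruct Hz as [Hz|Hz].
  - pose proof (cos_strip z Hz). pose proof (cosh_gt_0 (Re z)).
    assert (E2 : sinh (Re z) * sin (Im z) = 0).
    { apply Rmult_eq_reg_l with (2 * cosh (Re z) * cos (Im z)).
      - rewrite Rmult_0_r, <- E. ring.
      - apply Rgt_not_eq, Rmult_lt_0_compat; [apply Rmult_lt_0_compat; [lra|assumption]|assumption]. }
    assert (sinh (Re z) * sinh (Re z) * (sin (Im z) * sin (Im z)) = 0) by nra.
    nra.
  - pose proof (sinh_half (Re z) Hz). nra.
Qed.

Lemma XX_neq (z : C) (e : R) : dom z -> 1 < e -> (XX z + e)%C <> 0.
Proof.
  intros Hz He E. pose proof (XX_slit z e Hz He) as H. rewrite E in H. unfold slit in H.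
  rewrite Cmod_0 in H. unfold Re in H. simpl in H. lra.
Qed.

Definition PP (z : C) : C := csqrt (XX z + bb).
Definition QQ (z : C) : C := csqrt (XX z + dd).

Lemma PP_neq0 (z : C) : dom z -> PP z <> 0.
Proof. intros H. apply csqrt_neq0, XX_slit; [exact H|]. pose proof bb_bounds. lra. Qed.

Lemma QQ_neq0 (z : C) : dom z -> QQ z <> 0.
Proof. intros H. apply csqrt_neq0, XX_slit; [exact H|]. pose proof dd_bounds. lra. Qed.

(* [GG] is dt/dz, [TT] the complex time, and [lamU], [LamU] are the components of the separatrix,
   all as functions of the uniformizing coordinate z. *)
Definition GG (z : C) : C := (KK * XX z * / (PP z * QQ z))%C.
Definition TT : C -> C := prim GG.

(** The derivative of 2 arccos (X / (X + m)), where 1 - c^2 = 2 m (X + b) / (X + m)^2. Defining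
    lambda as a primitive of it avoids choosing a complex branch of arccos. *)
Definition dlam (z : C) : C := (- sqrt (8 * mm) * (csinh z * ccosh z) * / ((XX z + mm) * PP z))%C.
Definition lamU (l0 : R) (z : C) : C := (l0 + prim dlam z)%C.
Definition LamU (z : C) : C := (NN * csinh z * QQ z * / (ccosh z * (XX z + mm)))%C.

Lemma C1_XX (D : C -> Prop) : C1_on D XX.
Proof. apply C1_mult; apply C1_ccosh. Qed.

Lemma C1_sqrtXX (e : R) : 1 < e -> C1_on dom (fun z => csqrt (XX z + e)).
Proof.
  intros He. apply (C1_comp dom slit csqrt (fun z => XX z + e)%C).
  - apply C1_csqrt.
  - apply C1_plus; [apply C1_XX|apply C1_const].
  - intros z Hz. apply XX_slit; assumption.
Qed.

Lemma C1_PP : C1_on dom PP.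
Proof. apply C1_sqrtXX. pose proof bb_bounds. lra. Qed.

Lemma C1_QQ : C1_on dom QQ.
Proof. apply C1_sqrtXX. pose proof dd_bounds. lra. Qed.

Lemma C1_GG : C1_on dom GG.
Proof.
  apply C1_mult; [apply C1_mult; [apply C1_const|apply C1_XX]|].
  apply C1_inv; [apply C1_mult; [apply C1_PP|apply C1_QQ]|].
  intros z Hz. apply Cmult_neq_0; [apply PP_neq0, Hz|apply QQ_neq0, Hz].
Qed.

Lemma C1_dlam : C1_on dom dlam.
Proof.
  pose proof mm_bounds.
  apply C1_mult; [apply C1_mult; [apply C1_const|apply C1_mult; [apply C1_csinh|apply C1_ccosh]]|].
  apply C1_inv.
  - apply C1_mult; [apply C1_plus; [apply C1_XX|apply C1_const]|apply C1_PP].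
  - intros z Hz. apply Cmult_neq_0; [apply XX_neq; [exact Hz|lra]|apply PP_neq0, Hz].
Qed.

Lemma C1_incl (D E : C -> Prop) (f : C -> C) : (forall z, D z -> E z) -> C1_on E f -> C1_on D f.
Proof. intros H [f' Hf]. exists f'. intros z Hz. apply Hf, H, Hz. Qed.

Lemma C1_LamU : C1_on strip LamU.
Proof.
  pose proof mm_bounds.
  apply C1_mult; [apply C1_mult; [apply C1_mult; [apply C1_const|apply C1_csinh]|]|].
  - apply (C1_incl strip dom); [apply strip_dom|apply C1_QQ].
  - apply C1_inv.
    + apply C1_mult; [apply C1_ccosh|apply C1_plus; [apply C1_XX|apply C1_const]].
    + intros z Hz. apply Cmult_neq_0.
      * apply Re_pos_neq0, Re_ccosh_pos, Hz.
      * apply XX_neq; [apply strip_dom, Hz|lra].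
Qed.

Lemma TT_Cder (z : C) : dom z -> Cder TT z (GG z).
Proof.
  intros Hz. destruct C1_GG as [G' HG].
  apply (prim_Cder dom GG G' open_dom star_dom HG z Hz).
Qed.

Lemma GG_cont (z : C) : dom z -> Ccont GG z.
Proof. intros Hz. destruct C1_GG as [G' HG]. eapply Cder_cont. apply (HG z Hz). Qed.

Lemma TT_cont (z : C) : dom z -> Ccont TT z.
Proof. intros Hz. eapply Cder_cont, TT_Cder, Hz. Qed.

Lemma lamU_Cder (l0 : R) (z : C) : dom z -> Cder (lamU l0) z (dlam z).
Proof.
  intros Hz. destruct C1_dlam as [G' HG].
  eapply Cder_val.
  - apply Cder_plus; [apply Cder_const|apply (prim_Cder dom dlam G' open_dom star_dom HG z Hz)].
  - ring.
Qed.

Lemma Cconj_plus (z w : C) : Cconj (z + w) = (Cconj z + Cconj w)%C.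
Proof. destruct z, w. unfold Cconj, Cplus. simpl. f_equal. ring. Qed.
Lemma Cconj_mult' (z w : C) : Cconj (z * w) = (Cconj z * Cconj w)%C.
Proof. destruct z, w. unfold Cconj, Cmult. simpl. f_equal; ring. Qed.
Lemma Cconj_R (x : R) : Cconj x = x.
Proof. unfold Cconj, RtoC. simpl. f_equal. ring. Qed.
Lemma Cconj_opp' (z : C) : Cconj (- z) = (- Cconj z)%C.
Proof. destruct z. reflexivity. Qed.
Lemma Cconj_inv' (z : C) : Cconj (/ z) = (/ Cconj z)%C.
Proof.
  destruct z as [x y]. unfold Cconj, Cinv. simpl.
  replace (x * (x * 1) + - y * (- y * 1)) with (x * (x * 1) + y * (y * 1)) by ring.
  f_equal. unfold Rdiv. ring.
Qed.

Lemma XX_conj (z : C) : XX (Cconj z) = Cconj (XX z).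
Proof. unfold XX. rewrite ccosh_conj, Cconj_mult'. reflexivity. Qed.
Lemma XX_opp (z : C) : XX (- z) = XX z.
Proof. unfold XX. rewrite ccosh_opp. reflexivity. Qed.
Lemma PP_conj (z : C) : PP (Cconj z) = Cconj (PP z).
Proof. unfold PP. rewrite <- csqrt_conj, Cconj_plus, Cconj_R, XX_conj. reflexivity. Qed.
Lemma QQ_conj (z : C) : QQ (Cconj z) = Cconj (QQ z).
Proof. unfold QQ. rewrite <- csqrt_conj, Cconj_plus, Cconj_R, XX_conj. reflexivity. Qed.

Lemma TT_conj (z : C) : dom z -> TT (Cconj z) = Cconj (TT z).
Proof.
  intros Hz. destruct C1_GG as [G' HG].
  apply (prim_conj dom GG G' star_dom HG z); [|exact Hz].
  intros y _. unfold GG.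
  rewrite XX_conj, PP_conj, QQ_conj, !Cconj_mult', Cconj_inv', Cconj_mult', Cconj_R. reflexivity.
Qed.

Lemma lamU_conj (l0 : R) (z : C) : dom z -> lamU l0 (Cconj z) = Cconj (lamU l0 z).
Proof.
  intros Hz. destruct C1_dlam as [G' HG]. unfold lamU. rewrite Cconj_plus, Cconj_R. f_equal.
  apply (prim_conj dom dlam G' star_dom HG z); [|exact Hz].
  intros y _. unfold dlam.
  rewrite XX_conj, PP_conj, csinh_conj, ccosh_conj, !Cconj_mult', Cconj_inv', Cconj_mult', Cconj_plus,
    !Cconj_R, Cconj_opp', Cconj_R. reflexivity.
Qed.

Lemma LamU_conj (z : C) : LamU (Cconj z) = Cconj (LamU z).
Proof.
  unfold LamU.
  rewrite XX_conj, QQ_conj, csinh_conj, ccosh_conj, !Cconj_mult', Cconj_inv', Cconj_mult', Cconj_plus,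
    !Cconj_R. reflexivity.
Qed.

Lemma TT_opp (z : C) : dom z -> TT (- z) = (- TT z)%C.
Proof.
  intros Hz. destruct C1_GG as [G' HG].
  apply (prim_odd dom GG G' star_dom HG z); [|exact Hz].
  intros y _. unfold GG, PP, QQ. rewrite XX_opp. reflexivity.
Qed.

Lemma TT_0 : TT 0 = 0.
Proof. apply prim_0. Qed.

(** [GG] at points where X takes a real value r > - b: positive on both coordinate axes inside the
    strip, negative on the line Im z = pi/2 close to the corner. *)
Definition Gr (r : R) : R := KK * r / (sqrt (r + bb) * sqrt (r + dd)).

Lemma GG_real (z : C) (r : R) : - bb < r -> XX z = RtoC r -> GG z = RtoC (Gr r).
Proof.
  intros Hr E. constants.
  assert (Hd : bb < dd).
  { unfold bb, dd. rewrite mm_sqr. lra. }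
  unfold GG, PP, QQ, Gr. rewrite E, <- !RtoC_plus, !csqrt_R by lra.
  assert (0 < sqrt (r + bb)) by (apply sqrt_lt_R0; lra).
  assert (0 < sqrt (r + dd)) by (apply sqrt_lt_R0; lra).
  rewrite <- !RtoC_mult, <- RtoC_inv by nra. rewrite <- RtoC_mult. reflexivity.
Qed.

Lemma Gr_pos (r : R) : 0 < r -> 0 < Gr r.
Proof.
  intros H. constants.
  unfold Gr. apply Rdiv_lt_0_compat; [nra|]. apply Rmult_lt_0_compat; apply sqrt_lt_R0; lra.
Qed.

Lemma Gr_neg (r : R) : - bb < r < 0 -> Gr r < 0.
Proof.
  intros H. constants.
  assert (Hd : 1.9 < dd) by lra.
  assert (bb < dd).
  { unfold bb, dd. rewrite mm_sqr. pose proof mm_bounds. lra. }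
  unfold Gr. assert (0 < sqrt (r + bb) * sqrt (r + dd)) by (apply Rmult_lt_0_compat; apply sqrt_lt_R0; lra).
  apply Rmult_lt_reg_r with (sqrt (r + bb) * sqrt (r + dd)); [assumption|].
  unfold Rdiv. rewrite Rmult_assoc, Rinv_l by lra. nra.
Qed.

Lemma XX_R (x : R) : XX x = RtoC (cosh x * cosh x).
Proof.
  unfold XX, ccosh. unfold Re, Im. simpl. rewrite cos_0, sin_0.
  Cparts.
Qed.

Lemma XX_im (y : R) : XX (0, y) = RtoC (cos y * cos y).
Proof.
  unfold XX, ccosh. unfold Re, Im. simpl. rewrite cosh_0, sinh_0.
  Cparts.
Qed.

Lemma XX_top (x : R) : XX (x, PI / 2) = RtoC (- (sinh x * sinh x)).
Proof.
  unfold XX, ccosh. unfold Re, Im. simpl. rewrite cos_PI2, sin_PI2.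
  Cparts.
Qed.

Lemma GG_neq0 (z : C) : strip z -> GG z <> 0.
Proof.
  intros Hz. pose proof (Re_ccosh_pos z Hz) as H. apply Re_pos_neq0 in H.
  pose proof KK_bounds. unfold GG. apply Cmult_neq_0.
  - apply Cmult_neq_0; [|apply Cmult_neq_0; exact H]. intros E; apply RtoC_inj in E; lra.
  - intros E. assert (E1 : (PP z * QQ z)%C <> 0)
      by (apply Cmult_neq_0; [apply PP_neq0|apply QQ_neq0]; apply strip_dom, Hz).
    pose proof (Cinv_r _ E1) as E2. rewrite E in E2. rewrite Cmult_0_r in E2.
    apply RtoC_inj in E2. lra.
Qed.

(** Adding e > 0 lowers the argument of c^2, so 0 < arg sqrt (c^2 + e) < arg c < pi/2 and the
    quotient has its argument in (0, pi/2). *)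
Lemma first_quadrant_ratio (c : C) (e : R) :
  0 < Re c -> 0 < Im c -> 0 < e ->
  0 < Re (c / csqrt (c * c + e))%C /\ 0 < Im (c / csqrt (c * c + e))%C.
Proof.
  intros Hr Hi He. set (P := csqrt (c * c + e)).
  assert (Hs : 0 < Im (c * c + e)%C).
  { change (Im (c * c + e)%C) with (Re c * Im c + Im c * Re c + 0). nra. }
  assert (Hsl : slit (c * c + e)) by (apply slit_intro; lra).
  pose proof (csqrt_Re_pos _ Hsl) as P1. pose proof (csqrt_Im_pos _ Hs) as P2.
  pose proof (csqrt_sqr _ Hsl) as P3. fold P in P1, P2, P3.
  destruct c as [c1 c2], P as [p1 p2]. unfold Re, Im in *. simpl in *.
  injection P3 as E1 E2. replace (p1 * (p1 * 1) + p2 * (p2 * 1)) with (p1 * p1 + p2 * p2) by ring.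
  set (n := p1 * p1 + p2 * p2). assert (Hn : 0 < n) by (unfold n; nra).
  (* [p = sqrt (c^2 + e)] has the smaller argument: p1 p2 = c1 c2 and p1^2 - p2^2 = c1^2 - c2^2 + e *)
  assert (Hk : 0 < c2 * p1 - c1 * p2).
  { assert (p1 * p2 = c1 * c2) by lra.
    assert ((c2 * p1 - c1 * p2) * (c1 * p1 + c2 * p2) = e * (c1 * c2)).
    { replace ((c2 * p1 - c1 * p2) * (c1 * p1 + c2 * p2))
        with (c1 * c2 * (p1 * p1 - p2 * p2) - (c1 * c1 - c2 * c2) * (p1 * p2)) by ring.
      replace (p1 * p1 - p2 * p2) with (c1 * c1 - c2 * c2 + e) by lra. rewrite H. ring. }
    assert (0 < c1 * p1 + c2 * p2) by nra. assert (0 < e * (c1 * c2)) by nra. nra. }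
  split.
  - replace (c1 * (p1 / n) - c2 * (- p2 / n)) with ((c1 * p1 + c2 * p2) / n) by (field; lra).
    apply Rdiv_lt_0_compat; nra.
  - replace (c1 * (- p2 / n) + c2 * (p1 / n)) with ((c2 * p1 - c1 * p2) / n) by (field; lra).
    apply Rdiv_lt_0_compat; nra.
Qed.

(** [GG] is a positive multiple of (c / P)(c / Q) with c = cosh z in the open first quadrant; a
    product of two numbers of that quadrant lies in the upper half-plane. *)
Lemma GG_Im_pos (z : C) : 0 < Re z -> 0 < Im z < PI / 2 -> 0 < Im (GG z).
Proof.
  intros Hx Hy. constants. pose proof PI_RGT_0.
  assert (Hz : strip z) by (unfold strip; lra).
  pose proof (Re_ccosh_pos z Hz) as Hc1.
  assert (Hc2 : 0 < Im (ccosh z)).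
  { change (0 < sinh (Re z) * sin (Im z)). apply Rmult_lt_0_compat;
      [apply sinh_gt_0, Hx|apply sin_gt_0; lra]. }
  destruct (first_quadrant_ratio (ccosh z) bb Hc1 Hc2 ltac:(lra)) as [A1 A2].
  destruct (first_quadrant_ratio (ccosh z) dd Hc1 Hc2 ltac:(lra)) as [B1 B2].
  replace (GG z) with (RtoC KK * ((ccosh z / csqrt (ccosh z * ccosh z + bb)) * (ccosh z / csqrt (ccosh z * ccosh z + dd))))%C.
  - rewrite Im_scal. set (a := (ccosh z / csqrt (ccosh z * ccosh z + bb))%C) in *.
    set (b := (ccosh z / csqrt (ccosh z * ccosh z + dd))%C) in *.
    change (Im (a * b)%C) with (Re a * Im b + Im a * Re b). apply Rmult_lt_0_compat; [lra|].
    apply Rplus_lt_0_compat; apply Rmult_lt_0_compat; assumption.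
  - unfold GG. pose proof (PP_neq0 z (strip_dom z Hz)). pose proof (QQ_neq0 z (strip_dom z Hz)).
    unfold PP, QQ, XX in *. field. split; assumption.
Qed.

(** * Injectivity of the complex time *)

Lemma TT_horizontal (x1 x2 y : R) (k : C) :
  x1 < x2 -> (forall x, x1 <= x <= x2 -> dom (x, y)) ->
  exists c, x1 < c < x2 /\
    Re (k * (TT (x2, y) - TT (x1, y)))%C = (x2 - x1) * Re (k * GG (c, y))%C.
Proof.
  intros Hx Hd.
  assert (E : forall u : R, ((x1, y) + u * ((x2, y) - (x1, y)))%C = (x1 + u * (x2 - x1), y)).
  { intros u. Cparts. }
  destruct (Cmvt TT GG (x1, y) (x2, y) k) as (u & Hu & H).
  - intros u Hu. apply TT_Cder. rewrite E. apply Hd. nra.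
  - exists (x1 + u * (x2 - x1)). split; [nra|]. rewrite H, E.
    destruct (GG (x1 + u * (x2 - x1), y)), k. unfold Re; simpl. ring.
Qed.

Lemma TT_vertical (x y1 y2 : R) (k : C) :
  y1 < y2 -> (forall y, y1 <= y <= y2 -> dom (x, y)) ->
  exists c, y1 < c < y2 /\
    Re (k * (TT (x, y2) - TT (x, y1)))%C = (y2 - y1) * Re (k * (Ci * GG (x, c)))%C.
Proof.
  intros Hy Hd.
  assert (E : forall u : R, ((x, y1) + u * ((x, y2) - (x, y1)))%C = (x, y1 + u * (y2 - y1))).
  { intros u. Cparts. }
  destruct (Cmvt TT GG (x, y1) (x, y2) k) as (u & Hu & H).
  - intros u Hu. apply TT_Cder. rewrite E. apply Hd. nra.
  - exists (y1 + u * (y2 - y1)). split; [nra|]. rewrite H, E.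
    destruct (GG (x, y1 + u * (y2 - y1))), k. unfold Re; simpl. ring.
Qed.

Lemma Re_1 (z : C) : Re (1 * z)%C = Re z.
Proof. rewrite Cmult_1_l. reflexivity. Qed.
Lemma Re_mCi (z : C) : Re (- Ci * z)%C = Im z.
Proof. destruct z. unfold Re, Im, Ci. simpl. ring. Qed.
Lemma Re_Ci (z : C) : Re (Ci * z)%C = - Im z.
Proof. destruct z. unfold Re, Im, Ci. simpl. ring. Qed.
Lemma Im_Ci (z : C) : Im (Ci * z)%C = Re z.
Proof. destruct z. unfold Re, Im, Ci. simpl. ring. Qed.
Lemma Re_minus (z w : C) : Re (z - w)%C = Re z - Re w.
Proof. reflexivity. Qed.
Lemma Im_minus (z w : C) : Im (z - w)%C = Im z - Im w.
Proof. reflexivity. Qed.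

Lemma dom_axis (y : R) : dom (0, y).
Proof. right. unfold Re. simpl. lra. Qed.

Lemma dom_R (x : R) : dom x.
Proof. left. unfold strip, Im. simpl. pose proof PI_RGT_0. lra. Qed.

(** On the imaginary axis conjugation and negation agree, while [TT] commutes with both. *)
Lemma TT_re0 (y : R) : Re (TT (0, y)) = 0.
Proof.
  pose proof (TT_conj _ (dom_axis y)) as H1. pose proof (TT_opp _ (dom_axis y)) as H2.
  replace (Cconj (0, y)) with (Copp (0, y)) in H1 by Cparts.
  rewrite H1 in H2. apply (f_equal Re) in H2.
  change (Re (Cconj (TT (0, y)))) with (Re (TT (0, y))) in H2.
  change (Re (- TT (0, y))%C) with (- Re (TT (0, y))) in H2. lra.
Qed.

Lemma TT_real (x : R) : Im (TT x) = 0.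
Proof.
  pose proof (TT_conj _ (dom_R x)) as H1. rewrite Cconj_R in H1.
  apply (f_equal Im) in H1. change (Im (Cconj (TT x))) with (- Im (TT x)) in H1. lra.
Qed.

Lemma cos_sqr_pos (y : R) : - (PI / 2) < y < PI / 2 -> 0 < cos y * cos y.
Proof. intros H. assert (0 < cos y) by (apply cos_gt_0; lra). nra. Qed.

Lemma GG_axis (y : R) : GG (0, y) = RtoC (Gr (cos y * cos y)).
Proof. apply GG_real; [|apply XX_im]. pose proof bb_bounds. nra. Qed.

Lemma GG_R (x : R) : GG x = RtoC (Gr (cosh x * cosh x)).
Proof. apply GG_real; [|apply XX_R]. pose proof bb_bounds. nra. Qed.

(** The ends +-pi/2, where [GG] vanishes, are allowed because the mean value point is interior. *)
Lemma TT_axis_incr (y1 y2 : R) :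
  - (PI / 2) <= y1 -> y1 < y2 -> y2 <= PI / 2 -> Im (TT (0, y1)) < Im (TT (0, y2)).
Proof.
  intros H1 H2 H3.
  destruct (TT_vertical 0 y1 y2 (- Ci) H2) as (c & Hc & E); [intros; apply dom_axis|].
  rewrite !Re_mCi, Im_Ci, Im_minus, GG_axis in E.
  pose proof (Gr_pos _ (cos_sqr_pos c ltac:(lra))).
  change (Re (RtoC (Gr (cos c * cos c)))) with (Gr (cos c * cos c)) in E. nra.
Qed.

Lemma TT_R_incr (x1 x2 : R) : x1 < x2 -> Re (TT x1) < Re (TT x2).
Proof.
  intros H. destruct (TT_horizontal x1 x2 0 1 H) as (c & Hc & E); [intros; apply dom_R|].
  rewrite !Re_1, Re_minus in E. change (c, 0) with (RtoC c) in E. rewrite GG_R in E.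
  assert (0 < cosh c * cosh c) by (pose proof (cosh_gt_0 c); nra).
  pose proof (Gr_pos _ H0).
  change (Re (RtoC (Gr (cosh c * cosh c)))) with (Gr (cosh c * cosh c)) in E.
  change (x2, 0) with (RtoC x2) in E. change (x1, 0) with (RtoC x1) in E. nra.
Qed.

Definition AT : R := Im (TT ipi2).

Lemma TT_ipi2 : TT ipi2 = (0, AT).
Proof. apply Ceq; [apply TT_re0|reflexivity]. Qed.

Lemma AT_pos : 0 < AT.
Proof.
  pose proof PI_RGT_0. pose proof (TT_axis_incr 0 (PI / 2) ltac:(lra) ltac:(lra) ltac:(lra)).
  change (0, 0) with (RtoC 0) in H0. rewrite TT_0 in H0. exact H0.
Qed.

Lemma TT_Im_row_incr (x1 x2 y : R) :
  0 <= x1 -> x1 < x2 -> 0 < y < PI / 2 -> Im (TT (x1, y)) < Im (TT (x2, y)).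
Proof.
  intros H1 H2 Hy. destruct (TT_horizontal x1 x2 y (- Ci) H2) as (c & Hc & E).
  - intros x Hx. left. unfold strip, Im. simpl. lra.
  - rewrite !Re_mCi, Im_minus in E.
    assert (HG : 0 < Im (GG (c, y))) by (apply GG_Im_pos; unfold Re, Im; simpl; lra). nra.
Qed.

Lemma TT_Im_pos (x y : R) : 0 <= x -> 0 < y < PI / 2 -> 0 < Im (TT (x, y)).
Proof.
  intros Hx Hy.
  assert (H0 : 0 < Im (TT (0, y))).
  { pose proof (TT_axis_incr 0 y ltac:(lra) ltac:(lra) ltac:(lra)).
    change (0, 0) with (RtoC 0) in H. rewrite TT_0 in H. exact H. }
  destruct Hx as [Hx|<-]; [|exact H0].
  pose proof (TT_Im_row_incr 0 x y ltac:(lra) Hx Hy). lra.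
Qed.

Lemma TT_conj_pair (x y : R) : dom (x, y) -> TT (x, - y) = Cconj (TT (x, y)).
Proof. intros H. apply (TT_conj _ H). Qed.

(** On a convex set, a derivative with positive imaginary part forces injectivity: with k = - i / (b
    - a) the mean value theorem equates Im ((T b - T a) / (b - a)) with Im [GG] at a point of the
    segment. *)
Lemma TT_inj_quadrant (a b : C) :
  0 < Re a -> 0 < Im a < PI / 2 -> 0 < Re b -> 0 < Im b < PI / 2 -> TT a = TT b -> a = b.
Proof.
  intros Ha1 Ha2 Hb1 Hb2 E. apply NNPP. intros Hn.
  set (h := (b - a)%C).
  assert (Hh : h <> 0).
  { intros E0. apply Hn. symmetry. apply Ceq_minus. exact E0. }
  assert (Hin : forall u : R, 0 <= u <= 1 ->
     0 < Re (a + u * h)%C /\ 0 < Im (a + u * h)%C < PI / 2).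
  { intros u Hu. unfold h.
    change (Re (a + u * (b - a))%C) with (Re a + Re (u * (b - a))%C).
    change (Im (a + u * (b - a))%C) with (Im a + Im (u * (b - a))%C).
    rewrite Re_scal, Im_scal, Re_minus, Im_minus.
    destruct (Req_dec u 0) as [->|E0]; [lra|].
    assert (0 < u) by lra. repeat split; nra. }
  destruct (Cmvt TT GG a b (- Ci * / h)%C) as (u & Hu & H).
  - intros u Hu. apply TT_Cder. destruct (Hin u Hu). left. unfold strip, h in *. lra.
  - fold h in H. rewrite E in H.
    replace (- Ci * / h * (GG (a + u * h) * h))%C with (- Ci * GG (a + u * h))%C in H
      by (field; exact Hh).
    rewrite Re_mCi in H. replace (- Ci * / h * (TT b - TT b))%C with (RtoC 0) in H by ring.
    destruct (Hin u ltac:(lra)) as [H1 H2].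
    pose proof (GG_Im_pos _ H1 H2). change (Re (RtoC 0)) with 0 in H. lra.
Qed.

Lemma TT_Im_sign (z : C) : 0 < Re z -> strip z ->
  (0 < Im z -> 0 < Im (TT z)) /\ (Im z < 0 -> Im (TT z) < 0) /\ (Im z = 0 -> Im (TT z) = 0).
Proof.
  destruct z as [x y]. unfold strip. change (Re (x, y)) with x. change (Im (x, y)) with y.
  intros Hx Hy. repeat split; intros H.
  - apply TT_Im_pos; lra.
  - pose proof (TT_Im_pos x (- y) ltac:(lra) ltac:(lra)).
    replace (x, y) with (x, - - y) by (f_equal; ring).
    rewrite TT_conj_pair by (left; unfold strip, Im; simpl; lra).
    change (Im (Cconj (TT (x, - y)))) with (- Im (TT (x, - y))). lra.
  - subst y. apply TT_real.
Qed.

(** Im T has the sign of Im z, so equal values lie in the same part: the upper quarter strip, its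
    conjugate, or the real axis, where T is increasing. *)
Lemma TT_inj_right (a b : C) : 0 < Re a -> strip a -> 0 < Re b -> strip b -> TT a = TT b -> a = b.
Proof.
  intros Ha1 Ha2 Hb1 Hb2 E.
  destruct (TT_Im_sign a Ha1 Ha2) as (A1 & A2 & A3).
  destruct (TT_Im_sign b Hb1 Hb2) as (B1 & B2 & B3). rewrite E in A1, A2, A3.
  unfold strip in *.
  destruct (Rtotal_order (Im a) 0) as [H|[H|H]], (Rtotal_order (Im b) 0) as [H'|[H'|H']];
    try specialize (A1 H); try specialize (A2 H); try specialize (A3 H);
    try specialize (B1 H'); try specialize (B2 H'); try specialize (B3 H'); try lra.
  - assert (E2 : Cconj a = Cconj b).
    { apply TT_inj_quadrant; try assumption;
        try (change (Im (Cconj a)) with (- Im a); lra); try (change (Im (Cconj b)) with (- Im b); lra).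
      rewrite !TT_conj by (left; unfold strip; lra). rewrite E. reflexivity. }
    rewrite <- (Cconj_conj a), <- (Cconj_conj b), E2. reflexivity.
  - assert (Ea : a = RtoC (Re a)) by (apply Ceq; [reflexivity|exact H]).
    assert (Eb : b = RtoC (Re b)) by (apply Ceq; [reflexivity|exact H']).
    rewrite Ea, Eb in E. apply Ceq; [|lra].
    destruct (Rtotal_order (Re a) (Re b)) as [L|[L|L]]; [|exact L|].
    + apply TT_R_incr in L. rewrite E in L. lra.
    + apply TT_R_incr in L. rewrite E in L. lra.
  - apply TT_inj_quadrant; try assumption; lra.
Qed.

(* [TT] is not injective on the whole strip, its image overlaps itself beyond +-iA. *)
Definition Om (z : C) : Prop :=
  strip z /\ (0 < Re z -> 0 < Re (TT z)) /\ (Re z < 0 -> Re (TT z) < 0).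

Lemma TT_inj_Om (a b : C) : Om a -> Om b -> TT a = TT b -> a = b.
Proof.
  intros (Ha1 & Ha2 & Ha3) (Hb1 & Hb2 & Hb3) E. rewrite E in Ha2, Ha3.
  assert (Z : forall z, Re z = 0 -> Re (TT z) = 0).
  { intros [x y]. change (Re (x, y)) with x. intros ->. apply TT_re0. }
  destruct (Rtotal_order (Re a) 0) as [H|[H|H]], (Rtotal_order (Re b) 0) as [H'|[H'|H']];
    try specialize (Ha2 H); try specialize (Ha3 H); try specialize (Hb2 H'); try specialize (Hb3 H');
    try (pose proof (Z a H) as ZA; rewrite E in ZA); try (pose proof (Z b H') as ZB); try lra.
  - assert (E2 : Copp a = Copp b).
    { unfold strip in *. apply TT_inj_right.
      - change (Re (- a)%C) with (- Re a). lra.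
      - unfold strip. change (Im (- a)%C) with (- Im a). lra.
      - change (Re (- b)%C) with (- Re b). lra.
      - unfold strip. change (Im (- b)%C) with (- Im b). lra.
      - rewrite !TT_opp by (left; assumption). rewrite E. reflexivity. }
    replace a with (- - a)%C by ring. rewrite E2. ring.
  - destruct a as [x y], b as [x' y']. unfold strip, Re, Im in H, H', Ha1, Hb1. simpl in *. subst x x'.
    f_equal. destruct (Rtotal_order y y') as [L|[L|L]]; [|exact L|].
    + pose proof (TT_axis_incr y y' ltac:(lra) L ltac:(lra)). rewrite E in H. lra.
    + pose proof (TT_axis_incr y' y ltac:(lra) L ltac:(lra)). rewrite E in H. lra.
  - apply TT_inj_right; assumption.
Qed.

Lemma Om_axis (y : R) : - (PI / 2) < y < PI / 2 -> Om (0, y).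
Proof.
  intros H. split; [exact H|]. change (Re (0, y)) with 0. split; intros; lra.
Qed.

Lemma Om_conj (z : C) : Om z -> Om (Cconj z).
Proof.
  intros (H1 & H2 & H3). unfold Om. rewrite TT_conj by (left; exact H1).
  split; [|split; assumption]. unfold strip in *. change (Im (Cconj z)) with (- Im z). lra.
Qed.

Lemma Om_opp (z : C) : Om z -> Om (- z).
Proof.
  intros (H1 & H2 & H3). unfold Om. rewrite TT_opp by (left; exact H1).
  split; [|split].
  - unfold strip in *. change (Im (- z)%C) with (- Im z). lra.
  - change (Re (- z)%C) with (- Re z). change (Re (- TT z)%C) with (- Re (TT z)).
    intros H. specialize (H3 ltac:(lra)). lra.
  - change (Re (- z)%C) with (- Re z). change (Re (- TT z)%C) with (- Re (TT z)).
    intros H. specialize (H2 ltac:(lra)). lra.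
Qed.

Lemma Om_open_right (z : C) :
  Om z -> 0 < Re z -> exists e, 0 < e /\ forall y, Cmod (y - z) < e -> Om y.
Proof.
  intros (Hs & H1 & H2) H. destruct (open_strip z Hs) as (e1 & He1 & Hb1).
  specialize (H1 H).
  destruct (proj1 (Ccont_eps _ _) (TT_cont z (strip_dom z Hs)) (Re (TT z))) as (e2 & He2 & Hb2); [lra|].
  exists (Rmin (Re z) (Rmin e1 e2)). split; [repeat apply Rmin_glb_lt; lra|]. intros y Hy.
  apply Rmin_Rgt_l in Hy. destruct Hy as [Hy0 Hy]. apply Rmin_Rgt_l in Hy. destruct Hy as [Hy1 Hy2].
  pose proof (re_le_Cmod (y - z)) as R1. apply Rabs_le_between in R1. rewrite Re_minus in R1.
  pose proof (re_le_Cmod (TT y - TT z)) as R2. apply Rabs_le_between in R2. rewrite Re_minus in R2.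
  specialize (Hb2 y Hy2). split; [apply Hb1, Hy1|]. split; intros; lra.
Qed.

Lemma Om_open : open_eps Om.
Proof.
  intros z HOm. destruct (Rtotal_order (Re z) 0) as [H|[H|H]].
  - destruct (Om_open_right (- z)%C (Om_opp z HOm)) as (e & He & Hb).
    + change (Re (- z)%C) with (- Re z). lra.
    + exists e. split; [exact He|]. intros y Hy. replace y with (- - y)%C by ring.
      apply Om_opp, Hb. replace (- y - - z)%C with (- (y - z))%C by ring. rewrite Cmod_opp. exact Hy.
  - (* on the imaginary axis [GG] is real and positive *)
    destruct HOm as [Hs _]. destruct (open_strip z Hs) as (e1 & He1 & Hb1).
    assert (HG : 0 < Re (GG z)).
    { destruct z as [x y]. unfold Re in H. simpl in H. subst x. rewrite GG_axis.
      apply (Gr_pos _ (cos_sqr_pos y Hs)). }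
    destruct (proj1 (Ccont_eps _ _) (GG_cont z (strip_dom z Hs)) (Re (GG z))) as (e2 & He2 & Hb2);
      [exact HG|].
    exists (Rmin e1 e2). split; [apply Rmin_glb_lt; assumption|]. intros w Hw.
    apply Rmin_Rgt_l in Hw. destruct Hw as [Hw1 Hw2].
    split; [apply Hb1, Hw1|].
    destruct w as [x y]. change (Re (x, y)) with x.
    assert (Hpos : forall c, Rabs c <= Rabs x -> 0 < Re (GG (c, y))).
    { intros c Hc. assert (Hcm : Cmod ((c, y) - z) <= Cmod ((x, y) - z)).
      { pose proof (Cmod_ge_0 ((c, y) - z)). pose proof (Cmod_ge_0 ((x, y) - z)).
        pose proof (Cmod_sqr ((c, y) - z)) as S1. pose proof (Cmod_sqr ((x, y) - z)) as S2.
        rewrite !Re_minus, !Im_minus, H in S1, S2. unfold Re, Im in S1, S2. simpl in S1, S2.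
        assert (c * c <= x * x) by (apply Rsqr_le_abs_1; exact Hc). nra. }
      specialize (Hb2 (c, y) ltac:(lra)).
      pose proof (re_le_Cmod (GG (c, y) - GG z)) as R2. apply Rabs_le_between in R2.
      rewrite Re_minus in R2. lra. }
    assert (Hdom : forall c, dom (c, y)).
    { intros c. left. apply (Hb1 (x, y) Hw1). }
    split; intros Hx.
    + destruct (TT_horizontal 0 x y 1 Hx) as (c & Hc & E); [intros; apply Hdom|].
      rewrite !Re_1, Re_minus, TT_re0 in E.
      assert (0 < Re (GG (c, y))) by (apply Hpos; rewrite !Rabs_pos_eq; lra). nra.
    + destruct (TT_horizontal x 0 y 1 Hx) as (c & Hc & E); [intros; apply Hdom|].
      rewrite !Re_1, Re_minus, TT_re0 in E.
      assert (0 < Re (GG (c, y))) by (apply Hpos; rewrite !Rabs_left; lra). nra.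
  - apply Om_open_right; assumption.
Qed.

(** * Image of the complex time *)

Lemma Cmod_csqrt_sqr (z : C) : slit z -> Cmod (csqrt z) * Cmod (csqrt z) = Cmod z.
Proof. intros H. rewrite <- Cmod_mult, csqrt_sqr by exact H. reflexivity. Qed.

Lemma Cmod_XX (z : C) : Cmod (XX z) = sinh (Re z) * sinh (Re z) + cos (Im z) * cos (Im z).
Proof.
  unfold XX. rewrite Cmod_mult, Cmod_sqr. unfold ccosh at 1 2 3 4. unfold Re at 1 3, Im at 2 4. simpl.
  pose proof (sin2_cos2' (Im z)). pose proof (cosh2_sinh2 (Re z)).
  transitivity ((cosh (Re z) * cosh (Re z)) * (cos (Im z) * cos (Im z)) +
    sinh (Re z) * sinh (Re z) * (sin (Im z) * sin (Im z))); [ring|].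
  rewrite H0. replace (sin (Im z) * sin (Im z)) with (1 - cos (Im z) * cos (Im z)) by lra. ring.
Qed.

Lemma GG_bound (z : C) : 3 <= Re z -> strip z -> Cmod (GG z) <= 2 * KK.
Proof.
  intros Hx Hz. constants.
  assert (HX : 9 <= Cmod (XX z)).
  { rewrite Cmod_XX. pose proof (sinh_ge_id (Re z) ltac:(lra)). nra. }
  assert (He : forall e, 1 < e < 3 -> Cmod (XX z) / 2 <= Cmod (csqrt (XX z + e)) * Cmod (csqrt (XX z + e))).
  { intros e He. rewrite Cmod_csqrt_sqr by (apply XX_slit; [apply strip_dom, Hz|lra]).
    pose proof (Cmod_tri_inv (XX z) (XX z + e)) as T.
    replace (XX z - (XX z + e))%C with (RtoC (- e)) in T by (rewrite RtoC_opp; ring).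
    rewrite Cmod_R, Rabs_Ropp, Rabs_pos_eq in T by lra. lra. }
  pose proof (He bb ltac:(lra)) as HP. pose proof (He dd ltac:(lra)) as HQ.
  fold (PP z) in HP. fold (QQ z) in HQ.
  assert (HPQ : (PP z * QQ z)%C <> 0)
    by (apply Cmult_neq_0; [apply PP_neq0|apply QQ_neq0]; apply strip_dom, Hz).
  unfold GG. rewrite Cmod_mult, (Cmod_inv _ HPQ), !Cmod_mult, Cmod_R, Rabs_pos_eq by lra.
  assert (HPQ2 : Cmod (XX z) / 2 <= Cmod (PP z) * Cmod (QQ z)).
  { pose proof (Cmod_ge_0 (PP z)). pose proof (Cmod_ge_0 (QQ z)).
    assert ((Cmod (XX z) / 2) * (Cmod (XX z) / 2) <= (Cmod (PP z) * Cmod (QQ z)) * (Cmod (PP z) * Cmod (QQ z))).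
    { replace ((Cmod (PP z) * Cmod (QQ z)) * (Cmod (PP z) * Cmod (QQ z)))
        with ((Cmod (PP z) * Cmod (PP z)) * (Cmod (QQ z) * Cmod (QQ z))) by ring.
      apply Rmult_le_compat; lra. }
    apply Rsqr_incr_0_var; [exact H1|]. apply Rmult_le_pos; assumption. }
  apply Rle_div_l; [lra|]. nra.
Qed.

Lemma Gr_ge (r : R) : 3 <= r -> KK / 2 <= Gr r.
Proof.
  intros Hr. constants.
  unfold Gr. assert (P1 : sqrt (r + bb) * sqrt (r + bb) = r + bb) by (apply sqrt_sqrt; lra).
  assert (P2 : sqrt (r + dd) * sqrt (r + dd) = r + dd) by (apply sqrt_sqrt; lra).
  assert (0 < sqrt (r + bb)) by (apply sqrt_lt_R0; lra).
  assert (0 < sqrt (r + dd)) by (apply sqrt_lt_R0; lra).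
  assert (sqrt (r + bb) * sqrt (r + dd) <= 2 * r).
  { pose proof (Rle_0_sqr (sqrt (r + bb) - sqrt (r + dd))) as S. unfold Rsqr in S. nra. }
  refine (proj1 (Rle_div_r _ _ _ _) _); [apply Rmult_lt_0_compat; assumption|]. nra.
Qed.

(** On the real axis T grows at least linearly, while along a vertical segment of the strip, of
    length at most pi/2, it changes by at most K pi. Far right edges of rectangles are thus mapped
    beyond any target. *)
Lemma TT_growth (M : R) :
  exists X, 1 < X /\ forall y, - (PI / 2) < y < PI / 2 -> M < Re (TT (X, y)).
Proof.
  pose proof KK_bounds as HK. pose proof PI_RGT_0 as HPI. pose proof (Rle_abs M) as HM.
  pose proof (Rabs_pos M) as HM0.
  (* Re T > 0 at 3 and the slope beyond 3 is at least K / 2, so this X makes Re (T X) exceed |M| + K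
     pi. *)
  set (X := 4 + 2 / KK * (Rabs M + KK * PI)).
  assert (HX : 4 <= X).
  { assert (0 <= 2 / KK * (Rabs M + KK * PI)); [|unfold X; lra].
    apply Rmult_le_pos; [apply Rlt_le, Rdiv_lt_0_compat; lra|nra]. }
  exists X. split; [lra|]. intros y Hy.
  assert (H1 : Rabs M + KK * PI < Re (TT X)).
  { destruct (TT_horizontal 3 X 0 1 ltac:(lra)) as (c & Hc & E); [intros; apply dom_R|].
    rewrite !Re_1, Re_minus in E. change (c, 0) with (RtoC c) in E. rewrite GG_R in E.
    change (Re (RtoC (Gr (cosh c * cosh c)))) with (Gr (cosh c * cosh c)) in E.
    change (X, 0) with (RtoC X) in E. change (3, 0) with (RtoC 3) in E.
    pose proof (TT_R_incr 0 3 ltac:(lra)) as H3. rewrite TT_0 in H3. change (Re (RtoC 0)) with 0 in H3.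
    assert (Hg : KK / 2 <= Gr (cosh c * cosh c)).
    { apply Gr_ge. rewrite cosh2_sinh2. pose proof (sinh_ge_id c ltac:(lra)). nra. }
    assert ((X - 3) * (KK / 2) <= Re (TT X)) by nra.
    assert ((X - 3) * (KK / 2) = KK / 2 + (Rabs M + KK * PI)) by (unfold X; field; lra). lra. }
  assert (H2 : Cmod (TT (X, y) - TT X) <= 2 * KK * Cmod ((X, y) - X)).
  { assert (Es : forall u : R, (X + u * ((X, y) - X))%C = (X, u * y))
      by (intros u; Cparts).
    assert (Hs : forall u : R, 0 <= u <= 1 -> strip (X, u * y)).
    { intros u Hu. unfold strip, Im. simpl. destruct (Req_dec u 0) as [->|]; [lra|].
      assert (0 < u) by lra. split; nra. }
    apply (Cmvt_le TT GG).
    - intros u Hu. apply TT_Cder, strip_dom. rewrite Es. apply Hs, Hu.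
    - intros u Hu. apply GG_bound; rewrite Es; [unfold Re; simpl; lra|apply Hs; lra]. }
  replace ((X, y) - X)%C with (0, y) in H2 by Cparts.
  assert (Cmod (0, y) <= PI / 2).
  { eapply Rle_trans; [apply Cmod_le_abs|]. unfold Re, Im. simpl. rewrite Rabs_R0.
    assert (Rabs y <= PI / 2) by (apply Rabs_le; lra). lra. }
  pose proof (re_le_Cmod (TT (X, y) - TT X)) as R2. apply Rabs_le_between in R2.
  rewrite Re_minus in R2. nra.
Qed.

Lemma GG_top (x : R) : - (1 / 2) < x < 1 / 2 -> GG (x, PI / 2) = RtoC (Gr (- (sinh x * sinh x))).
Proof.
  intros Hx. apply GG_real; [|apply XX_top]. pose proof (sinh_half x Hx). pose proof bb_bounds. lra.
Qed.

Lemma Gr_top_neg (x : R) : 0 < x < 1 / 2 -> Gr (- (sinh x * sinh x)) < 0.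
Proof.
  intros Hx. apply Gr_neg. pose proof (sinh_half x ltac:(lra)). pose proof bb_bounds.
  pose proof (sinh_gt_0 x ltac:(lra)). nra.
Qed.

Lemma dom_top (x : R) (y : R) : - (1 / 2) < x < 1 / 2 -> dom (x, y).
Proof. intros H. right. exact H. Qed.

(** On this edge X = - sinh^2 x is real, hence so is [GG], and T moves horizontally away from i
    [AT]. It moves to the left, see [TT_top_Re], because X is negative there. *)
Lemma TT_top_Im (x : R) : 0 < x < 1 / 2 -> Im (TT (x, PI / 2)) = AT.
Proof.
  intros Hx. destruct (TT_horizontal 0 x (PI / 2) (- Ci) ltac:(lra)) as (c & Hc & E).
  - intros; apply dom_top; lra.
  - rewrite !Re_mCi, Im_minus, GG_top in E by lra.
    change (Im (RtoC (Gr (- (sinh c * sinh c))))) with 0 in E. unfold AT, ipi2. lra.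
Qed.

Lemma TT_top_Re (x : R) : 0 <= x < 1 / 2 -> Re (TT (x, PI / 2)) <= 0.
Proof.
  intros [[Hx| <-] Hx2]; [|rewrite TT_re0; lra].
  destruct (TT_horizontal 0 x (PI / 2) 1 ltac:(lra)) as (c & Hc & E).
  - intros; apply dom_top; lra.
  - rewrite !Re_1, Re_minus, GG_top, TT_re0 in E by lra.
    change (Re (RtoC (Gr (- (sinh c * sinh c))))) with (Gr (- (sinh c * sinh c))) in E.
    pose proof (Gr_top_neg c ltac:(lra)). nra.
Qed.

(* [TT] has further branch points on the line Im z = PI / 2; this lemma provides a horizontal line
   below it whose image avoids the part Re t >= e of the closed strip |Im t| <= AT. *)
Lemma corner_escape (e : R) : 0 < e ->
  exists x Y, 0 < x /\ 0 < Y < PI / 2 /\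
    (forall c, 0 <= c <= x -> Re (TT (c, Y)) < e) /\ AT < Im (TT (x, Y)).
Proof.
  intros He. pose proof PI_RGT_0 as HPI.
  assert (Hdi : dom ipi2) by apply dom_axis.
  destruct (proj1 (Ccont_eps _ _) (TT_cont _ Hdi) e He) as (d & Hd & H).
  set (x := Rmin (d / 4) (1 / 4)).
  assert (Hx : 0 < x) by (apply Rmin_glb_lt; lra).
  assert (Hx1 : x <= d / 4) by apply Rmin_l. assert (Hx2 : x <= 1 / 4) by apply Rmin_r.
  assert (Hdx : dom (x, PI / 2)) by (apply dom_top; lra).
  pose proof (Gr_top_neg x ltac:(lra)) as Hneg.
  assert (HGx : Re (GG (x, PI / 2)) = Gr (- (sinh x * sinh x))) by (rewrite GG_top by lra; reflexivity).
  (* Within d2 of (x, pi/2) the real part of [GG] stays negative. It is the derivative of Im T in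
     the vertical direction, so descending from the top edge raises Im T above [AT]. *)
  destruct (proj1 (Ccont_eps _ _) (GG_cont _ Hdx) (- Gr (- (sinh x * sinh x)))) as (d2 & Hd2 & H2); [lra|].
  set (y := Rmin (d / 4) (Rmin (d2 / 2) (PI / 4))).
  assert (Hy : 0 < y) by (repeat apply Rmin_glb_lt; lra).
  assert (Hy1 : y <= d / 4) by apply Rmin_l.
  assert (Hy2 : y <= d2 / 2) by (eapply Rle_trans; [apply Rmin_r|apply Rmin_l]).
  assert (Hy3 : y <= PI / 4) by (eapply Rle_trans; [apply Rmin_r|apply Rmin_r]).
  exists x, (PI / 2 - y). split; [exact Hx|]. split; [lra|]. split.
  - intros c Hc. specialize (H (c, PI / 2 - y)).
    assert (Hm : Cmod ((c, PI / 2 - y) - ipi2) < d).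
    { eapply Rle_lt_trans; [apply Cmod_le_abs|]. rewrite Re_minus, Im_minus. unfold ipi2, Re, Im. simpl.
      replace (PI / 2 - y - PI / 2) with (- y) by ring. rewrite Rabs_Ropp, Rminus_0_r, !Rabs_pos_eq; lra. }
    specialize (H Hm). pose proof (re_le_Cmod (TT (c, PI / 2 - y) - TT ipi2)) as R2.
    apply Rabs_le_between in R2. rewrite Re_minus, TT_ipi2 in R2. rewrite TT_ipi2 in H.
    change (Re (0, AT)) with 0 in R2. lra.
  - destruct (TT_vertical x (PI / 2 - y) (PI / 2) (- Ci) ltac:(lra)) as (c & Hc & E).
    + intros; apply dom_top; lra.
    + rewrite !Re_mCi, Im_Ci, Im_minus, TT_top_Im in E by lra.
      assert (Hm : Cmod ((x, c) - (x, PI / 2)) < d2).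
      { eapply Rle_lt_trans; [apply Cmod_le_abs|]. rewrite Re_minus, Im_minus. unfold Re, Im. simpl.
        rewrite Rminus_diag, Rabs_R0, Rabs_left1; lra. }
      specialize (H2 _ Hm). pose proof (re_le_Cmod (GG (x, c) - GG (x, PI / 2))) as R2.
      apply Rabs_le_between in R2. rewrite Re_minus, HGx in R2.
      assert (Re (GG (x, c)) < 0) by lra. nra.
Qed.

(** The four edges miss the target: the left one has Re T = 0, the right one Re T > M, and the top
    one is handled by [corner_escape]; the bottom one is its conjugate. *)
Lemma strip_onto_right (t : C) : 0 < Re t -> Rabs (Im t) <= AT -> exists z, Om z /\ TT z = t.
Proof.
  intros Ht1 Ht2. pose proof PI_RGT_0 as HPI.
  assert (HT1 : 0 < Re (TT 1)).
  { pose proof (TT_R_incr 0 1 ltac:(lra)) as H. rewrite TT_0 in H. exact H. }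
  (* Chosen so that the target contains both t and T 1, the starting value of the open-closed
     argument. *)
  set (e := Rmin (Re t) (Re (TT 1))). set (M := Rmax (Re t) (Re (TT 1))).
  assert (He : 0 < e) by (apply Rmin_glb_lt; assumption).
  destruct (corner_escape e He) as (x & Y & Hx & HY & Hc1 & Hc2).
  destruct (TT_growth M) as (X & HX & HXy).
  set (P := fun w : C => e <= Re w <= M /\ - AT <= Im w <= AT).
  destruct (rect_onto TT GG 0 X (- Y) Y P) with (t := t) as (z & Hz & E).
  - intros z [Hz1 Hz2]. apply TT_cont, strip_dom. unfold strip. lra.
  - intros z Hz1 Hz2. assert (strip z) by (unfold strip; lra).
    split; [|split]; [apply TT_Cder|apply GG_cont|apply GG_neq0]; auto using strip_dom.
  - intros [a b] [Ha Hb] [HP1 HP2].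
    change (Re (a, b)) with a in *. change (Im (a, b)) with b in *.
    (* Up to x the corner estimate bounds Re T; beyond x, Im T has already passed [AT] and keeps
       increasing along the row. *)
    assert (Htop : Re (TT (a, Y)) < e \/ AT < Im (TT (a, Y))).
    { destruct (Rle_or_lt a x) as [L|L]; [left; apply Hc1; lra|right].
      pose proof (TT_Im_row_incr x a Y ltac:(lra) L HY). lra. }
    split; split.
    + destruct Ha as [[Ha| <-] _]; [exact Ha|]. rewrite TT_re0 in HP1. lra.
    + destruct Ha as [_ [Ha| ->]]; [exact Ha|]. specialize (HXy b ltac:(lra)). lra.
    + destruct Hb as [[Hb| <-] _]; [exact Hb|].
      rewrite TT_conj_pair in HP1, HP2 by (left; unfold strip, Im; simpl; lra).
      change (Re (Cconj (TT (a, Y)))) with (Re (TT (a, Y))) in HP1.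
      change (Im (Cconj (TT (a, Y)))) with (- Im (TT (a, Y))) in HP2. lra.
    + destruct Hb as [_ [Hb| ->]]; [exact Hb|]. lra.
  - intros a b u [Ha1 Ha2] [Hb1 Hb2] Hu. unfold P.
    change (Re (a + u * (b - a))%C) with (Re a + Re (u * (b - a))%C).
    change (Im (a + u * (b - a))%C) with (Im a + Im (u * (b - a))%C).
    rewrite Re_scal, Im_scal, Re_minus, Im_minus. split; split; nra.
  - exists (RtoC 1). split.
    + unfold rect, RtoC, Re, Im. simpl. lra.
    + unfold P. rewrite TT_real. split; [split; [apply Rmin_r|apply Rmax_r]|]. pose proof AT_pos. lra.
  - unfold P. split; [split; [apply Rmin_l|apply Rmax_l]|]. apply Rabs_le_between, Ht2.
  - exists z. split; [|exact E]. split; [unfold strip; lra|]. rewrite E. split; intros; lra.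
Qed.

Lemma TT_axis_der (y : R) : is_derive (fun y => Im (TT (0, y))) y (Gr (cos y * cos y)).
Proof.
  apply (is_derive_ext (fun y : R => Re (- Ci * TT (0 + y * Ci))%C)).
  - intros u. rewrite Re_mCi. do 2 f_equal. Cparts.
  - eapply is_derive_val; [apply (Cder_line TT 0 Ci (- Ci))|].
    + apply TT_Cder. replace (0 + y * Ci)%C with ((0, y) : C) by Cparts.
      apply dom_axis.
    + replace (0 + y * Ci)%C with ((0, y) : C) by Cparts.
      rewrite Re_mCi, Cmult_comm, Im_Ci, GG_axis. reflexivity.
Qed.

Lemma axis_onto (y1 y2 v : R) :
  y1 < y2 -> Im (TT (0, y1)) < v < Im (TT (0, y2)) -> exists y, y1 < y < y2 /\ TT (0, y) = (0, v).
Proof.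
  intros Hy Hv.
  destruct (IVT_gen (fun y => Im (TT (0, y))) y1 y2 v) as (y & Hy1 & Hy2).
  - intros y. eapply is_derive_continuity_pt, TT_axis_der.
  - rewrite Rmin_left, Rmax_right; lra.
  - rewrite Rmin_left, Rmax_right in Hy1 by lra. exists y. split.
    + destruct Hy1 as [[L1|L1] [L2|L2]]; subst; lra.
    + apply Ceq; [apply TT_re0|exact Hy2].
Qed.

Lemma strip_onto (t : C) : Rabs (Im t) <= AT -> (Re t = 0 -> Rabs (Im t) < AT) -> exists z,
  Om z /\ TT z = t.
Proof.
  intros H1 H2. destruct (Rtotal_order (Re t) 0) as [H|[H|H]].
  - destruct (strip_onto_right (- t)%C) as (z & Hz & E).
    + change (Re (- t)%C) with (- Re t). lra.
    + change (Im (- t)%C) with (- Im t). rewrite Rabs_Ropp. exact H1.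
    + exists (- z)%C. split; [apply Om_opp, Hz|]. rewrite TT_opp by (left; apply Hz). rewrite E. ring.
  - specialize (H2 H). apply Rabs_lt_between in H2. pose proof PI_RGT_0.
    destruct (axis_onto (- (PI / 2)) (PI / 2) (Im t)) as (y & Hy & E); [lra| |].
    + rewrite TT_conj_pair by apply dom_axis. exact H2.
    + exists (0, y). split; [apply Om_axis; lra|]. rewrite E. apply Ceq; [symmetry; exact H|reflexivity].
  - apply strip_onto_right; assumption.
Qed.

(** * Expansions at i PI / 2 *)

Lemma RtoC_neq0 (x : R) : x <> 0 -> RtoC x <> 0.
Proof. intros H E. apply RtoC_inj in E. contradiction. Qed.

(** The root of q + e differs from sqrt e by q divided by a sum of modulus at least 1. The bounds on
    e and q keep |q + e| and e above 1, so passing to inverses costs nothing. *)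
Lemma csqrt_near (e : R) (q : C) : 1.5 < e -> Cmod q <= 1 / 4 ->
  let r := csqrt (q + e) in
  r <> 0 /\ 1 <= Cmod r /\ Cmod (r - sqrt e) <= Cmod q /\ Cmod (/ r - / sqrt e) <= Cmod q.
Proof.
  intros He Hq r.
  pose proof (re_le_Cmod q) as Hre. apply Rabs_le_between in Hre.
  assert (Hs : slit (q + e)).
  { apply slit_Re. change (Re (q + e)%C) with (Re q + e). lra. }
  assert (Hse : 1 < sqrt e).
  { rewrite <- sqrt_1. apply sqrt_lt_1; lra. }
  pose proof (csqrt_Re_pos _ Hs) as Hr. pose proof (csqrt_sqr _ Hs) as Hr2.
  pose proof (Cmod_csqrt_sqr _ Hs) as Hm. fold r in Hr, Hr2, Hm.
  pose proof (Cmod_tri_inv e (q + e)) as T. replace (e - (q + e))%C with (- q)%C in T by ring.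
  rewrite Cmod_opp, Cmod_R, Rabs_pos_eq in T by lra.
  assert (H1 : 1 <= Cmod r) by (pose proof (Cmod_ge_0 r); nra).
  assert (H0 : r <> 0) by (apply Re_pos_neq0, Hr).
  assert (Hd : Cmod (r - sqrt e) <= Cmod q).
  { assert (E : ((r - sqrt e) * (r + sqrt e))%C = q).
    { transitivity (r * r - sqrt e * sqrt e)%C; [ring|].
      rewrite Hr2, <- RtoC_mult, sqrt_sqrt by lra. ring. }
    assert (1 <= Cmod (r + sqrt e)).
    { eapply Rle_trans; [|apply re_le_Cmod]. change (Re (r + sqrt e)%C) with (Re r + sqrt e).
      rewrite Rabs_pos_eq; lra. }
    apply (f_equal Cmod) in E. rewrite Cmod_mult in E. pose proof (Cmod_ge_0 (r - sqrt e)). nra. }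
  split; [exact H0|]. split; [exact H1|]. split; [exact Hd|].
  assert (Hs0 : RtoC (sqrt e) <> 0) by (apply RtoC_neq0; lra).
  clearbody r. replace (/ r - / sqrt e)%C with (- (r - sqrt e) / (r * sqrt e))%C by (field; split;
    assumption).
  rewrite Cmod_div by (apply Cmult_neq_0; assumption).
  rewrite Cmod_opp, Cmod_mult, Cmod_R, Rabs_pos_eq by lra.
  apply Rle_div_l; [nra|]. pose proof (Cmod_ge_0 q).
  assert (1 <= Cmod r * sqrt e) by nra. nra.
Qed.

Lemma Cmod_inv_le1 (z : C) : 1 <= Cmod z -> Cmod (/ z) <= 1.
Proof.
  intros H. rewrite Cmod_inv by (apply (proj2 (Cmod_gt_0 z)); lra).
  rewrite <- Rinv_1. apply Rinv_le_contravar; lra.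
Qed.

Lemma Cmod_prod_diff (a b a' b' : C) :
  Cmod (a * b - a' * b') <= Cmod a * Cmod (b - b') + Cmod (a - a') * Cmod b'.
Proof.
  replace (a * b - a' * b')%C with (a * (b - b') + (a - a') * b')%C by ring.
  eapply Rle_trans; [apply Cmod_triangle|]. rewrite !Cmod_mult. lra.
Qed.

Lemma small_Re (u : C) : Cmod u <= 1 / 4 -> - (1 / 2) < Re u < 1 / 2 /\ - (1 / 2) < Im u < 1 / 2.
Proof.
  intros H. pose proof (re_le_Cmod u) as Hr. pose proof (im_le_Cmod u) as Hi.
  apply Rabs_le_between in Hr. apply Rabs_le_between in Hi. lra.
Qed.

Lemma csinh_0 : csinh 0 = 0.
Proof. unfold csinh, Re, Im. simpl. rewrite sinh_0, sin_0. Cparts. Qed.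

Lemma csinh_small (u : C) : Cmod u <= 1 / 4 ->
  Cmod (csinh u) <= 2 * Cmod u /\ Cmod (ccosh u) <= 2 /\
  Cmod (ccosh u - 1) <= Cmod (csinh u) * Cmod (csinh u).
Proof.
  assert (Hc : forall v, Cmod v <= 1 / 4 -> Cmod (ccosh v) <= 2).
  { intros v Hv. destruct (small_Re v Hv) as [Hr _].
    assert (Cmod (ccosh v) * Cmod (ccosh v) <= 4).
    { rewrite <- Cmod_mult. change (ccosh v * ccosh v)%C with (XX v). rewrite Cmod_XX.
      pose proof (sinh_half _ Hr). pose proof (sin2_cos2' (Im v)).
      pose proof (Rle_0_sqr (sin (Im v))) as S. unfold Rsqr in S. lra. }
    pose proof (Cmod_ge_0 (ccosh v)). nra. }
  intros Hu. split; [|split].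
  - replace (csinh u) with (csinh u - csinh 0)%C by (rewrite csinh_0; ring).
    replace (Cmod u) with (Cmod (u - 0)) by (f_equal; ring).
    apply (Cmvt_le csinh ccosh).
    + intros; apply csinh_Cder.
    + intros v Hv. apply Hc. replace (0 + v * (u - 0))%C with (v * u)%C by ring.
      rewrite Cmod_mult, Cmod_R, Rabs_pos_eq by lra. pose proof (Cmod_ge_0 u). nra.
  - apply Hc, Hu.
  - destruct (small_Re u Hu) as [_ Hi].
    assert (Hst : strip u) by (unfold strip; pose proof PI2_3_2; lra).
    pose proof (Re_ccosh_pos u Hst) as Hp.
    assert (1 <= Cmod (ccosh u + 1)).
    { eapply Rle_trans; [|apply re_le_Cmod]. change (Re (ccosh u + 1)%C) with (Re (ccosh u) + 1).
      rewrite Rabs_pos_eq; lra. }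
    (* From cosh^2 - 1 = sinh^2; the second factor has modulus at least 1. *)
    assert (E : Cmod (ccosh u - 1) * Cmod (ccosh u + 1) = Cmod (csinh u) * Cmod (csinh u)).
    { rewrite <- !Cmod_mult. f_equal. transitivity (ccosh u * ccosh u - 1)%C; [ring|].
      rewrite ccosh_sqr. ring. }
    pose proof (Cmod_ge_0 (ccosh u - 1)). nra.
Qed.

(** Lets the bounds obtained by integrating along u be restated in powers of s = sinh u. *)
Lemma csinh_lower (u : C) : Cmod u <= 1 / 4 -> Cmod u <= 2 * Cmod (csinh u).
Proof.
  intros Hu.
  assert (H : Cmod ((csinh u - u) - (csinh 0 - 0)) <= 1 / 4 * Cmod (u - 0)).
  { apply (Cmvt_le (fun v => csinh v - v)%C (fun v => ccosh v - 1)%C).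
    - intros; apply Cder_minus; [apply csinh_Cder|apply Cder_id].
    - intros v Hv. replace (0 + v * (u - 0))%C with (v * u)%C by ring.
      assert (Hvu : Cmod (v * u) <= 1 / 4).
      { rewrite Cmod_mult, Cmod_R, Rabs_pos_eq by lra. pose proof (Cmod_ge_0 u). nra. }
      destruct (csinh_small _ Hvu) as (A & _ & B). pose proof (Cmod_ge_0 (csinh (v * u))). nra. }
  replace (u - 0)%C with u in H by ring.
  rewrite csinh_0 in H.
  replace (csinh u - u - (0 - 0))%C with (csinh u - u)%C in H by ring.
  pose proof (Cmod_tri_inv u (csinh u)) as T. rewrite Cmod_sym in T. pose proof (Cmod_ge_0 u). lra.
Qed.

Lemma XX_shift (u : C) : XX (ipi2 + u) = (- (csinh u * csinh u))%C.
Proof.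
  unfold XX. rewrite ccosh_shift. transitivity ((Ci * Ci) * (csinh u * csinh u))%C; [ring|].
  replace (Ci * Ci)%C with (- RtoC 1)%C by Cparts.
  ring.
Qed.

(** The leading coefficient at the corner: T - i [AT] is close to - kap s^3, because X = - s^2 and
    the two roots tend to sqrt b and sqrt d. *)
Definition kap : R := KK / (3 * (sqrt bb * sqrt dd)).

Section Corner.

Variable u : C.
Hypothesis Hu : Cmod u <= 1 / 4.
Let s := csinh u.

Lemma corner_s2 : Cmod (- (s * s)) <= 1 / 4 /\ Cmod (- (s * s)) = Cmod s * Cmod s.
Proof.
  destruct (csinh_small u Hu) as (A & _ & _). fold s in A.
  rewrite Cmod_opp, Cmod_mult. pose proof (Cmod_ge_0 s). split; nra.
Qed.

Lemma corner_dom : dom (ipi2 + u).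
Proof.
  right. change (Re (ipi2 + u)%C) with (0 + Re u). destruct (small_Re u Hu). lra.
Qed.

Lemma corner_PP :
  PP (ipi2 + u) <> 0 /\ Cmod (/ PP (ipi2 + u)) <= 1 /\
  Cmod (/ PP (ipi2 + u) - / sqrt bb) <= Cmod s * Cmod s.
Proof.
  destruct corner_s2 as [H1 H2]. pose proof bb_bounds.
  destruct (csqrt_near bb (- (s * s))%C) as (A & B & D & E); [lra|exact H1|].
  unfold PP. rewrite XX_shift. fold s. rewrite <- H2.
  split; [exact A|]. split; [apply Cmod_inv_le1, B|exact E].
Qed.

Lemma corner_QQ :
  QQ (ipi2 + u) <> 0 /\ Cmod (/ QQ (ipi2 + u)) <= 1 /\
  Cmod (/ QQ (ipi2 + u) - / sqrt dd) <= Cmod s * Cmod s /\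
  Cmod (QQ (ipi2 + u) - sqrt dd) <= Cmod s * Cmod s.
Proof.
  destruct corner_s2 as [H1 H2]. pose proof dd_bounds.
  destruct (csqrt_near dd (- (s * s))%C) as (A & B & D & E); [lra|exact H1|].
  unfold QQ. rewrite XX_shift. fold s. rewrite <- H2.
  split; [exact A|]. split; [apply Cmod_inv_le1, B|]. split; [exact E|exact D].
Qed.

Lemma corner_mm :
  (XX (ipi2 + u) + mm)%C <> 0 /\ Cmod (/ (XX (ipi2 + u) + mm)) <= 1 /\
  Cmod (/ (XX (ipi2 + u) + mm) - / mm) <= Cmod s * Cmod s.
Proof.
  destruct corner_s2 as [H1 H2]. pose proof mm_bounds.
  rewrite XX_shift. fold s. rewrite <- H2. set (q := (- (s * s))%C) in *.
  pose proof (Cmod_tri_inv mm (q + mm)) as T. replace (mm - (q + mm))%C with (- q)%C in T by ring.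
  rewrite Cmod_opp, Cmod_R, Rabs_pos_eq in T by lra.
  assert (H3 : 1 <= Cmod (q + mm)) by lra.
  assert (H4 : (q + mm)%C <> 0) by (apply (proj2 (Cmod_gt_0 _)); lra).
  split; [exact H4|]. split; [apply Cmod_inv_le1, H3|].
  assert (H5 : RtoC mm <> 0) by (apply RtoC_neq0; lra).
  replace (/ (q + mm) - / mm)%C with (- q / ((q + mm) * mm))%C by (field; split; assumption).
  rewrite Cmod_div by (apply Cmult_neq_0; assumption).
  rewrite Cmod_opp, Cmod_mult, Cmod_R, Rabs_pos_eq by lra.
  apply Rle_div_l; [nra|]. pose proof (Cmod_ge_0 q). assert (1 <= Cmod (q + mm) * mm) by nra. nra.
Qed.

(** The term 3 kap s^2 cosh u is the exact derivative of kap s^3, so [corner_TT] follows by the mean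
    value inequality. The 48 is 3 * 16: the remainder is at most 3 |s|^4, and |s| <= 2 |u|. *)
Lemma corner_TT' :
  Cmod (GG (ipi2 + u) + 3 * kap * (s * s) * ccosh u) <= 48 * (Cmod u * Cmod u * Cmod u * Cmod u).
Proof.
  destruct corner_PP as (P0 & P1 & P2). destruct corner_QQ as (Q0 & Q1 & Q2 & _).
  destruct (csinh_small u Hu) as (A & _ & B). fold s in A, B.
  constants.
  assert (Hsb : 1 < sqrt bb) by (rewrite <- sqrt_1; apply sqrt_lt_1; lra).
  assert (Hsd : 1 < sqrt dd) by (rewrite <- sqrt_1; apply sqrt_lt_1; lra).
  assert (Nb : RtoC (sqrt bb) <> 0) by (apply RtoC_neq0; lra).
  assert (Nd : RtoC (sqrt dd) <> 0) by (apply RtoC_neq0; lra).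
  set (p := (/ PP (ipi2 + u))%C) in *. set (q := (/ QQ (ipi2 + u))%C) in *.
  assert (E : (GG (ipi2 + u) + 3 * kap * (s * s) * ccosh u)%C =
    (KK * (s * s) * (((ccosh u - 1) * (/ sqrt bb * / sqrt dd)) - (p * q - / sqrt bb * / sqrt dd)))%C).
  { unfold GG. rewrite XX_shift. fold s. unfold kap, p, q.
    rewrite RtoC_div, RtoC_mult, RtoC_mult by nra.
    field. repeat split; assumption. }
  rewrite E. rewrite !Cmod_mult, Cmod_R, Rabs_pos_eq by lra.
  set (S := Cmod s * Cmod s) in *.
  assert (HS : 0 <= S) by (unfold S; pose proof (Cmod_ge_0 s); nra).
  assert (Ib : Cmod (/ sqrt bb) <= 1) by (apply Cmod_inv_le1; rewrite Cmod_R, Rabs_pos_eq; lra).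
  assert (Id : Cmod (/ sqrt dd) <= 1) by (apply Cmod_inv_le1; rewrite Cmod_R, Rabs_pos_eq; lra).
  pose proof (Cmod_ge_0 (/ sqrt bb)). pose proof (Cmod_ge_0 (/ sqrt dd)). pose proof (Cmod_ge_0 p).
  assert (E2 : Cmod ((ccosh u - 1) * (/ sqrt bb * / sqrt dd) - (p * q - / sqrt bb * / sqrt dd)) <= 3 * S).
  { unfold Cminus at 1. eapply Rle_trans; [apply Cmod_triangle|]. rewrite Cmod_opp, !Cmod_mult.
    pose proof (Cmod_prod_diff p q (/ sqrt bb) (/ sqrt dd)) as D.
    assert (Cmod (ccosh u - 1) * (Cmod (/ sqrt bb) * Cmod (/ sqrt dd)) <= S * (1 * 1)).
    { apply Rmult_le_compat; [apply Cmod_ge_0|nra|assumption|].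
      apply Rmult_le_compat; assumption. }
    assert (Cmod p * Cmod (q - / sqrt dd) <= 1 * S)
      by (apply Rmult_le_compat; try apply Cmod_ge_0; assumption).
    assert (Cmod (p - / sqrt bb) * Cmod (/ sqrt dd) <= S * 1)
      by (apply Rmult_le_compat; try apply Cmod_ge_0; assumption).
    lra. }
  assert (HSu : S <= 4 * (Cmod u * Cmod u)) by (unfold S; pose proof (Cmod_ge_0 s); nra).
  pose proof (Cmod_ge_0 u) as Hu0.
  eapply Rle_trans; [apply Rmult_le_compat_l; [nra|exact E2]|].
  fold S. assert (KK * S * (3 * S) <= 3 * (S * S)) by nra.
  assert (S * S <= (4 * (Cmod u * Cmod u)) * (4 * (Cmod u * Cmod u))) by (apply Rmult_le_compat;
    assumption).
  lra.
Qed.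

(** The subtracted term is the derivative of (2 / m) s^2, the leading term of lambda - pi. *)
Lemma corner_dlam :
  Cmod (dlam (ipi2 + u) - 2 / mm * (2 * s * ccosh u)) <= 192 * (Cmod u * Cmod u * Cmod u).
Proof.
  destruct corner_PP as (P0 & P1 & P2). destruct corner_mm as (M0 & M1 & M2).
  destruct (csinh_small u Hu) as (A & B & _). fold s in A.
  constants.
  assert (Hsb : 1 < sqrt bb) by (rewrite <- sqrt_1; apply sqrt_lt_1; lra).
  assert (Nb : RtoC (sqrt bb) <> 0) by (apply RtoC_neq0; lra).
  assert (Nm : RtoC mm <> 0) by (apply RtoC_neq0; lra).
  assert (E8 : sqrt (8 * mm) = 4 * sqrt bb).
  { replace (8 * mm) with ((4 * 4) * bb) by (unfold bb; field).
    rewrite sqrt_mult, sqrt_square by lra. reflexivity. }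
  set (p := (/ PP (ipi2 + u))%C) in *. set (q := (/ (XX (ipi2 + u) + mm))%C) in *.
  assert (E : (dlam (ipi2 + u) - 2 / mm * (2 * s * ccosh u))%C =
    (4 * sqrt bb * (s * ccosh u) * (p * q - / sqrt bb * / mm))%C).
  { unfold dlam. rewrite ccosh_shift, csinh_shift. fold s. rewrite E8, RtoC_mult. unfold p, q.
    replace (Ci * ccosh u * (Ci * s))%C with (- (s * ccosh u))%C.
    - field. repeat split; assumption.
    - transitivity ((Ci * Ci) * (s * ccosh u))%C; [|ring].
      replace (Ci * Ci)%C with (- RtoC 1)%C by Cparts.
      ring. }
  assert (Hsb2 : sqrt bb < 1.5).
  { assert (sqrt bb * sqrt bb = bb) by (apply sqrt_sqrt; lra). nra. }
  rewrite E. rewrite !Cmod_mult, !Cmod_R, !Rabs_pos_eq by lra.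
  set (S := Cmod s * Cmod s) in *.
  assert (HS : 0 <= S) by (unfold S; pose proof (Cmod_ge_0 s); nra).
  assert (Im' : Cmod (/ mm) <= 1) by (apply Cmod_inv_le1; rewrite Cmod_R, Rabs_pos_eq; lra).
  assert (D2 : Cmod (p * q - / sqrt bb * / mm) <= 2 * S).
  { eapply Rle_trans; [apply Cmod_prod_diff|].
    assert (Cmod p * Cmod (q - / mm) <= 1 * S)
      by (apply Rmult_le_compat; try apply Cmod_ge_0; assumption).
    assert (Cmod (p - / sqrt bb) * Cmod (/ mm) <= S * 1)
      by (apply Rmult_le_compat; try apply Cmod_ge_0; assumption).
    lra. }
  pose proof (Cmod_ge_0 u) as Hu0. pose proof (Cmod_ge_0 s) as Hs0. pose proof (Cmod_ge_0 (ccosh u)) as Hc0.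
  pose proof (Cmod_ge_0 (p * q - / sqrt bb * / mm)) as Hd0.
  assert (HSu : S <= 4 * (Cmod u * Cmod u)) by (unfold S; nra).
  assert (F1 : Cmod s * Cmod (ccosh u) <= (2 * Cmod u) * 2) by (apply Rmult_le_compat; assumption).
  assert (F2 : 4 * sqrt bb * (Cmod s * Cmod (ccosh u)) <= 6 * ((2 * Cmod u) * 2)).
  { apply Rmult_le_compat; nra. }
  assert (F3 : 4 * sqrt bb * (Cmod s * Cmod (ccosh u)) * Cmod (p * q - / sqrt bb * / mm)
     <= 6 * ((2 * Cmod u) * 2) * (2 * (4 * (Cmod u * Cmod u)))).
  { apply Rmult_le_compat; try assumption; try lra.
    apply Rmult_le_pos; [lra|apply Rmult_le_pos; assumption]. }
  lra.
Qed.

(** The factor cosh z = i s in the denominator gives a simple pole in s. The quotient cosh u Q / (X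
    + m) departs from its corner value only to order s^2, which leaves a remainder of order s. *)
Lemma corner_LamU : s <> 0 ->
  Cmod (LamU (ipi2 + u) - NN * sqrt dd / (mm * s)) <= NN * 8 * Cmod s.
Proof.
  intros Ns.
  destruct corner_QQ as (Q0 & _ & _ & Q3). destruct corner_mm as (M0 & M1 & M2).
  destruct (csinh_small u Hu) as (_ & B & D). fold s in D.
  destruct corner_s2 as [S1 S2].
  constants.
  assert (Nm : RtoC mm <> 0) by (apply RtoC_neq0; lra).
  assert (Hsd : 1 < sqrt dd) by (rewrite <- sqrt_1; apply sqrt_lt_1; lra).
  assert (Hsd2 : sqrt dd < 1.5).
  { assert (sqrt dd * sqrt dd = dd) by (apply sqrt_sqrt; lra). nra. }
  set (q := (/ (XX (ipi2 + u) + mm))%C) in *. set (Q := QQ (ipi2 + u)) in *.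
  assert (E : (LamU (ipi2 + u) - NN * sqrt dd / (mm * s))%C =
     (NN * (ccosh u * (Q * q) - 1 * (sqrt dd * / mm)) * / s)%C).
  { unfold LamU. rewrite ccosh_shift, csinh_shift. fold s. unfold q, Q. field.
    repeat split; try assumption. apply Ci_nz. }
  set (S := Cmod s * Cmod s) in *.
  assert (HS : 0 <= S) by (rewrite <- S2; apply Cmod_ge_0).
  assert (HS4 : S <= 1 / 4) by (rewrite <- S2; exact S1).
  assert (Im' : Cmod (/ mm) <= 1) by (apply Cmod_inv_le1; rewrite Cmod_R, Rabs_pos_eq; lra).
  assert (HQ : Cmod Q <= 2).
  { pose proof (Cmod_tri_inv Q (sqrt dd)) as T. rewrite Cmod_R, Rabs_pos_eq in T by lra. lra. }
  assert (D1 : Cmod (Q * q - sqrt dd * / mm) <= 3 * S).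
  { eapply Rle_trans; [apply Cmod_prod_diff|].
    assert (Cmod Q * Cmod (q - / mm) <= 2 * S)
      by (apply Rmult_le_compat; try apply Cmod_ge_0; assumption).
    assert (Cmod (Q - sqrt dd) * Cmod (/ mm) <= S * 1)
      by (apply Rmult_le_compat; try apply Cmod_ge_0; assumption).
    lra. }
  assert (D2 : Cmod (ccosh u * (Q * q) - 1 * (sqrt dd * / mm)) <= 8 * S).
  { eapply Rle_trans; [apply Cmod_prod_diff|].
    assert (Cmod (ccosh u) * Cmod (Q * q - sqrt dd * / mm) <= 2 * (3 * S))
      by (apply Rmult_le_compat; try apply Cmod_ge_0; assumption).
    assert (Cmod (ccosh u - 1) * Cmod (sqrt dd * / mm) <= S * 2).
    { apply Rmult_le_compat; try apply Cmod_ge_0; try assumption.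
      rewrite Cmod_mult, Cmod_R, Rabs_pos_eq by lra. pose proof (Cmod_ge_0 (/ mm)). nra. }
    lra. }
  assert (Hs0 : 0 < Cmod s) by (apply Cmod_gt_0; exact Ns).
  rewrite E. rewrite !Cmod_mult, Cmod_R, Rabs_pos_eq by lra.
  rewrite Cmod_inv by exact Ns. apply Rle_div_l; [exact Hs0|].
  apply Rle_trans with (NN * (8 * S)); [apply Rmult_le_compat_l; lra|]. unfold S. right. ring.
Qed.

End Corner.

Lemma segment_small (u : C) (v : R) : Cmod u <= 1 / 4 -> 0 <= v <= 1 ->
  Cmod (0 + v * (u - 0)) <= Cmod u.
Proof.
  intros Hu Hv. replace (0 + v * (u - 0))%C with (v * u)%C by ring.
  rewrite Cmod_mult, Cmod_R, Rabs_pos_eq by lra. pose proof (Cmod_ge_0 u). nra.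
Qed.

Lemma corner_TT (u : C) : Cmod u <= 1 / 4 ->
  Cmod (TT (ipi2 + u) - (0, AT) + kap * (csinh u * csinh u * csinh u))
   <= 1536 * (Cmod (csinh u) * Cmod (csinh u) * Cmod (csinh u) * Cmod (csinh u) * Cmod (csinh u)).
Proof.
  intros Hu.
  set (F := fun v => (TT (ipi2 + v) + kap * (csinh v * csinh v * csinh v))%C).
  assert (H : Cmod (F u - F 0) <= 48 * (Cmod u * Cmod u * Cmod u * Cmod u) * Cmod (u - 0)).
  { apply (Cmvt_le F (fun v => GG (ipi2 + v) + 3 * kap * (csinh v * csinh v) * ccosh v)%C).
    - intros v Hv. pose proof (segment_small u v Hu Hv). set (w := (0 + v * (u - 0))%C) in *.
      eapply Cder_val.
      + apply Cder_plus.
        * apply (Cder_comp TT (fun v => ipi2 + v)%C); [apply TT_Cder, corner_dom; lra|].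
          apply Cder_plus; [apply Cder_const|apply Cder_id].
        * apply Cder_scal. apply Cder_mult; [apply Cder_mult|]; apply csinh_Cder.
      + simpl. ring.
    - intros v Hv. pose proof (segment_small u v Hu ltac:(lra)) as Hw. set (w := (0 + v * (u - 0))%C) in *.
      eapply Rle_trans; [apply corner_TT'; lra|]. pose proof (Cmod_ge_0 w). pose proof (Cmod_ge_0 u).
      apply Rmult_le_compat_l; [lra|].
      repeat (apply Rmult_le_compat; repeat apply Rmult_le_pos; try assumption). }
  assert (F0 : F 0 = (0, AT)).
  { unfold F. rewrite csinh_0. rewrite Cplus_0_r, TT_ipi2. ring. }
  rewrite F0 in H. unfold F in H.
  replace (u - 0)%C with u in H by ring.
  replace (TT (ipi2 + u) - (0, AT) + kap * (csinh u * csinh u * csinh u))%C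
    with (TT (ipi2 + u) + kap * (csinh u * csinh u * csinh u) - (0, AT))%C by ring.
  eapply Rle_trans; [exact H|].
  pose proof (csinh_lower u Hu) as L. pose proof (Cmod_ge_0 u) as H0.
  set (a := Cmod u) in *. set (b := Cmod (csinh u)) in *.
  assert (a * a * a * a * a <= (2 * b) * (2 * b) * (2 * b) * (2 * b) * (2 * b)).
  { repeat (apply Rmult_le_compat; repeat apply Rmult_le_pos; try assumption). }
  nra.
Qed.

Lemma corner_lamU (l0 : R) (u : C) : Cmod u <= 1 / 4 ->
  Cmod (lamU l0 (ipi2 + u) - lamU l0 ipi2 - 2 / mm * (csinh u * csinh u))
   <= 3072 * (Cmod (csinh u) * Cmod (csinh u) * Cmod (csinh u) * Cmod (csinh u)).
Proof.
  intros Hu.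
  set (F := fun v => (lamU l0 (ipi2 + v) - 2 / mm * (csinh v * csinh v))%C).
  assert (H : Cmod (F u - F 0) <= 192 * (Cmod u * Cmod u * Cmod u) * Cmod (u - 0)).
  { apply (Cmvt_le F (fun v => dlam (ipi2 + v) - 2 / mm * (2 * csinh v * ccosh v))%C).
    - intros v Hv. pose proof (segment_small u v Hu Hv). set (w := (0 + v * (u - 0))%C) in *.
      eapply Cder_val.
      + apply Cder_minus.
        * apply (Cder_comp (lamU l0) (fun v => ipi2 + v)%C); [apply lamU_Cder, corner_dom; lra|].
          apply Cder_plus; [apply Cder_const|apply Cder_id].
        * apply Cder_scal. apply Cder_mult; apply csinh_Cder.
      + simpl. ring.
    - intros v Hv. pose proof (segment_small u v Hu ltac:(lra)) as Hw. set (w := (0 + v * (u - 0))%C) in *.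
      eapply Rle_trans; [apply corner_dlam; lra|]. pose proof (Cmod_ge_0 w). pose proof (Cmod_ge_0 u).
      apply Rmult_le_compat_l; [lra|].
      repeat (apply Rmult_le_compat; repeat apply Rmult_le_pos; try assumption). }
  assert (F0 : F 0 = lamU l0 ipi2).
  { unfold F. rewrite csinh_0. rewrite Cplus_0_r. ring. }
  rewrite F0 in H. unfold F in H.
  replace (u - 0)%C with u in H by ring.
  replace (lamU l0 (ipi2 + u) - lamU l0 ipi2 - 2 / mm * (csinh u * csinh u))%C
    with (lamU l0 (ipi2 + u) - 2 / mm * (csinh u * csinh u) - lamU l0 ipi2)%C by ring.
  eapply Rle_trans; [exact H|].
  pose proof (csinh_lower u Hu) as L. pose proof (Cmod_ge_0 u) as H0.
  set (a := Cmod u) in *. set (b := Cmod (csinh u)) in *.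
  assert (a * a * a * a <= (2 * b) * (2 * b) * (2 * b) * (2 * b)).
  { repeat (apply Rmult_le_compat; repeat apply Rmult_le_pos; try assumption). }
  nra.
Qed.

(** * Image of a neighbourhood of i PI / 2 *)

Lemma kap_pos : 0 < kap.
Proof.
  constants. unfold kap.
  apply Rdiv_lt_0_compat; [lra|]. apply Rmult_lt_0_compat; [lra|].
  apply Rmult_lt_0_compat; apply sqrt_lt_R0; lra.
Qed.

(** For |u| <= [rad] the remainder 1536 |s|^5 of [corner_TT] is at most half of the leading term kap
    |s|^3. *)
Definition rad : R := Rmin (1 / 4) (kap / 12288).

Lemma rad_pos : 0 < rad.
Proof. pose proof kap_pos. apply Rmin_glb_lt; lra. Qed.

Lemma rad_le : rad <= 1 / 4.
Proof. apply Rmin_l. Qed.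

Lemma corner_two_sided (u : C) : Cmod u <= rad ->
  kap / 2 * Cmod (csinh u) ^ 3 <= Cmod (TT (ipi2 + u) - (0, AT)) <= 2 * kap * Cmod (csinh u) ^ 3.
Proof.
  intros Hu. pose proof rad_le. pose proof kap_pos as Hk.
  assert (Hu1 : Cmod u <= 1 / 4) by lra.
  assert (Hu2 : Cmod u <= kap / 12288) by (eapply Rle_trans; [exact Hu|apply Rmin_r]).
  pose proof (corner_TT u Hu1) as E. destruct (csinh_small u Hu1) as (A & _ & _).
  set (w := (TT (ipi2 + u) - (0, AT))%C) in *.
  assert (Hk3 : Cmod (kap * (csinh u * csinh u * csinh u))%C = kap * Cmod (csinh u) ^ 3).
  { rewrite !Cmod_mult, Cmod_R, Rabs_pos_eq by lra. ring. }
  set (k := (kap * (csinh u * csinh u * csinh u))%C) in *.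
  set (s := Cmod (csinh u)) in *. assert (Hs : 0 <= s) by apply Cmod_ge_0.
  assert (Hs3 : 0 <= s ^ 3) by (apply pow_le; exact Hs).
  assert (E2 : 1536 * (s * s * s * s * s) <= kap / 2 * s ^ 3).
  { replace (1536 * (s * s * s * s * s)) with ((1536 * (s * s)) * s ^ 3) by ring.
    apply Rmult_le_compat_r; [exact Hs3|]. assert (s <= 1 / 2) by lra. nra. }
  pose proof (Cmod_triangle (w + k) (- w)) as T1. replace (w + k + - w)%C with k in T1 by ring.
  rewrite Cmod_opp in T1.
  pose proof (Cmod_triangle (w + k) (- k)) as T2. replace (w + k + - k)%C with w in T2 by ring.
  rewrite Cmod_opp in T2. assert (0 <= kap * s ^ 3) by nra. lra.
Qed.

Lemma shift_pair (x y : R) : ((x, y) : C) = (ipi2 + (x, (y - PI / 2)%R))%C.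
Proof. unfold ipi2. Cparts. Qed.

(** The second entry bounds |T - i [AT]| from below on the ring rad / 2 <= |u| <= rad, where |s| >=
    rad / 4. The first keeps the disc around i [AT] in the upper half-plane. *)
Definition nu0 : R := Rmin (AT / 2) (kap / 2 * (rad / 4) ^ 3).

Lemma nu0_pos : 0 < nu0.
Proof.
  pose proof kap_pos. pose proof AT_pos. pose proof rad_pos.
  apply Rmin_glb_lt; [lra|]. apply Rmult_lt_0_compat; [lra|]. apply pow_lt. lra.
Qed.

Lemma corner_far (u : C) : rad / 2 <= Cmod u <= rad -> nu0 <= Cmod (TT (ipi2 + u) - (0, AT)).
Proof.
  intros [H1 H2]. destruct (corner_two_sided u H2) as [H3 _].
  pose proof (csinh_lower u ltac:(pose proof rad_le; lra)) as L. pose proof kap_pos. pose proof rad_pos.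
  eapply Rle_trans; [|exact H3]. eapply Rle_trans; [apply Rmin_r|].
  apply Rmult_le_compat_l; [lra|]. apply pow_incr. lra.
Qed.

(** The target is the right half-disc. The left edge has Re T = 0, the top edge Re T <= 0, and on
    the other two edges |u| >= rad / 2, so T is at distance at least [nu0] from i [AT]. *)
Lemma corner_onto_right (w : C) : Cmod w < nu0 -> 0 < Re w ->
  exists u, Cmod u <= rad /\ Om (ipi2 + u) /\ TT (ipi2 + u) = ((0, AT) + w)%C.
Proof.
  intros Hw1 Hw2. pose proof PI2_3_2 as HPI. pose proof rad_pos as Hr. pose proof rad_le as Hr'.
  pose proof nu0_pos as Hn.
  set (P := fun t : C => 0 < Re t /\ Cmod (t - (0, AT)) < nu0).
  set (r := rad / 2) in *.
  assert (Hrect : forall z, rect 0 r (PI / 2 - r) (PI / 2) z ->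
            exists u, z = (ipi2 + u)%C /\ Cmod u <= rad /\ Re u = Re z /\ Im u = Im z - PI / 2).
  { intros [x y] [Hx Hy]. unfold Re, Im in Hx, Hy. simpl in Hx, Hy.
    exists (x, (y - PI / 2)%R). split; [apply shift_pair|]. split; [|split; reflexivity].
    eapply Rle_trans; [apply Cmod_le_abs|]. unfold Re, Im. simpl.
    rewrite Rabs_pos_eq, Rabs_left1 by lra. unfold r in *. lra. }
  destruct (rect_onto TT GG 0 r (PI / 2 - r) (PI / 2) P) with (t := ((0, AT) + w)%C) as (z & Hz & E).
  - intros z [Hz1 Hz2]. apply TT_cont. right. unfold r in *. lra.
  - intros z Hz1 Hz2. assert (strip z) by (unfold strip; unfold r in *; lra).
    split; [|split]; [apply TT_Cder|apply GG_cont|apply GG_neq0]; auto using strip_dom.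
  - intros z Hz [HP1 HP2]. destruct (Hrect z Hz) as (u & Eu & Hu & Eu1 & Eu2).
    assert (Hfar : ~ r <= Cmod u).
    { intros Hf. pose proof (corner_far u ltac:(unfold r in *; lra)) as L. rewrite <- Eu in L. lra. }
    pose proof (re_le_Cmod u) as R1. pose proof (im_le_Cmod u) as R2.
    pose proof (Rle_abs (Re u)). pose proof (Rle_abs (- Im u)). rewrite Rabs_Ropp in H0.
    destruct z as [x y]. destruct Hz as [Hx Hy].
    change (Re (x, y)) with x in *. change (Im (x, y)) with y in *.
    split; split; [| |lra|].
    + destruct Hx as [[Hx| <-] _]; [exact Hx|]. rewrite TT_re0 in HP1. lra.
    + lra.
    + destruct Hy as [_ [Hy| ->]]; [exact Hy|].
      pose proof (TT_top_Re x ltac:(unfold r in *; lra)). lra.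
  - intros a b v [Ha1 Ha2] [Hb1 Hb2] Hv. split.
    + change (Re (a + v * (b - a))%C) with (Re a + Re (v * (b - a))%C). rewrite Re_scal, Re_minus.
      destruct (Req_dec v 0) as [->|]; [lra|]. assert (0 < v) by lra. nra.
    + replace (a + v * (b - a) - (0, AT))%C with ((1 - v)%R * (a - (0, AT)) + v * (b - (0, AT)))%C
        by (rewrite RtoC_minus; ring).
      eapply Rle_lt_trans; [apply Cmod_triangle|]. rewrite !Cmod_mult, !Cmod_R, !Rabs_pos_eq by lra.
      destruct (Req_dec v 0) as [->|]; [lra|]. assert (0 < v) by lra. nra.
  (* A starting point in the half-disc: go down from the corner along the axis to (0, y), then
     slightly to the right. Openness of [Om] makes Re T positive there. *)
  - destruct (proj1 (Ccont_eps _ _) (TT_cont _ (dom_axis (PI / 2))) (nu0 / 2)) as (d1 & Hd1 & H1); [lra|].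
    set (y := PI / 2 - Rmin (d1 / 2) (r / 2)).
    assert (Hm : 0 < Rmin (d1 / 2) (r / 2)) by (apply Rmin_glb_lt; unfold r; lra).
    pose proof (Rmin_l (d1 / 2) (r / 2)) as Hm1. pose proof (Rmin_r (d1 / 2) (r / 2)) as Hm2.
    specialize (H1 (0, y)). change (TT (0, PI / 2)) with (TT ipi2) in H1. rewrite TT_ipi2 in H1.
    assert (Hy : Cmod ((0, y) - (0, PI / 2)) < d1).
    { eapply Rle_lt_trans; [apply Cmod_le_abs|]. rewrite Re_minus, Im_minus. unfold Re, Im. simpl.
      rewrite Rminus_0_r, Rabs_R0, Rabs_left1; unfold y; lra. }
    specialize (H1 Hy).
    destruct (Om_open (0, y) (Om_axis y ltac:(unfold y, r in *; lra))) as (d2 & Hd2 & H2).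
    destruct (proj1 (Ccont_eps _ _) (TT_cont _ (dom_axis y)) (nu0 / 2)) as (d3 & Hd3 & H3); [lra|].
    set (x := Rmin (r / 2) (Rmin (d2 / 2) (d3 / 2))).
    assert (Hx : 0 < x) by (repeat apply Rmin_glb_lt; unfold r; lra).
    assert (Hx1 : x <= r / 2) by apply Rmin_l.
    assert (Hx2 : x <= d2 / 2) by (eapply Rle_trans; [apply Rmin_r|apply Rmin_l]).
    assert (Hx3 : x <= d3 / 2) by (eapply Rle_trans; [apply Rmin_r|apply Rmin_r]).
    assert (Hxy : Cmod ((x, y) - (0, y)) <= x).
    { eapply Rle_trans; [apply Cmod_le_abs|]. rewrite Re_minus, Im_minus. unfold Re, Im. simpl.
      rewrite Rminus_diag, Rabs_R0, Rabs_pos_eq; lra. }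
    exists (x, y). split.
    + unfold rect. change (Re (x, y)) with x. change (Im (x, y)) with y. unfold y. lra.
    + split.
      * apply (H2 (x, y)); [lra|]. exact Hx.
      * specialize (H3 (x, y) ltac:(lra)).
        replace (TT (x, y) - (0, AT))%C with ((TT (x, y) - TT (0, y)) + (TT (0, y) - (0, AT)))%C by ring.
        eapply Rle_lt_trans; [apply Cmod_triangle|]. lra.
  - split.
    + change (0 < 0 + Re w). lra.
    + replace ((0, AT) + w - (0, AT))%C with w by ring. exact Hw1.
  - destruct (Hrect z) as (u & Eu & Hu & _); [unfold rect; lra|].
    exists u. rewrite <- Eu. split; [exact Hu|]. split; [|exact E].
    assert (0 < Re (TT z)) by (rewrite E; change (0 < 0 + Re w); lra).
    split; [unfold strip, r in *; lra|]. split; intros; lra.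
Qed.

Lemma TT_mirror (z : C) : dom z -> TT (- Cconj z) = (- Cconj (TT z))%C.
Proof. intros H. rewrite TT_opp by (apply dom_conj, H). rewrite TT_conj by exact H. reflexivity. Qed.

Lemma mirror_ipi2 (u : C) : (- Cconj (ipi2 + u) = ipi2 + - Cconj u)%C.
Proof. Cparts. Qed.

Lemma corner_onto (w : C) : Cmod w < nu0 -> (Re w = 0 -> Im w < 0) ->
  exists u, Cmod u <= rad /\ Om (ipi2 + u) /\ TT (ipi2 + u) = ((0, AT) + w)%C.
Proof.
  intros Hw1 Hw2. destruct (Rtotal_order (Re w) 0) as [H|[H|H]].
  - destruct (corner_onto_right (- Cconj w)%C) as (u & Hu & HOm & E).
    + rewrite Cmod_opp, Cmod_conj. exact Hw1.
    + change (Re (- Cconj w)%C) with (- Re w). lra.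
    + exists (- Cconj u)%C. rewrite <- mirror_ipi2, Cmod_opp, Cmod_conj.
      split; [exact Hu|]. split; [apply Om_opp, Om_conj, HOm|].
      rewrite TT_mirror by (left; apply HOm). rewrite E.
      Cparts.
  - specialize (Hw2 H). pose proof PI2_3_2 as HPI. pose proof rad_pos as Hr. pose proof rad_le as Hr'.
    assert (Hwm : - nu0 < Im w).
    { pose proof (im_le_Cmod w) as I. apply Rabs_le_between in I. lra. }
    (* At this height |u| = rad / 2, so T is at least [nu0] below i [AT] and the intermediate value
       theorem reaches every value in between. *)
    set (y0 := PI / 2 - rad / 2).
    assert (Hy0 : Im (TT (0, y0)) <= AT - nu0).
    { pose proof (corner_far (0, (y0 - PI / 2)%R)) as F.
      assert (Ec : Cmod (0, (y0 - PI / 2)%R) = rad / 2).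
      { replace ((0, (y0 - PI / 2)%R) : C) with (Ci * RtoC (y0 - PI / 2))%C
          by Cparts.
        rewrite Cmod_mult, Cmod_Ci, Cmod_R, Rabs_left1 by (unfold y0; lra). unfold y0. ring. }
      rewrite Ec, <- shift_pair in F. specialize (F ltac:(lra)).
      assert (Hlt : Im (TT (0, y0)) < AT) by (apply TT_axis_incr; unfold y0; lra).
      replace (TT (0, y0) - (0, AT))%C with (Ci * RtoC (Im (TT (0, y0)) - AT))%C in F.
      2:{ pose proof (TT_re0 y0) as R0. apply Ceq; rewrite ?Re_minus, ?Im_minus, ?R0;
        unfold Re, Im, Ci; simpl; ring. }
      rewrite Cmod_mult, Cmod_Ci, Cmod_R, Rabs_left1 in F by lra. lra. }
    destruct (axis_onto y0 (PI / 2) (AT + Im w)) as (y & Hy & E).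
    + unfold y0; lra.
    + change (Im (TT (0, PI / 2))) with AT. lra.
    + exists (0, (y - PI / 2)%R). rewrite <- shift_pair. split; [|split].
      * eapply Rle_trans; [apply Cmod_le_abs|]. unfold Re, Im. simpl.
        rewrite Rabs_R0, Rabs_left1; unfold y0 in *; lra.
      * apply Om_axis. unfold y0 in *; lra.
      * rewrite E. apply Ceq; [change (0 = 0 + Re w); lra|reflexivity].
  - apply corner_onto_right; assumption.
Qed.

(** * The real separatrix *)

Lemma derive_zero_const (f : R -> R) (a b : R) : (forall x, is_derive f x 0) -> f a = f b.
Proof.
  intros H.
  destruct (MVT_gen f a b (fun _ => 0)) as (c & _ & E).
  - intros; apply H.
  - intros x _. eapply is_derive_continuity_pt; apply H.
  - lra.
Qed.

Lemma is_derive_cosh (x : R) : is_derive cosh x (sinh x).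
Proof. apply is_derive_Reals, derivable_pt_lim_cosh. Qed.

Lemma is_derive_sinh (x : R) : is_derive sinh x (cosh x).
Proof. apply is_derive_Reals, derivable_pt_lim_sinh. Qed.

Lemma is_derive_acos (x : R) : -1 < x < 1 -> is_derive acos x (- / sqrt (1 - x * x)).
Proof.
  intros H. apply is_derive_Reals.
  pose proof (derive_pt_acos x H) as E. unfold derive_pt in E.
  destruct (derivable_pt_acos x H) as [l Hl]. simpl in E. unfold derivable_pt_abs in Hl.
  rewrite E in Hl. replace (- / sqrt (1 - x * x)) with (-1 / sqrt (1 - x²)); [exact Hl|].
  unfold Rsqr, Rdiv. ring.
Qed.

(* [cc X = cos (lambda / 2)] as a function of [X = cosh(z)^2] *)
Definition cc (X : R) : R := X / (X + mm).

Lemma cc_bounds (X : R) : 0 <= X -> 0 <= cc X < 1.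
Proof.
  intros H. pose proof mm_bounds. unfold cc. split.
  - apply Rle_div_r; lra.
  - apply Rlt_div_l; lra.
Qed.

Lemma cc_increasing (X Y : R) : 0 <= X -> X < Y -> cc X < cc Y.
Proof.
  intros HX HXY. pose proof mm_bounds.
  assert (E : cc Y - cc X = mm * (Y - X) / ((X + mm) * (Y + mm))) by (unfold cc; field; lra).
  assert (0 < cc Y - cc X); [|lra].
  rewrite E. apply Rdiv_lt_0_compat; apply Rmult_lt_0_compat; lra.
Qed.

Lemma sqrt_1_cc (X : R) : 0 <= X ->
  sqrt (1 - cc X * cc X) = sqrt (2 * mm) * sqrt (X + bb) / (X + mm).
Proof.
  intros H. constants.
  assert (0 < sqrt (2 * mm)) by (apply sqrt_lt_R0; lra).
  assert (0 < sqrt (X + bb)) by (apply sqrt_lt_R0; lra).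
  apply sqrt_lem_1.
  - pose proof (cc_bounds X H). nra.
  - apply Rle_div_r; [lra|]. rewrite Rmult_0_l. nra.
  - unfold Rdiv.
    transitivity ((sqrt (2 * mm) * sqrt (2 * mm)) * (sqrt (X + bb) * sqrt (X + bb)) / ((X + mm) * (X + mm))).
    + field. lra.
    + rewrite !sqrt_sqrt by lra. unfold cc, bb. field. lra.
Qed.

(** The function h is left open because it is cosh^2 on the real axis and cos^2 on the imaginary
    axis. *)
Lemma ll_der (h : R -> R) (v h' : R) : is_derive h v h' -> 0 <= h v ->
  is_derive (fun x => 2 * acos (cc (h x))) v
    (- (sqrt (2 * mm) * h' / ((h v + mm) * sqrt (h v + bb)))).
Proof.
  intros Hh H0. constants. pose proof (cc_bounds _ H0) as Hc.
  assert (Hs : 0 < sqrt (h v + bb)) by (apply sqrt_lt_R0; lra).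
  assert (H2 : 0 < sqrt (2 * mm)) by (apply sqrt_lt_R0; lra).
  assert (H3 : sqrt (2 * mm) * sqrt (2 * mm) = 2 * mm) by (apply sqrt_sqrt; lra).
  eapply is_derive_val.
  - apply is_derive_scal. apply (is_derive_comp acos (fun x => cc (h x))).
    + apply is_derive_acos. lra.
    + unfold cc. apply is_derive_div; [exact Hh| |lra].
      apply (is_derive_plus h (fun _ => mm)); [exact Hh|apply is_derive_const].
  - rewrite sqrt_1_cc by exact H0.
    unfold scal, plus, zero; simpl; unfold mult; simpl.
    set (q := sqrt (2 * mm)) in *. set (r := sqrt (h v + bb)) in *.
    transitivity (- (q * q) * h' / (q * ((h v + mm) * r))).
    + rewrite H3. field. repeat split; lra.
    + field. repeat split; lra.
Qed.

(** The turning point of the separatrix, where X = 1; [separatrix_turning_point] identifies it with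
    the given initial value. *)
Definition lstar : R := 2 * acos a_plus.

Lemma cc_1 : cc 1 = a_plus.
Proof.
  unfold cc, a_plus, mm. pose proof sqrt2_sqr. pose proof sqrt2_bounds.
  apply Rmult_eq_reg_r with (1 + (1 + 2 * sqrt 2)); [|lra].
  unfold Rdiv at 1. rewrite Rmult_assoc, Rinv_l by lra. nra.
Qed.

Lemma mm_sqrt2 : sqrt (8 * mm) = 2 * sqrt (2 * mm).
Proof.
  pose proof mm_bounds. replace (8 * mm) with ((2 * 2) * (2 * mm)) by ring.
  rewrite sqrt_mult, sqrt_square by lra. reflexivity.
Qed.

Lemma PP_real (z : C) (r : R) : 0 <= r -> XX z = RtoC r -> PP z = RtoC (sqrt (r + bb)).
Proof.
  intros Hr E. pose proof bb_bounds. unfold PP. rewrite E, <- RtoC_plus. apply csqrt_R. lra.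
Qed.

Lemma QQ_real (z : C) (r : R) : 0 <= r -> XX z = RtoC r -> QQ z = RtoC (sqrt (r + dd)).
Proof.
  intros Hr E. pose proof dd_bounds. unfold QQ. rewrite E, <- RtoC_plus. apply csqrt_R. lra.
Qed.

Lemma dlam_real (z : C) (r : R) : 0 <= r -> XX z = RtoC r ->
  dlam z = (RtoC (- (2 * sqrt (2 * mm)) / ((r + mm) * sqrt (r + bb))) * (csinh z * ccosh z))%C.
Proof.
  intros Hr E. constants.
  assert (0 < sqrt (r + bb)) by (apply sqrt_lt_R0; lra).
  unfold dlam. rewrite (PP_real z r Hr E), E, mm_sqrt2.
  rewrite <- RtoC_plus, <- RtoC_mult, <- RtoC_inv, RtoC_div by nra. rewrite RtoC_opp.
  rewrite RtoC_inv by nra. unfold Cdiv. ring.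
Qed.

Lemma lamU_0 (l0 : R) : lamU l0 0 = l0.
Proof. unfold lamU. rewrite prim_0. ring. Qed.

(** Along a line through 0 on which X is real, both sides have the same real derivative and agree at
    0. The direction 1 yields the real separatrix; the direction i yields the value 2 arccos 0 = pi
    at the corner. *)
Lemma lamU_line (h : C) (X X' : R -> R) :
  (forall v : R, dom (0 + v * h)) ->
  (forall v : R, XX (0 + v * h) = RtoC (X v)) -> (forall v, 0 <= X v) -> X 0 = 1 ->
  (forall v, is_derive X v (X' v)) ->
  (forall v : R, (2 * (csinh (0 + v * h) * ccosh (0 + v * h)) * h)%C = RtoC (X' v)) ->
  forall v : R, lamU lstar (0 + v * h) = RtoC (2 * acos (cc (X v))).
Proof.
  intros Hd HX HX0 H1 HX' Hh v. constants.
  assert (Hder : forall w : R, (dlam (0 + w * h) * h)%C =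
     RtoC (- (sqrt (2 * mm) * X' w / ((X w + mm) * sqrt (X w + bb))))).
  { intros w. assert (0 < sqrt (X w + bb)) by (apply sqrt_lt_R0; specialize (HX0 w); lra).
    specialize (HX0 w).
    rewrite (dlam_real _ _ HX0 (HX w)).
    replace (- (sqrt (2 * mm) * X' w / ((X w + mm) * sqrt (X w + bb))))
      with ((- (2 * sqrt (2 * mm)) / ((X w + mm) * sqrt (X w + bb))) * / 2 * X' w)
      by (field; split; lra).
    rewrite !RtoC_mult, <- Hh, RtoC_inv by lra. field. }
  assert (E0 : lamU lstar (0 + 0%R * h) = RtoC (2 * acos (cc (X 0)))).
  { replace (0 + 0%R * h)%C with (RtoC 0) by ring. rewrite lamU_0, H1, cc_1. reflexivity. }
  apply Ceq.
  - pose proof (derive_zero_const (fun w => Re (1 * lamU lstar (0 + w * h))%C - 2 * acos (cc (X w))) v 0) as D.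
    cbv beta in D. rewrite !Re_1, E0 in D. change (Re (RtoC ?a)) with a in *.
    rewrite Rminus_diag in D. apply Rminus_diag_uniq. apply D. intros w.
    eapply is_derive_val.
    + apply @is_derive_minus; [apply (Cder_line (lamU lstar) 0 h 1), lamU_Cder, Hd|apply ll_der;
        [apply HX'|apply HX0]].
    + rewrite Re_1, Hder. change (Re (RtoC ?a)) with a. unfold minus, plus, opp; simpl. ring.
  - pose proof (derive_zero_const (fun w => Re (- Ci * lamU lstar (0 + w * h))%C) v 0) as D.
    cbv beta in D. rewrite !Re_mCi, E0 in D. apply D. intros w.
    eapply is_derive_val; [apply (Cder_line (lamU lstar) 0 h), lamU_Cder, Hd|].
    rewrite Re_mCi, Hder. reflexivity.
Qed.

Lemma csinh_R (x : R) : csinh x = RtoC (sinh x).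
Proof.
  unfold csinh. change (Re x) with x. change (Im x) with 0. rewrite cos_0, sin_0.
  Cparts.
Qed.

Lemma ccosh_R (x : R) : ccosh x = RtoC (cosh x).
Proof.
  unfold ccosh. change (Re x) with x. change (Im x) with 0. rewrite cos_0, sin_0.
  Cparts.
Qed.

Lemma lamU_R (x : R) : lamU lstar x = RtoC (2 * acos (cc (cosh x * cosh x))).
Proof.
  replace (RtoC x) with (0 + x * 1)%C at 1 by ring.
  assert (E : forall v : R, (0 + v * 1)%C = RtoC v) by (intros; ring).
  apply (lamU_line 1 (fun v => cosh v * cosh v) (fun v => 2 * (sinh v * cosh v))).
  - intros v. rewrite E. apply dom_R.
  - intros v. rewrite E. apply XX_R.
  - intros v. nra.
  - rewrite cosh_0. ring.
  - intros v. eapply is_derive_val; [apply (is_derive_mult cosh cosh); try apply is_derive_cosh;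
      exact Rmult_comm|].
    unfold plus, mult; simpl. ring.
  - intros v. rewrite E, csinh_R, ccosh_R, <- !RtoC_mult. f_equal. ring.
Qed.

Lemma lamU_axis (y : R) : lamU lstar (0, y) = RtoC (2 * acos (cc (cos y * cos y))).
Proof.
  assert (E : forall v : R, (0 + v * Ci)%C = (0, v)) by (intros; Cparts).
  rewrite <- E.
  apply (lamU_line Ci (fun v => cos v * cos v) (fun v => - (2 * (sin v * cos v)))).
  - intros v. rewrite E. apply dom_axis.
  - intros v. rewrite E. apply XX_im.
  - intros v. nra.
  - rewrite cos_0. ring.
  - intros v. auto_derive; [exact I|ring].
  - intros v. rewrite E. unfold csinh, ccosh. change (Re (0, v)) with 0. change (Im (0, v)) with v.
    rewrite sinh_0, cosh_0. Cparts.
Qed.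

Lemma lamU_ipi2 : lamU lstar ipi2 = RtoC PI.
Proof.
  unfold ipi2. rewrite lamU_axis, cos_PI2. unfold cc. rewrite Rmult_0_l.
  unfold Rdiv. rewrite Rmult_0_l, acos_0. f_equal. field.
Qed.

Definition LamR (x : R) : R :=
  NN * sinh x * sqrt (cosh x * cosh x + dd) / (cosh x * (cosh x * cosh x + mm)).

Lemma LamU_R (x : R) : LamU x = RtoC (LamR x).
Proof.
  pose proof mm_bounds. pose proof (cosh_gt_0 x).
  unfold LamU, LamR. rewrite (QQ_real x (cosh x * cosh x)) by (try apply XX_R; nra).
  rewrite XX_R, csinh_R, ccosh_R, <- RtoC_plus, <- !RtoC_mult, <- RtoC_inv by nra.
  rewrite <- RtoC_mult. reflexivity.
Qed.

Lemma NN_KK : 2 * sqrt (2 * mm) = 3 * NN * KK.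
Proof.
  constants.
  apply Rsqr_inj.
  - pose proof (sqrt_pos (2 * mm)). lra.
  - nra.
  - unfold Rsqr. transitivity (4 * (sqrt (2 * mm) * sqrt (2 * mm))); [ring|].
    rewrite sqrt_sqrt by lra. transitivity (9 * (NN * NN) * (KK * KK)); [|ring].
    rewrite NN_sqr, KK_sqr. field.
Qed.

(** The first pendulum equation in the coordinate x instead of t, hence the factor dt/dx = Gr
    (cosh^2 x); likewise for [Lam_ode]. *)
Lemma lam_ode (x : R) :
  is_derive (fun x => 2 * acos (cc (cosh x * cosh x))) x (-3 * LamR x * Gr (cosh x * cosh x)).
Proof.
  pose proof mm_bounds. pose proof (cosh_gt_0 x). constants.
  set (X := cosh x * cosh x). assert (HX : 0 < X) by (unfold X; nra).
  eapply is_derive_val.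
  - apply (ll_der (fun v => cosh v * cosh v)).
    + apply (is_derive_mult cosh cosh); try apply is_derive_cosh; exact Rmult_comm.
    + fold X. lra.
  - fold X. unfold LamR, Gr. fold X. unfold plus, mult; simpl.
    assert (0 < sqrt (X + bb)) by (apply sqrt_lt_R0; lra).
    assert (0 < sqrt (X + dd)) by (apply sqrt_lt_R0; lra).
    replace (sqrt (2 * mm)) with (3 * NN * KK / 2) by (rewrite <- NN_KK; field).
    transitivity (- (3 * NN * KK * sinh x * cosh x / ((X + mm) * sqrt (X + bb)))).
    + field. split; lra.
    + replace (KK * X) with (KK * (cosh x * cosh x)) by reflexivity.
      field. repeat split; lra.
Qed.

Lemma Fpend_acos (c : R) : 0 < c < 1 ->
  Fpend (2 * acos c) = - (2 * c * sqrt (1 - c * c)) * (1 - 1 / (8 * (c * c * c))).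
Proof.
  intros Hc. unfold Fpend.
  rewrite cos_2a_cos, sin_2a, cos_acos, sin_acos by lra.
  replace (2 + 2 * (2 * c * c - 1)) with ((2 * c) * (2 * c)) by ring.
  rewrite sqrt_square by lra. unfold Rsqr. simpl. f_equal; [ring|]. f_equal. f_equal. ring.
Qed.

Lemma Lam_ode (x : R) :
  is_derive LamR x (Fpend (2 * acos (cc (cosh x * cosh x))) * Gr (cosh x * cosh x)).
Proof.
  pose proof mm_bounds. pose proof (cosh_gt_0 x) as Hch. constants.
  set (X := cosh x * cosh x). assert (HX : 0 < X) by (unfold X; nra).
  assert (Hc : 0 < cc X < 1).
  { split; [|apply cc_bounds; lra]. unfold cc. apply Rdiv_lt_0_compat; lra. }
  assert (Hr : 0 < sqrt (X + dd)) by (apply sqrt_lt_R0; lra).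
  assert (Hq : 0 < sqrt (X + bb)) by (apply sqrt_lt_R0; lra).
  assert (Hr2 : sqrt (X + dd) * sqrt (X + dd) = X + dd) by (apply sqrt_sqrt; lra).
  assert (HX0 : 0 < cosh x * X) by (apply Rmult_lt_0_compat; assumption).
  eapply is_derive_val.
  - unfold LamR. auto_derive.
    + fold X. repeat split; try lra; try (eexists; apply is_derive_cosh); try (eexists;
        apply is_derive_sinh).
      apply Rgt_not_eq, Rmult_lt_0_compat; lra.
    + reflexivity.
  - fold X.
    replace (Derive (fun x : R => cosh x) x) with (sinh x) by (symmetry;
      apply is_derive_unique, is_derive_cosh).
    replace (Derive (fun x : R => sinh x) x) with (cosh x) by (symmetry;
      apply is_derive_unique, is_derive_sinh).
    rewrite (Fpend_acos _ Hc), sqrt_1_cc by lra. unfold Gr, cc.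
    replace (sqrt (2 * mm)) with (3 * NN * KK / 2) by (rewrite <- NN_KK; field).
    assert (Ec : cosh x * cosh x = X) by reflexivity.
    assert (Es : sinh x * sinh x = X - 1) by (pose proof (cosh2_sinh2 x); lra).
    pose proof KK_sqr as HK. constants.
    (* With cosh, sinh and the two roots as atoms, their squares X, X - 1, X + b and X + d reduce
       the claim to a polynomial identity in X and m modulo m^2 = 2 m + 7. *)
    clearbody X. clear Hc HX0.
    set (R0 := sqrt (X + dd)) in *. set (Q0 := sqrt (X + bb)) in *.
    set (c := cosh x) in *. set (s := sinh x) in *. clearbody R0 Q0 c s.
    transitivity (NN * (R0 / (X + mm) + (s * s) / (R0 * (X + mm))
       - (s * s) * R0 * (X + mm + 2 * (c * c)) / ((c * c) * ((X + mm) * (X + mm))))).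
    { field. repeat split; lra. }
    rewrite Es, Ec.
    transitivity (NN * ((R0 * R0) * (X * (X + mm) - (X - 1) * (3 * X + mm)) + (X - 1) * X * (X + mm))
       / (X * R0 * ((X + mm) * (X + mm)))).
    { field. repeat split; lra. }
    transitivity (- (3 * NN * (KK * KK) * (8 * (X * X * X) - (X + mm) * (X + mm) * (X + mm)) / 8)
       / (X * R0 * ((X + mm) * (X + mm)))).
    2:{ field. repeat split; lra. }
    rewrite HK, Hr2. f_equal.
    assert (Em : mm * mm * (X * X) = (2 * mm + 7) * (X * X)) by (rewrite mm_sqr; reflexivity).
    unfold dd. nra.
Qed.

(** * Uniqueness for the pendulum equation *)

Lemma zero_forward (E E' : R -> R) (M d : R) :
  (forall t, is_derive E t (E' t)) -> (forall t, 0 <= E t) -> 0 < d -> 0 <= M ->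
  (forall t, E t < d -> Rabs (E' t) <= M * E t) -> E 0 = 0 -> forall t, 0 <= t -> E t = 0.
Proof.
  intros HE Hpos Hd HM Hb H0 t1 Ht1.
  assert (Hcont : forall t e, 0 < e -> exists r, 0 < r /\ forall s,
    Rabs (s - t) < r -> Rabs (E s - E t) < e).
  { intros t e He. destruct (is_derive_continuity_pt E t _ (HE t) e He) as (r & Hr & H).
    exists r. split; [exact Hr|]. intros s Hs.
    destruct (Req_dec s t) as [->|Hst]; [rewrite Rminus_diag, Rabs_R0; exact He|].
    apply H. split; [split; [exact I|congruence]|exact Hs]. }
  (* Gronwall's argument: E e^(-M v) cannot increase while E < d. The bound on E' is only local, so
     it is applied just to the right of a zero of E. *)
  assert (HEexp : forall v, is_derive (fun v => E v * exp (- M * v)) v ((E' v - M * E v) * exp (- M * v))).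
  { intros v. assert (D : is_derive (fun v => exp (- M * v)) v (- M * exp (- M * v))) by (auto_derive;
      [exact I|ring]).
    eapply is_derive_val.
    - apply (is_derive_mult E (fun v => exp (- M * v))); [apply HE|exact D|exact Rmult_comm].
    - unfold plus, mult; simpl. ring. }
  apply (interval_induction (fun t => E t = 0) t1); [exact H0| | |lra].
  - intros l Hl Hlt. apply NNPP. intros Hn.
    assert (Hp : 0 < E l) by (specialize (Hpos l); lra).
    destruct (Hcont l (E l) Hp) as (r & Hr & H).
    set (s := Rmax 0 (l - r / 2)). assert (Hs : 0 <= s < l) by (unfold s, Rmax; destruct Rle_dec; lra).
    assert (Hs2 : l - r / 2 <= s) by apply Rmax_r.
    specialize (H s). rewrite (Hlt s Hs), Rminus_0_l, Rabs_Ropp, (Rabs_pos_eq (E l)) in H by lra.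
    specialize (H ltac:(rewrite Rabs_left1; lra)). lra.
  - intros l Hl Hle. assert (HEl : E l = 0) by (apply Hle; lra).
    destruct (Hcont l d Hd) as (r & Hr & H). exists r. split; [exact Hr|]. intros s Hs.
    destruct (MVT_gen (fun v => E v * exp (- M * v)) l s (fun v => (E' v - M * E v) * exp (- M * v)))
      as (c & Hc & EQ).
    + intros v _. apply HEexp.
    + intros v _. eapply is_derive_continuity_pt, HEexp.
    + rewrite Rmin_left, Rmax_right in Hc by lra. cbv beta in EQ. rewrite HEl, Rmult_0_l in EQ.
      assert (Hcd : E c < d).
      { specialize (H c ltac:(rewrite Rabs_pos_eq; lra)).
        rewrite HEl, Rminus_0_r, Rabs_pos_eq in H by apply Hpos. exact H. }
      specialize (Hb c Hcd). apply Rabs_le_between in Hb.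
      pose proof (exp_pos (- M * c)). pose proof (exp_pos (- M * s)). specialize (Hpos s).
      assert (E s * exp (- M * s) <= 0).
      { rewrite Rminus_0_r in EQ. rewrite EQ.
        assert ((E' c - M * E c) * exp (- M * c) <= 0) by nra. nra. }
      nra.
Qed.

Lemma zero_everywhere (E E' : R -> R) (M d : R) :
  (forall t, is_derive E t (E' t)) -> (forall t, 0 <= E t) -> 0 < d -> 0 <= M ->
  (forall t, E t < d -> Rabs (E' t) <= M * E t) -> E 0 = 0 -> forall t, E t = 0.
Proof.
  intros HE Hpos Hd HM Hb H0 t. destruct (Rle_or_lt 0 t) as [H|H].
  - apply (zero_forward E E' M d); assumption.
  - rewrite <- (Ropp_involutive t).
    apply (zero_forward (fun s => E (- s)) (fun s => - E' (- s)) M d); try assumption.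
    + intros s.
      assert (D : is_derive (fun s : R => - s) s (- (1))) by (auto_derive; [exact I|ring]).
      eapply is_derive_val.
      * apply (is_derive_comp E (fun s => - s)); [apply HE|exact D].
      * unfold scal, opp, one; simpl; unfold mult; simpl. ring.
    + intros s. apply Hpos.
    + intros s. rewrite Rabs_Ropp. apply Hb.
    + rewrite Ropp_0. exact H0.
    + lra.
Qed.

(** The force is singular where 2 + 2 cos x vanishes; on |x| <= l1 < pi that quantity is bounded
    below, and so its derivative is bounded. *)
Lemma Fpend_lipschitz (l1 : R) : 0 < l1 < PI ->
  exists L, 0 <= L /\ forall a b,
    Rabs a <= l1 -> Rabs b <= l1 -> Rabs (Fpend a - Fpend b) <= L * Rabs (a - b).
Proof.
  intros Hl.
  assert (Hcos : forall x, Rabs x <= l1 -> cos l1 <= cos x).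
  { intros x Hx. replace (cos x) with (cos (Rabs x)).
    - pose proof (Rabs_pos x). apply cos_decr_1; lra.
    - unfold Rabs. destruct Rcase_abs; [apply cos_neg|reflexivity]. }
  assert (H1 : -1 < cos l1).
  { rewrite <- cos_PI. apply cos_decreasing_1; lra. }
  set (s0 := sqrt (2 + 2 * cos l1)). assert (Hs0 : 0 < s0) by (apply sqrt_lt_R0; lra).
  assert (Hs : forall x, Rabs x <= l1 -> s0 <= sqrt (2 + 2 * cos x)).
  { intros x Hx. apply sqrt_le_1_alt. specialize (Hcos x Hx). lra. }
  set (dF := fun x => let s := sqrt (2 + 2 * cos x) in
     - cos x * (1 - 1 / s ^ 3) + 3 * (sin x * sin x) / s ^ 5).
  assert (HdF : forall x, Rabs x <= l1 -> is_derive Fpend x (dF x)).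
  { intros x Hx. specialize (Hs x Hx). specialize (Hcos x Hx). unfold Fpend, dF.
    assert (Hp : 0 < sqrt (2 + 2 * cos x)) by lra.
    auto_derive.
    - repeat split; try lra. apply Rgt_not_eq. repeat apply Rmult_lt_0_compat; lra.
    - set (s := sqrt (2 + 2 * cos x)) in *. simpl. field. lra. }
  set (L := 1 * (1 + / s0 ^ 3) + 3 * / s0 ^ 5).
  assert (P3 : 0 < s0 ^ 3) by (apply pow_lt; exact Hs0). assert (P5 : 0 < s0 ^ 5) by (apply pow_lt;
    exact Hs0).
  assert (I3 : 0 < / s0 ^ 3) by (apply Rinv_0_lt_compat, P3).
  assert (I5 : 0 < / s0 ^ 5) by (apply Rinv_0_lt_compat, P5).
  assert (HL : forall x, Rabs x <= l1 -> Rabs (dF x) <= L).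
  { intros x Hx. specialize (Hs x Hx). unfold dF, L. set (s := sqrt (2 + 2 * cos x)) in *.
    assert (J3 : 0 < / s ^ 3 <= / s0 ^ 3).
    { split; [apply Rinv_0_lt_compat, pow_lt; lra|]. apply Rinv_le_contravar;
        [exact P3|apply pow_incr; lra]. }
    assert (J5 : 0 < / s ^ 5 <= / s0 ^ 5).
    { split; [apply Rinv_0_lt_compat, pow_lt; lra|]. apply Rinv_le_contravar;
        [exact P5|apply pow_incr; lra]. }
    pose proof (COS_bound x) as Hc. pose proof (sin2_cos2' x).
    eapply Rle_trans; [apply Rabs_triang|]. apply Rplus_le_compat.
    - rewrite Rabs_mult. apply Rmult_le_compat; try apply Rabs_pos.
      + rewrite Rabs_Ropp. apply Rabs_le. lra.
      + apply Rabs_le. unfold Rdiv. lra.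
    - unfold Rdiv. rewrite Rabs_pos_eq by nra. nra. }
  exists L. split; [unfold L; lra|]. intros a b Ha Hb.
  destruct (MVT_gen Fpend b a dF) as (c & Hc & E).
  - intros x Hx. apply HdF. apply Rabs_le_between in Ha. apply Rabs_le_between in Hb. apply Rabs_le.
    unfold Rmin, Rmax in Hx. destruct Rle_dec; lra.
  - intros x Hx. eapply is_derive_continuity_pt. apply HdF. apply Rabs_le_between in Ha.
    apply Rabs_le_between in Hb. apply Rabs_le.
    unfold Rmin, Rmax in Hx. destruct Rle_dec; lra.
  - rewrite E, Rabs_mult. apply Rmult_le_compat_r; [apply Rabs_pos|]. apply HL.
    apply Rabs_le_between in Ha. apply Rabs_le_between in Hb. apply Rabs_le.
    unfold Rmin, Rmax in Hc. destruct Rle_dec; lra.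
Qed.

(** The squared distance E satisfies |E'| <= (3 + L) E as long as E < eta^2. Only the second
    solution is confined a priori; eta, half its distance to pi, keeps the first one away from the
    singularity while E is that small. *)
Lemma pend_unique (l0 : R) (l1 L1 l2 L2 : R -> R) :
  0 < l0 < PI -> (forall t, 0 <= l2 t <= l0) ->
  (forall t, is_derive l1 t (-3 * L1 t)) -> (forall t, is_derive L1 t (Fpend (l1 t))) ->
  (forall t, is_derive l2 t (-3 * L2 t)) -> (forall t, is_derive L2 t (Fpend (l2 t))) ->
  l1 0 = l2 0 -> L1 0 = L2 0 -> forall t, l1 t = l2 t /\ L1 t = L2 t.
Proof.
  intros Hl0 Hl2 H1 H1' H2 H2' E0 E0' t.
  set (eta := (PI - l0) / 2).
  destruct (Fpend_lipschitz (l0 + eta)) as (L & HL & Hlip); [unfold eta; lra|].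
  set (E := fun t => (l1 t - l2 t) * (l1 t - l2 t) + (L1 t - L2 t) * (L1 t - L2 t)).
  assert (HE : E t = 0).
  { apply (zero_everywhere E (fun t => 2 * (l1 t - l2 t) * (-3 * L1 t - -3 * L2 t)
       + 2 * (L1 t - L2 t) * (Fpend (l1 t) - Fpend (l2 t))) (3 + L) (eta * eta)).
    - intros s.
      assert (D1 : is_derive (fun t => l1 t - l2 t) s (-3 * L1 s - -3 * L2 s))
        by (apply @is_derive_minus; auto).
      assert (D2 : is_derive (fun t => L1 t - L2 t) s (Fpend (l1 s) - Fpend (l2 s)))
        by (apply @is_derive_minus; auto).
      eapply is_derive_val.
      + apply (is_derive_plus (fun t => (l1 t - l2 t) * (l1 t - l2 t)) (fun t => (L1 t - L2 t) * (L1 t - L2 t))).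
        * apply (is_derive_mult (fun t => l1 t - l2 t) (fun t => l1 t - l2 t));
            [exact D1|exact D1|exact Rmult_comm].
        * apply (is_derive_mult (fun t => L1 t - L2 t) (fun t => L1 t - L2 t));
            [exact D2|exact D2|exact Rmult_comm].
      + unfold plus, mult; simpl. ring.
    - intros s. apply Rplus_le_le_0_compat; apply Rle_0_sqr.
    - apply Rmult_lt_0_compat; unfold eta; lra.
    - lra.
    - intros s Hs. unfold E in *. set (x := l1 s - l2 s) in *. set (y := L1 s - L2 s) in *.
      assert (Hx : Rabs x < eta).
      { apply Rnot_le_lt. intros Hge. assert (0 < eta) by (unfold eta; lra).
        assert (eta * eta <= Rabs x * Rabs x) by nra.
        rewrite <- Rabs_mult, (Rabs_pos_eq (x * x)) in H0 by nra. nra. }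
      specialize (Hl2 s). apply Rabs_lt_between in Hx.
      assert (HF : Rabs (Fpend (l1 s) - Fpend (l2 s)) <= L * Rabs x).
      { apply Hlip; apply Rabs_le; unfold x in Hx; unfold eta in *; lra. }
      set (z := Fpend (l1 s) - Fpend (l2 s)) in *.
      replace (2 * x * (-3 * L1 s - -3 * L2 s) + 2 * y * z) with (-6 * (x * y) + 2 * (y * z))
        by (unfold x, y; ring).
      eapply Rle_trans; [apply Rabs_triang|]. rewrite !Rabs_mult.
      rewrite (Rabs_left1 (-6)), (Rabs_pos_eq 2) by lra.
      assert (Ex : Rabs x * Rabs x = x * x) by (rewrite <- Rabs_mult; apply Rabs_pos_eq; nra).
      assert (Ey : Rabs y * Rabs y = y * y) by (rewrite <- Rabs_mult; apply Rabs_pos_eq; nra).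
      rewrite <- Ex, <- Ey. pose proof (Rabs_pos x). pose proof (Rabs_pos y).
      set (p := Rabs x) in *. set (q := Rabs y) in *.
      assert (q * Rabs z <= q * (L * p)) by (apply Rmult_le_compat_l; assumption).
      assert (2 * (p * q) <= p * p + q * q) by (pose proof (Rle_0_sqr (p - q)) as S; unfold Rsqr in S; lra).
      assert (L * (2 * (p * q)) <= L * (p * p + q * q)) by (apply Rmult_le_compat_l; assumption).
      lra.
    - unfold E. rewrite E0, E0'. ring. }
  unfold E in HE. destruct (Rplus_sqr_eq_0 (l1 t - l2 t) (L1 t - L2 t) HE) as [Ex Ey]. lra.
Qed.

(** * The value A *)

Lemma a_plus_bounds : 0.2 < a_plus < 0.25.
Proof. unfold a_plus. pose proof sqrt2_bounds. lra. Qed.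

(** In c = cos (l0 / 2) the energy equation becomes (1 - c)(4 c^2 + 4 c - 1) = 0, and 0 < c < 1/2
    leaves the root a_+. *)
Lemma separatrix_turning_point (l0 : R) :
  2 / 3 * PI < l0 < PI -> Vpend l0 = - 1 / 2 -> l0 = lstar.
Proof.
  intros Hl E. pose proof PI_RGT_0.
  set (c := cos (l0 / 2)).
  assert (Hc0 : 0 < c) by (unfold c; apply cos_gt_0; lra).
  assert (Hc1 : c < 1 / 2) by (unfold c; rewrite <- cos_PI3; apply cos_decreasing_1; lra).
  assert (Ec : cos l0 = 2 * c * c - 1).
  { replace l0 with (2 * (l0 / 2)) by field. rewrite cos_2a_cos. reflexivity. }
  unfold Vpend in E. rewrite Ec in E.
  replace (2 + 2 * (2 * c * c - 1)) with ((2 * c) * (2 * c)) in E by ring.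
  rewrite sqrt_square in E by lra.
  assert (E2 : (1 - c) * (4 * c * c + 4 * c - 1) = 0).
  { apply (f_equal (fun x => x * (2 * c))) in E. field_simplify in E; [|lra]. lra. }
  assert (E3 : c = a_plus).
  { apply Rmult_integral in E2. destruct E2 as [E2|E2]; [lra|].
    unfold a_plus. assert (2 * c + 1 = sqrt 2); [|lra].
    symmetry. apply sqrt_lem_1; lra. }
  unfold lstar. rewrite <- E3. unfold c. rewrite acos_cos by lra. field.
Qed.

Lemma A_integrand_continuous (x : R) : 0 <= x < a_plus -> continuous A_integrand x.
Proof.
  intros Hx. pose proof a_plus_bounds.
  assert (Hm : a_minus < 0) by (unfold a_minus; pose proof sqrt2_bounds; lra).
  apply (continuous_mult (K := R_AbsRing) (fun x => 1 / (1 - x))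
    (fun x => sqrt (x / (3 * (x + 1) * (a_plus - x) * (x - a_minus))))).
  - apply (ex_derive_continuous (K := R_AbsRing) (V := R_NormedModule)). auto_derive. lra.
  - apply (continuous_comp (fun x => x / (3 * (x + 1) * (a_plus - x) * (x - a_minus))) sqrt).
    + apply (ex_derive_continuous (K := R_AbsRing) (V := R_NormedModule)). auto_derive.
      apply Rgt_not_eq.
      apply Rmult_lt_0_compat; [apply Rmult_lt_0_compat; lra|lra].
    + apply continuous_sqrt.
Qed.

(* This is the substitution [x = cc (cos y ^ 2)] in the integral defining A: its right-hand side is
   minus the derivative of [Im (TT (0, y))]. *)
Lemma A_integrand_subst (y : R) : 0 < y < PI / 2 ->
  (mm * (- (2 * (sin y * cos y))) / ((cos y * cos y + mm) * (cos y * cos y + mm))) *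
    A_integrand (cc (cos y * cos y)) = - Gr (cos y * cos y).
Proof.
  intros Hy. constants.
  pose proof PI_RGT_0.
  assert (Hc : 0 < cos y) by (apply cos_gt_0; lra). assert (Hs : 0 < sin y) by (apply sin_gt_0; lra).
  pose proof (sin2_cos2' y) as Hsc.
  set (c := cos y) in *. set (s := sin y) in *. clearbody c s.
  set (X := c * c). assert (HX : 0 < X) by (unfold X; nra).
  assert (Hr : 0 < sqrt (X + dd)) by (apply sqrt_lt_R0; lra).
  assert (Hq : 0 < sqrt (X + bb)) by (apply sqrt_lt_R0; lra).
  assert (Hr2 : sqrt (X + dd) * sqrt (X + dd) = X + dd) by (apply sqrt_sqrt; lra).
  assert (Hq2 : sqrt (X + bb) * sqrt (X + bb) = X + bb) by (apply sqrt_sqrt; lra).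
  assert (E1 : a_plus - cc X = (1 - a_plus) * (s * s) / (X + mm)).
  { unfold cc. apply Rmult_eq_reg_r with (X + mm); [|lra]. unfold Rdiv. rewrite Rmult_minus_distr_r.
    rewrite !Rmult_assoc, Rinv_l, !Rmult_1_r by lra.
    replace (s * s) with (1 - X) by (unfold X; lra).
    assert (a_plus * mm = 1 - a_plus); [|nra].
    unfold a_plus, mm. pose proof sqrt2_sqr. nra. }
  assert (E2 : cc X - a_minus = (1 - a_minus) * (X + dd) / (X + mm)).
  { unfold cc. apply Rmult_eq_reg_r with (X + mm); [|lra]. unfold Rdiv. rewrite Rmult_minus_distr_r.
    rewrite !Rmult_assoc, Rinv_l, !Rmult_1_r by lra.
    assert (- a_minus * mm = (1 - a_minus) * dd); [|nra].
    unfold a_minus, dd. rewrite mm_sqr. unfold mm. pose proof sqrt2_sqr. nra. }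
  assert (E3 : (1 - a_plus) * (1 - a_minus) = 7 / 4).
  { unfold a_plus, a_minus. pose proof sqrt2_sqr. nra. }
  assert (E4 : cc X + 1 = 2 * (X + bb) / (X + mm)) by (unfold cc, bb; field; lra).
  unfold A_integrand. rewrite E1, E2, E4.
  assert (E5 : sqrt (cc X / (3 * (2 * (X + bb) / (X + mm)) * ((1 - a_plus) * (s * s) / (X + mm)) *
     ((1 - a_minus) * (X + dd) / (X + mm)))) = KK / 2 * c * (X + mm) / (sqrt (X + bb) * sqrt (X + dd) * s)).
  { assert (Hin : cc X / (3 * (2 * (X + bb) / (X + mm)) * ((1 - a_plus) * (s * s) / (X + mm)) *
     ((1 - a_minus) * (X + dd) / (X + mm))) = 2 / 21 * X * ((X + mm) * (X + mm)) / ((X + bb) * (X + dd) * (s * s))).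
    { assert (N1 : 1 - a_plus <> 0) by (intros E; rewrite E in E3; lra).
      assert (N2 : 1 - a_minus <> 0) by (intros E; rewrite E in E3; lra).
      transitivity (X * ((X + mm) * (X + mm)) / (6 * ((1 - a_plus) * (1 - a_minus)) * ((X + bb) * (X + dd) * (s * s)))).
      - unfold cc. field. repeat split; lra.
      - rewrite E3. field. repeat split; lra. }
    rewrite Hin. apply sqrt_lem_1.
    - apply Rle_div_r; [|rewrite Rmult_0_l; apply Rmult_le_pos; nra].
      repeat apply Rmult_lt_0_compat; lra.
    - apply Rle_div_r; [|rewrite Rmult_0_l; apply Rmult_le_pos; nra].
      apply Rmult_lt_0_compat; [apply Rmult_lt_0_compat|]; assumption.
    - transitivity ((KK * KK) / 4 * (c * c) * ((X + mm) * (X + mm)) /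
        ((sqrt (X + bb) * sqrt (X + bb)) * (sqrt (X + dd) * sqrt (X + dd)) * (s * s))).
      + field. repeat split; lra.
      + rewrite Hr2, Hq2, KK_sqr. fold X. field. repeat split; lra. }
  rewrite E5. unfold Gr. replace (1 - cc X) with (mm / (X + mm)) by (unfold cc; field; lra).
  transitivity (- (KK * (c * c) / (sqrt (X + bb) * sqrt (X + dd)))); [|fold X; reflexivity].
  field. repeat split; lra.
Qed.

Lemma Gr_continuous (r : R) : 0 <= r -> continuous Gr r.
Proof.
  intros Hr. constants.
  apply (ex_derive_continuous (K := R_AbsRing) (V := R_NormedModule)). unfold Gr. auto_derive.
  repeat split; try lra. apply Rgt_not_eq, Rmult_lt_0_compat; apply sqrt_lt_R0; lra.
Qed.

Lemma cc_cos_der (y : R) : is_derive (fun y => cc (cos y * cos y)) y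
  (mm * (- (2 * (sin y * cos y))) / ((cos y * cos y + mm) * (cos y * cos y + mm))).
Proof.
  pose proof mm_bounds. assert (0 <= cos y * cos y) by nra.
  unfold cc. auto_derive; [lra|]. field. lra.
Qed.

Lemma cc_cos_lt (y : R) : 0 < y <= PI / 2 -> cc (cos y * cos y) < a_plus.
Proof.
  intros Hy. pose proof PI_RGT_0. assert (Hc : 0 <= cos y < 1).
  { split; [apply cos_ge_0; lra|]. rewrite <- cos_0. apply cos_decreasing_1; lra. }
  rewrite <- cc_1. apply cc_increasing; nra.
Qed.

(** The substitution runs backwards, from x = 0 at y = pi/2 towards x = a_+ at y = 0. It stops at y1
    > 0 because the integrand is singular at a_+. *)
Lemma A_integral (y1 : R) : 0 < y1 < PI / 2 ->
  is_RInt A_integrand 0 (cc (cos y1 * cos y1)) (AT - Im (TT (0, y1))).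
Proof.
  intros Hy. pose proof PI_RGT_0. pose proof mm_bounds.
  set (g := fun y => cc (cos y * cos y)).
  set (dg := fun y => mm * (- (2 * (sin y * cos y))) / ((cos y * cos y + mm) * (cos y * cos y + mm))).
  assert (Hg : forall y, y1 <= y <= PI / 2 -> 0 <= g y < a_plus).
  { intros y Hyy. split; [apply cc_bounds; nra|apply cc_cos_lt; lra]. }
  assert (Hgc : forall y, y1 <= y <= PI / 2 -> continuous A_integrand (g y)).
  { intros y Hyy. apply A_integrand_continuous, Hg, Hyy. }
  assert (I1 : is_RInt (fun y => scal (dg y) (A_integrand (g y))) y1 (PI / 2) (RInt A_integrand (g y1) (g (PI / 2)))).
  { apply (is_RInt_comp (V := R_CompleteNormedModule)).
    - rewrite Rmin_left, Rmax_right by lra. exact Hgc.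
    - intros y _. split; [apply cc_cos_der|].
      apply (ex_derive_continuous (K := R_AbsRing) (V := R_NormedModule)). unfold dg. auto_derive.
      apply Rgt_not_eq. assert (0 <= cos y * cos y) by nra. apply Rmult_lt_0_compat; lra. }
  assert (I2 : is_RInt (fun y => scal (dg y) (A_integrand (g y))) y1 (PI / 2) (- (AT - Im (TT (0, y1))))).
  { apply (is_RInt_ext (fun y => opp (Gr (cos y * cos y)))).
    - rewrite Rmin_left, Rmax_right by lra. intros y Hyy. symmetry. apply A_integrand_subst. lra.
    - apply (is_RInt_opp (V := R_NormedModule)). apply (is_RInt_derive (fun y => Im (TT (0, y)))).
      + intros y _. apply TT_axis_der.
      + intros y _. apply (continuous_comp (fun y => cos y * cos y) Gr).
        * apply (ex_derive_continuous (K := R_AbsRing) (V := R_NormedModule)). auto_derive. exact I.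
        * apply Gr_continuous. nra. }
  assert (Hg2 : g (PI / 2) = 0).
  { unfold g, cc. rewrite cos_PI2, Rmult_0_l. unfold Rdiv. ring. }
  assert (Hex : ex_RInt A_integrand (g y1) (g (PI / 2))).
  { apply (ex_RInt_continuous (V := R_CompleteNormedModule)). intros x Hx. rewrite Hg2 in Hx.
    pose proof (Hg y1 ltac:(lra)). rewrite Rmin_right, Rmax_left in Hx by lra.
    apply A_integrand_continuous. lra. }
  assert (E : RInt A_integrand (g y1) (g (PI / 2)) = - (AT - Im (TT (0, y1)))).
  { rewrite <- (is_RInt_unique _ _ _ _ I1). apply is_RInt_unique. exact I2. }
  pose proof (RInt_correct (V := R_CompleteNormedModule) _ _ _ Hex) as I3. rewrite E, Hg2 in I3.
  apply (is_RInt_swap (V := R_NormedModule)) in I3.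
  replace (AT - Im (TT (0, y1))) with (opp (- (AT - Im (TT (0, y1))))) by (unfold opp; simpl; ring).
  exact I3.
Qed.

Lemma A_eq (A : R) : is_RInt_gen A_integrand (at_point 0) (at_left a_plus) A -> A = AT.
Proof.
  intros HA. apply NNPP. intros Hne. pose proof PI_RGT_0.
  set (e := Rabs (A - AT)). assert (He : 0 < e) by (apply Rabs_pos_lt; lra).
  assert (HP : locally A (fun y => Rabs (y - A) < e / 2)).
  { assert (He2 : 0 < e / 2) by lra. exists (mkposreal _ He2). intros y Hy. exact Hy. }
  specialize (HA _ HP). destruct HA as [Q S HQ [r HS] H0].
  assert (C1 : continuity_pt (fun y => cc (cos y * cos y)) 0)
    by (eapply is_derive_continuity_pt, cc_cos_der).
  assert (C2 : continuity_pt (fun y => Im (TT (0, y))) 0) by (eapply is_derive_continuity_pt, TT_axis_der).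
  destruct (C1 r (cond_pos r)) as (d1 & Hd1 & H1).
  destruct (C2 (e / 2) ltac:(lra)) as (d2 & Hd2 & H2).
  (* So small that the upper limit is in the neighbourhood of a_+ given by the improper integral,
     and that [A_integral] yields a value within e / 2 of [AT]. *)
  set (y1 := Rmin (PI / 4) (Rmin (d1 / 2) (d2 / 2))).
  assert (Hy1 : 0 < y1) by (repeat apply Rmin_glb_lt; lra).
  assert (Hy2 : y1 <= PI / 4) by apply Rmin_l.
  assert (Hy3 : y1 <= d1 / 2) by (eapply Rle_trans; [apply Rmin_r|apply Rmin_l]).
  assert (Hy4 : y1 <= d2 / 2) by (eapply Rle_trans; [apply Rmin_r|apply Rmin_r]).
  assert (Hdist : forall d, y1 <= d / 2 -> D_x no_cond 0 y1 /\ R_dist y1 0 < d).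
  { intros d Hd. split; [split; [exact I|lra]|]. unfold R_dist. rewrite Rminus_0_r, Rabs_pos_eq; lra. }
  specialize (H1 y1 (Hdist d1 Hy3)). specialize (H2 y1 (Hdist d2 Hy4)).
  change (Rabs (cc (cos y1 * cos y1) - cc (cos 0 * cos 0)) < r) in H1.
  change (Rabs (Im (TT (0, y1)) - Im (TT (RtoC 0))) < e / 2) in H2.
  rewrite cos_0, Rmult_1_r, cc_1 in H1.
  rewrite TT_0 in H2. change (Im (RtoC 0)) with 0 in H2.
  pose proof (A_integral y1 ltac:(lra)) as I1.
  destruct (H0 0 (cc (cos y1 * cos y1)) HQ) as (y & Iy & Py).
  - apply HS; [exact H1|apply cc_cos_lt; lra].
  - simpl in Iy. pose proof (is_RInt_unique _ _ _ _ Iy) as U1. rewrite (is_RInt_unique _ _ _ _ I1) in U1.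
    subst y. rewrite Rminus_0_r in H2. unfold e in *.
    pose proof (Rabs_triang (AT - Im (TT (0, y1)) - A) (Im (TT (0, y1)))) as T.
    replace (AT - Im (TT (0, y1)) - A + Im (TT (0, y1))) with (- (A - AT)) in T by ring.
    rewrite Rabs_Ropp in T. lra.
Qed.

(** * The extended separatrix *)

(* [UU] is the domain of the extension, [VV] the inverse of [TT] on it. *)
Definition UU (t : C) : Prop := exists z, Om z /\ TT z = t.
Definition VV (t : C) : C := epsilon (inhabits (RtoC 0)) (fun z => Om z /\ TT z = t).

Lemma VV_spec (t : C) : UU t -> Om (VV t) /\ TT (VV t) = t.
Proof. intros H. apply (epsilon_spec (inhabits (RtoC 0)) (fun z => Om z /\ TT z = t) H). Qed.

Lemma VV_TT (z : C) : Om z -> VV (TT z) = z.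
Proof.
  intros Hz. destruct (VV_spec (TT z)) as [H1 H2]; [exists z; auto|].
  apply TT_inj_Om; assumption.
Qed.

Lemma UU_conj (t : C) : UU t -> UU (Cconj t).
Proof.
  intros (z & Hz & E). exists (Cconj z). split; [apply Om_conj, Hz|].
  rewrite TT_conj by (left; apply Hz). rewrite E. reflexivity.
Qed.

Lemma VV_conj (t : C) : UU t -> VV (Cconj t) = Cconj (VV t).
Proof.
  intros (z & Hz & <-). rewrite <- TT_conj by (left; apply Hz). rewrite !VV_TT; auto using Om_conj.
Qed.

Lemma VV_Cder (t : C) : UU t -> Cder VV t (/ GG (VV t))%C.
Proof.
  intros (z & Hz & <-). rewrite VV_TT by exact Hz.
  destruct Hz as [Hz1 Hz2].
  apply (inverse_Cder TT GG VV Om z Om_open).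
  - intros y [Hy _]. split; [apply TT_Cder|apply GG_cont]; apply strip_dom, Hy.
  - apply VV_TT.
  - split; assumption.
  - apply GG_neq0, Hz1.
Qed.

Lemma UU_open : open UU.
Proof.
  intros t (z & Hz & <-). apply locally_C. apply (proj2 (locally_Cmod _ _)).
  destruct (Om_open z Hz) as (r & Hr & H).
  destruct (local_onto TT GG z r Hr) as (e & He & H2).
  - intros y Hy. apply TT_Cder, strip_dom, H, Hy.
  - apply GG_cont, strip_dom, Hz.
  - apply GG_neq0, Hz.
  - exists e. split; [exact He|]. intros y Hy. destruct (H2 y Hy) as (a & Ha & Ea).
    exists a. split; [apply H, Ha|exact Ea].
Qed.

Definition lamC (t : C) : C := lamU lstar (VV t).
Definition LamC (t : C) : C := LamU (VV t).

Lemma lamC_Cderivable (t : C) : UU t -> Cderivable lamC t /\ Cderivable LamC t.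
Proof.
  intros H. destruct (VV_spec t H) as [[Hs _] _]. destruct C1_LamU as [L' HL]. split.
  - eapply Cder_Cderivable. apply (Cder_comp (lamU lstar) VV);
      [apply lamU_Cder, strip_dom, Hs|apply VV_Cder, H].
  - eapply Cder_Cderivable. apply (Cder_comp LamU VV); [apply (HL _ Hs)|apply VV_Cder, H].
Qed.

Lemma lamC_conj (t : C) : UU t -> lamC (Cconj t) = Cconj (lamC t) /\ LamC (Cconj t) = Cconj (LamC t).
Proof.
  intros H. destruct (VV_spec t H) as [[Hs _] _]. unfold lamC, LamC. rewrite VV_conj by exact H. split.
  - apply lamU_conj, strip_dom, Hs.
  - apply LamU_conj.
Qed.

Lemma UU_strip (t : C) : Rabs (Im t) <= AT -> (Re t = 0 -> Rabs (Im t) < AT) -> UU t.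
Proof. apply strip_onto. Qed.

Lemma UU_R (x : R) : UU x.
Proof.
  pose proof AT_pos. apply UU_strip; change (Im (RtoC x)) with 0; rewrite Rabs_R0; [lra|intros _; lra].
Qed.

Definition xi (t : R) : R := Re (VV t).

Lemma VV_R (t : R) : VV t = RtoC (xi t).
Proof.
  pose proof (VV_conj _ (UU_R t)) as H. rewrite Cconj_R in H.
  apply (f_equal Im) in H. change (Im (Cconj (VV t))) with (- Im (VV t)) in H.
  apply Ceq; [reflexivity|]. change (Im (RtoC (xi t))) with 0. lra.
Qed.

Lemma xi_0 : xi 0 = 0.
Proof.
  unfold xi. rewrite <- TT_0 at 1. rewrite VV_TT; [reflexivity|].
  apply Om_axis. pose proof PI_RGT_0. lra.
Qed.

Lemma Gr_cosh_pos (x : R) : 0 < Gr (cosh x * cosh x).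
Proof. apply Gr_pos. pose proof (cosh_gt_0 x). nra. Qed.

Lemma xi_der (t : R) : is_derive xi t (/ Gr (cosh (xi t) * cosh (xi t))).
Proof.
  apply (is_derive_ext (fun v : R => Re (1 * VV (0 + v * 1))%C)).
  - intros v. rewrite Re_1. unfold xi. do 2 f_equal. ring.
  - eapply is_derive_val; [apply (Cder_line VV 0 1 1), VV_Cder|].
    + replace (0 + t * 1)%C with (RtoC t) by ring. apply UU_R.
    + replace (0 + t * 1)%C with (RtoC t) by ring. rewrite VV_R, GG_R.
      pose proof (Gr_cosh_pos (xi t)).
      rewrite <- RtoC_inv by lra. rewrite Re_1, Cmult_1_r. reflexivity.
Qed.

Lemma acos_antitone (a b : R) : -1 <= a -> a <= b -> b <= 1 -> acos b <= acos a.
Proof.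
  intros H1 H2 H3. apply Rnot_lt_le. intros H.
  pose proof (acos_bound a). pose proof (acos_bound b).
  assert (Hc : cos (acos b) < cos (acos a)) by (apply cos_decreasing_1; lra).
  rewrite !cos_acos in Hc by lra. lra.
Qed.

(** The explicit functions of [xi] solve the pendulum equations because the derivative of [xi] is 1
    / Gr, and they stay in [0, lstar] because X >= 1. [pend_unique] then identifies them with the
    given solution. *)
Lemma lamC_real (lamh Lamh : R -> R) :
  (forall t : R, is_derive lamh t (- 3 * Lamh t)) ->
  (forall t : R, is_derive Lamh t (Fpend (lamh t))) ->
  lamh 0 = lstar -> Lamh 0 = 0 ->
  forall x : R, lamC x = RtoC (lamh x) /\ LamC x = RtoC (Lamh x).
Proof.
  intros H1 H2 E1 E2 x.
  set (l2 := fun t => 2 * acos (cc (cosh (xi t) * cosh (xi t)))).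
  set (L2 := fun t => LamR (xi t)).
  assert (Hcosh : forall y, 1 <= cosh y * cosh y) by (intros y; rewrite cosh2_sinh2; nra).
  assert (Hap : 0 < acos a_plus < PI / 2).
  { pose proof a_plus_bounds. pose proof (acos_bound a_plus).
    assert (Hc : cos (acos a_plus) = a_plus) by (apply cos_acos; lra).
    split; apply Rnot_le_lt; intros Hle.
    - replace (acos a_plus) with 0 in Hc by lra. rewrite cos_0 in Hc. lra.
    - pose proof (cos_le_0 (acos a_plus)) as Hn. pose proof PI_RGT_0.
      specialize (Hn ltac:(lra) ltac:(lra)). lra. }
  destruct (pend_unique lstar lamh Lamh l2 L2) with (t := x) as [A1 A2]; try assumption.
  - unfold lstar. lra.
  - intros t. unfold l2, lstar. specialize (Hcosh (xi t)).
    set (X := cosh (xi t) * cosh (xi t)) in *.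
    pose proof (cc_bounds X ltac:(lra)). pose proof (acos_bound (cc X)).
    assert (acos (cc X) <= acos a_plus); [|lra].
    pose proof a_plus_bounds. apply acos_antitone; [lra| |lra].
    rewrite <- cc_1. destruct (Req_dec X 1) as [->|]; [lra|]. left. apply cc_increasing; lra.
  - intros t. pose proof (Gr_cosh_pos (xi t)). eapply is_derive_val.
    + apply (is_derive_comp (fun x => 2 * acos (cc (cosh x * cosh x))) xi); [apply lam_ode|apply xi_der].
    + unfold scal; simpl; unfold mult; simpl. unfold L2. field. lra.
  - intros t. pose proof (Gr_cosh_pos (xi t)). eapply is_derive_val.
    + apply (is_derive_comp LamR xi); [apply Lam_ode|apply xi_der].
    + unfold scal; simpl; unfold mult; simpl. unfold l2. field. lra.
  - unfold l2. rewrite xi_0, cosh_0, Rmult_1_r, cc_1. exact E1.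
  - unfold L2, LamR. rewrite xi_0, sinh_0, E2. unfold Rdiv. ring.
  - unfold lamC, LamC. rewrite VV_R, lamU_R, LamU_R, A1, A2. split; reflexivity.
Qed.

(** * Polar form and cube roots *)

Definition pol (r a : R) : C := (r * cos a, r * sin a).

Lemma pol_mult (r a r' a' : R) : (pol r a * pol r' a')%C = pol (r * r') (a + a').
Proof.
  unfold pol. rewrite cos_plus, sin_plus. Cparts.
Qed.

Lemma Cmod_pol (r a : R) : 0 <= r -> Cmod (pol r a) = r.
Proof.
  intros H. pose proof (Cmod_sqr (pol r a)) as E. pose proof (Cmod_ge_0 (pol r a)).
  change (Re (pol r a)) with (r * cos a) in E. change (Im (pol r a)) with (r * sin a) in E.
  pose proof (sin2_cos2' a).
  assert (Cmod (pol r a) * Cmod (pol r a) = r * r).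
  { rewrite E. transitivity (r * r * (sin a * sin a + cos a * cos a)); [ring|]. rewrite H1. ring. }
  apply Rsqr_inj; assumption.
Qed.

Lemma pol_ArgP (W : C) : slit W -> pol (Cmod W) (ArgP W) = W.
Proof.
  intros H. unfold slit in H. unfold ArgP.
  (* Here q is the tangent of half the argument; cosine and sine of the argument are (1 - q^2) / (1
     + q^2) and 2 q / (1 + q^2). *)
  set (n := Cmod W + Re W) in *. set (q := Im W / n). set (k := sqrt (1 + q * q)).
  assert (Hk2 : k * k = 1 + q * q) by (apply sqrt_sqrt; nra).
  assert (Hk : 0 < k) by (apply sqrt_lt_R0; nra).
  assert (Hn : Im W = q * n) by (unfold q; field; lra).
  pose proof (Cmod_sqr W) as HW.
  assert (HW2 : Cmod W * (1 + q * q) = Cmod W + Re W + q * q * Cmod W - Re W) by ring.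
  assert (Hq : q * q * n = Cmod W - Re W).
  { apply Rmult_eq_reg_r with n; [|lra]. transitivity (Im W * Im W); [rewrite Hn; ring|]. unfold n. nra. }
  assert (Hm : 2 * Cmod W = n * (k * k)) by (rewrite Hk2; unfold n in *; lra).
  assert (Hr : 2 * Re W = n * (1 - q * q)) by (unfold n in *; lra).
  unfold pol. rewrite cos_2a, sin_2a, cos_atan, sin_atan. unfold Rsqr. fold k.
  apply Ceq; [change (Re (?a, ?b)) with a|change (Im (?a, ?b)) with b].
  - replace (Cmod W) with (n * (k * k) / 2) by lra. replace (Re W) with (n * (1 - q * q) / 2) by lra.
    field. lra.
  - replace (Cmod W) with (n * (k * k) / 2) by lra. rewrite Hn. field. lra.
Qed.

Lemma ArgP_bound (W : C) : - PI < ArgP W < PI.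
Proof. unfold ArgP. pose proof (atan_bound (Im W / (Cmod W + Re W))). lra. Qed.

Lemma ArgP_sign (W : C) : slit W -> (0 <= Im W -> 0 <= ArgP W) /\ (Im W <= 0 -> ArgP W <= 0).
Proof.
  intros H. unfold slit in H. unfold ArgP.
  assert (Hmono : forall x y, x <= y -> atan x <= atan y).
  { intros x y [L| ->]; [left; apply atan_increasing, L|right; reflexivity]. }
  split; intros Hi.
  - assert (atan 0 <= atan (Im W / (Cmod W + Re W))); [|rewrite atan_0 in H0; lra].
    apply Hmono. apply Rle_div_r; lra.
  - assert (atan (Im W / (Cmod W + Re W)) <= atan 0); [|rewrite atan_0 in H0; lra].
    apply Hmono. apply Rle_div_l; lra.
Qed.

(* [kap = k3^3]. Among the cube roots of 1/2, [alpha] is the one for which lambda - PI is real and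
   negative on the segment from 0 to iA, see [alpha_pow_23]. *)
Definition a0 : R := Rpower (1 / 2) (1 / 3).
Definition k3 : R := sqrt (2 / (3 * mm * a0)).
Definition alpha : C := pol a0 (- (2 * PI / 3)).

Lemma Rpower_cube (x : R) : 0 < x -> Rpower x (1 / 3) ^ 3 = x.
Proof.
  intros H. rewrite <- Rpower_pow by apply exp_pos. rewrite Rpower_mult.
  replace (1 / 3 * INR 3) with 1 by (simpl; field). apply Rpower_1, H.
Qed.

Lemma a0_pos : 0 < a0.
Proof. apply exp_pos. Qed.

Lemma a0_cube : a0 * a0 * a0 = 1 / 2.
Proof. pose proof (Rpower_cube (1 / 2) ltac:(lra)) as H. fold a0 in H. simpl in H. lra. Qed.

Lemma k3_pos : 0 < k3.
Proof.
  pose proof mm_bounds. pose proof a0_pos. apply sqrt_lt_R0, Rdiv_lt_0_compat; [lra|].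
  apply Rmult_lt_0_compat; lra.
Qed.

Lemma k3_sqr : k3 * k3 = 2 / (3 * mm * a0).
Proof.
  pose proof mm_bounds. pose proof a0_pos. apply sqrt_sqrt. left. apply Rdiv_lt_0_compat; [lra|].
  apply Rmult_lt_0_compat; lra.
Qed.

(** [k3] is defined by matching the coefficients of lambda, (2 / m) s^2 = 3 a0 (k3 s)^2. That its
    cube is also the coefficient of T is what forces alpha^3 = 1/2; both squares equal 16 / (27
    m^3). *)
Lemma kap_k3 : kap = k3 * k3 * k3.
Proof.
  pose proof mm_bounds. pose proof a0_pos. pose proof k3_pos. pose proof kap_pos.
  constants.
  apply Rsqr_inj; [lra| |].
  - repeat apply Rmult_le_pos; lra.
  - unfold Rsqr. transitivity (16 / (27 * (mm * mm * mm))).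
    + unfold kap. transitivity (KK * KK / (9 * ((sqrt bb * sqrt bb) * (sqrt dd * sqrt dd)))).
      * field. split; apply Rgt_not_eq, sqrt_lt_R0; lra.
      * rewrite KK_sqr, !sqrt_sqrt by lra. unfold bb, dd. field. lra.
    + transitivity ((k3 * k3) * (k3 * k3) * (k3 * k3)); [|ring]. rewrite k3_sqr.
      transitivity (8 / (27 * (mm * mm * mm) * (a0 * a0 * a0))); [rewrite a0_cube; field; lra|].
      field. split; lra.
Qed.

Lemma k3_Lam : NN * sqrt dd * k3 / mm = 2 / 3 * a0.
Proof.
  pose proof mm_bounds. pose proof a0_pos. pose proof k3_pos. constants. assert (0 < sqrt dd)
    by (apply sqrt_lt_R0; lra).
  apply Rsqr_inj.
  - apply Rle_div_r; [lra|]. rewrite Rmult_0_l. repeat apply Rmult_le_pos; lra.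
  - lra.
  - unfold Rsqr. transitivity ((NN * NN) * (sqrt dd * sqrt dd) * (k3 * k3) / (mm * mm)); [field; lra|].
    rewrite NN_sqr, k3_sqr, sqrt_sqrt by lra. unfold dd.
    transitivity (2 / 9 * / a0); [field; split; lra|].
    apply Rmult_eq_reg_r with (9 / 2 * a0); [|nra].
    transitivity 1; [field; lra|]. transitivity (2 * (a0 * a0 * a0)); [rewrite a0_cube; field|field].
Qed.

Lemma alpha_cube : Cpow alpha 3 = RtoC (1 / 2).
Proof.
  simpl. rewrite Cmult_1_r. unfold alpha. rewrite !pol_mult.
  replace (a0 * (a0 * a0)) with (1 / 2) by (rewrite <- a0_cube; ring).
  replace (- (2 * PI / 3) + (- (2 * PI / 3) + - (2 * PI / 3))) with (- (2 * PI)) by field.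
  unfold pol. rewrite cos_neg, sin_neg, cos_2PI, sin_2PI. unfold RtoC. f_equal; field.
Qed.

Definition croot (W : C) : C := pol (Rpower (Cmod W) (1 / 3)) (ArgP W / 3).

Lemma croot_cube (W : C) : slit W -> (croot W * croot W * croot W)%C = W.
Proof.
  intros H. assert (HW : 0 < Cmod W).
  { apply Cmod_gt_0. intros E. subst. unfold slit in H. rewrite Cmod_0 in H. unfold Re in H.
    simpl in H. lra. }
  unfold croot. rewrite !pol_mult. rewrite <- (pol_ArgP W H) at 7.
  f_equal; [|field]. rewrite <- (Rpower_cube (Cmod W) HW) at 4. simpl. ring.
Qed.

Lemma croot_sector (W : C) : slit W -> 0 < Cmod W ->
  0 < Re (croot W) /\ (0 <= Im W -> 0 <= Im (croot W)) /\ (Im W <= 0 -> Im (croot W) <= 0).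
Proof.
  intros H HW. pose proof (ArgP_bound W). destruct (ArgP_sign W H) as [S1 S2]. pose proof PI_RGT_0.
  assert (Hr : 0 < Rpower (Cmod W) (1 / 3)) by apply exp_pos.
  unfold croot. change (Re (pol ?r ?a)) with (r * cos a). change (Im (pol ?r ?a)) with (r * sin a).
  split; [|split]; intros.
  - apply Rmult_lt_0_compat; [exact Hr|]. apply cos_gt_0; lra.
  - apply Rmult_le_pos; [lra|]. apply sin_ge_0; specialize (S1 H2); lra.
  - specialize (S2 H2). assert (0 <= sin (- (ArgP W / 3))) by (apply sin_ge_0; lra).
    rewrite sin_neg in H3. nra.
Qed.

(** With phi the principal argument of i w, the branch has argument phi - pi/2, and the phase of the
    product is 2 phi / 3 - pi. For the power -1/3 it is - phi / 3 - pi/2. *)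
Lemma alpha_pow_23 (w : C) : 0 < Cmod w ->
  (alpha * pow_up (2 / 3) w)%C = (- (a0 * (croot (Ci * w) * croot (Ci * w))))%C.
Proof.
  intros Hw. unfold pow_up, cpow_br, croot. rewrite Cmod_mult, Cmod_Ci, Rmult_1_l.
  set (ph := ArgP (Ci * w)).
  change (?r * cos ?a, ?r * sin ?a) with (pol r a).
  unfold alpha. rewrite !pol_mult.
  replace (- (2 * PI / 3) + 2 / 3 * (ph + - PI / 2)) with (ph / 3 + ph / 3 - PI) by field.
  replace (Rpower (Cmod w) (2 / 3)) with (Rpower (Cmod w) (1 / 3) * Rpower (Cmod w) (1 / 3)).
  - unfold pol. rewrite cos_minus, sin_minus, cos_PI, sin_PI. Cparts.
  - rewrite <- Rpower_plus. f_equal. field.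
Qed.

Lemma croot_neq0 (W : C) : croot W <> 0.
Proof.
  apply (proj2 (Cmod_gt_0 _)). unfold croot. rewrite Cmod_pol; [apply exp_pos|left; apply exp_pos].
Qed.

Lemma alpha_pow_13 (w : C) : 0 < Cmod w ->
  (alpha * pow_up (- 1 / 3) w)%C = (- (a0 * Ci / croot (Ci * w)))%C.
Proof.
  intros Hw. pose proof (croot_neq0 (Ci * w)) as Hn.
  assert (E : (alpha * pow_up (- 1 / 3) w * croot (Ci * w))%C = (- (a0 * Ci))%C).
  { unfold pow_up, cpow_br, croot. rewrite Cmod_mult, Cmod_Ci, Rmult_1_l.
    set (ph := ArgP (Ci * w)).
    change (?r * cos ?a, ?r * sin ?a) with (pol r a).
    unfold alpha. rewrite !pol_mult.
    replace (- (2 * PI / 3) + - 1 / 3 * (ph + - PI / 2) + ph / 3) with (- (PI / 2)) by field.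
    replace (a0 * Rpower (Cmod w) (- 1 / 3) * Rpower (Cmod w) (1 / 3)) with a0.
    - unfold pol. rewrite cos_neg, sin_neg, cos_PI2, sin_PI2. Cparts.
    - rewrite Rmult_assoc, <- Rpower_plus. replace (- 1 / 3 + 1 / 3) with 0 by field.
      rewrite Rpower_O by exact Hw. ring. }
  transitivity (alpha * pow_up (- 1 / 3) w * croot (Ci * w) / croot (Ci * w))%C; [field; exact Hn|].
  rewrite E. field. exact Hn.
Qed.

(* The hypothesis gives |S^2 + S s + s^2| >= |S s|. *)
Lemma cube_root_close (S s : C) :
  0 <= Re S * Re s + Im S * Im s ->
  Cmod S * Cmod s * Cmod (S - s) <= Cmod (S * S * S - s * s * s).
Proof.
  intros H. set (T := (S * S + S * s + s * s)%C).
  assert (HT : Cmod S * Cmod s <= Cmod T).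
  { set (p := (Cmod S * Cmod s)%R).
    assert (Hp : 0 <= p) by (apply Rmult_le_pos; apply Cmod_ge_0).
    assert (E : Re (T * Cconj (S * s))%C = (Cmod S * Cmod S + Cmod s * Cmod s) * (Re S * Re s + Im S * Im s) + p * p).
    { unfold p. replace (Cmod S * Cmod s * (Cmod S * Cmod s)) with ((Cmod S * Cmod S) * (Cmod s * Cmod s)) by ring.
      rewrite !Cmod_sqr. destruct S, s. unfold T, Cconj, Re, Im. simpl. ring. }
    assert (E2 : p * p <= Cmod T * p).
    { assert (Cmod (T * Cconj (S * s)) = Cmod T * p) by (rewrite Cmod_mult, Cmod_conj, Cmod_mult;
        reflexivity).
      rewrite <- H0. pose proof (re_le_Cmod (T * Cconj (S * s))) as R1. apply Rabs_le_between in R1.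
      pose proof (Cmod_ge_0 S). pose proof (Cmod_ge_0 s).
      assert (0 <= (Cmod S * Cmod S + Cmod s * Cmod s) * (Re S * Re s + Im S * Im s)).
      { apply Rmult_le_pos; [nra|exact H]. }
      lra. }
    destruct Hp as [Hp|<-]; [apply Rmult_le_reg_r with p; assumption|apply Cmod_ge_0]. }
  replace (S * S * S - s * s * s)%C with (T * (S - s))%C by (unfold T; ring).
  rewrite Cmod_mult. apply Rmult_le_compat_r; [apply Cmod_ge_0|exact HT].
Qed.

(** Solves p (p / 2) x <= 1536 (2 p / k3)^5 for x / p^3: the remainder of [corner_TT] divided by the
    lower bound for |S| |sg|. *)
Definition Croot_const : R := 1536 * 64 / (k3 * k3 * k3 * k3 * k3).

(* With [s = csinh u] and [sg = i k3 s] one has [sg^3 = - i kap s^3], so [sg] approximates the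
   principal cube root of [i w]. *)
Lemma corner_root (u w : C) :
  Cmod u <= rad -> Om (ipi2 + u) -> TT (ipi2 + u) = ((0, AT) + w)%C -> (Re w = 0 -> Im w < 0) ->
  let S := croot (Ci * w) in
  let sg := (Ci * k3 * csinh u)%C in
  let p := Rpower (Cmod w) (1 / 3) in
  0 < p /\ Cmod S = p /\ p / 2 <= Cmod sg <= 2 * p /\ Cmod (csinh u) <= 2 * p / k3 /\
  Cmod (S - sg) <= Croot_const * (p * p * p).
Proof.
  intros Hu HOm E Hw S sg p.
  pose proof rad_le as Hrad. pose proof k3_pos as Hk. pose proof kap_k3 as Hkap.
  assert (Hw0 : 0 < Cmod w).
  { apply Cmod_gt_0. intros E0. subst w. unfold Re, Im in Hw. simpl in Hw. lra. }
  assert (Hsl : slit (Ci * w)).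
  { apply slit_intro. rewrite Im_Ci, Re_Ci. intros H. specialize (Hw H). lra. }
  assert (HW : 0 < Cmod (Ci * w)) by (rewrite Cmod_mult, Cmod_Ci, Rmult_1_l; exact Hw0).
  assert (Hp : 0 < p) by apply exp_pos.
  assert (Hp3 : p * p * p = Cmod w).
  { rewrite <- (Rpower_cube (Cmod w) Hw0). fold p. simpl. ring. }
  assert (HS : Cmod S = p).
  { unfold S, croot. rewrite Cmod_pol by (left; apply exp_pos). rewrite Cmod_mult, Cmod_Ci, Rmult_1_l.
    reflexivity. }
  pose proof (corner_two_sided u Hu) as [T1 T2].
  pose proof (corner_TT u ltac:(lra)) as T3.
  rewrite E in T1, T2, T3. replace ((0, AT) + w - (0, AT))%C with w in T1, T2, T3 by ring.
  set (s := csinh u) in *. set (a := Cmod s) in *. assert (Ha : 0 <= a) by apply Cmod_ge_0.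
  assert (Hsg : Cmod sg = k3 * a).
  { unfold sg. rewrite !Cmod_mult, Cmod_Ci, Cmod_R, Rabs_pos_eq by lra. unfold a, s. ring. }
  rewrite <- Hp3, Hkap in T1, T2. simpl in T1, T2.
  assert (B1 : p <= 2 * (k3 * a)).
  { apply Rnot_lt_le. intros H. assert (0 <= 2 * (k3 * a)) by nra.
    assert ((2 * (k3 * a)) * (2 * (k3 * a)) <= p * p) by (apply Rmult_le_compat; lra).
    assert ((2 * (k3 * a)) * (2 * (k3 * a)) * (2 * (k3 * a)) <= p * p * (2 * (k3 * a)))
      by (apply Rmult_le_compat_r; lra).
    assert (p * p * (2 * (k3 * a)) < p * p * p) by (apply Rmult_lt_compat_l; nra).
    assert (0 <= (k3 * a) * (k3 * a) * (k3 * a)) by (repeat apply Rmult_le_pos; lra). lra. }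
  assert (B2 : k3 * a <= 2 * p).
  { apply Rnot_lt_le. intros H.
    assert ((2 * p) * (2 * p) <= (k3 * a) * (k3 * a)) by (apply Rmult_le_compat; lra).
    assert ((2 * p) * (2 * p) * (2 * p) <= (k3 * a) * (k3 * a) * (k3 * a)) by (apply Rmult_le_compat; nra).
    assert (0 < p * p * p) by lra. lra. }
  split; [exact Hp|]. split; [exact HS|]. rewrite Hsg. split; [lra|].
  assert (B3 : a <= 2 * p / k3) by (apply Rle_div_r; lra).
  split; [exact B3|].
  (* Both numbers have positive real part, and their imaginary parts have compatible signs: that of
     S has the sign of Re w, that of sg the sign of Re u, and membership in [Om] links the two. This
     singles out the right cube root. *)
  assert (Hquad : 0 <= Re S * Re sg + Im S * Im sg).
  { destruct (croot_sector (Ci * w) Hsl HW) as (C1 & C2 & C3). fold S in C1, C2, C3.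
    rewrite Im_Ci in C2, C3. destruct HOm as (O1 & O2 & O3). rewrite E in O2, O3.
    change (Re ((0, AT) + w)%C) with (0 + Re w) in O2, O3.
    unfold strip in O1. change (Im (ipi2 + u)%C) with (PI / 2 + Im u) in O1.
    change (Re (ipi2 + u)%C) with (0 + Re u) in O2, O3.
    destruct (small_Re u ltac:(lra)) as [_ Hui]. pose proof PI2_3_2.
    assert (Hre : Re sg = - (k3 * (cosh (Re u) * sin (Im u)))).
    { unfold sg, s, csinh, Ci, Re at 1. simpl. ring. }
    assert (Him : Im sg = k3 * (sinh (Re u) * cos (Im u))).
    { unfold sg, s, csinh, Ci, Im at 1. simpl. ring. }
    assert (Hsin : sin (Im u) < 0) by (apply sin_lt_0_var; lra).
    assert (Hcos : 0 < cos (Im u)) by (apply cos_gt_0; lra).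
    pose proof (cosh_gt_0 (Re u)) as Hch.
    apply Rplus_le_le_0_compat.
    - apply Rmult_le_pos; [lra|]. rewrite Hre.
      assert (0 <= k3 * (cosh (Re u) * - sin (Im u))); [|lra].
      apply Rmult_le_pos; [lra|]. apply Rmult_le_pos; lra.
    - rewrite Him. destruct (Rtotal_order (Re u) 0) as [L|[L|L]].
      + specialize (O3 ltac:(lra)). specialize (C3 ltac:(lra)).
        assert (sinh (Re u) < 0).
        { pose proof (sinh_gt_0 (- Re u) ltac:(lra)) as Q. rewrite sinh_odd in Q. lra. }
        assert (0 <= (- Im S) * (k3 * (- sinh (Re u) * cos (Im u)))); [|lra].
        apply Rmult_le_pos; [lra|]. apply Rmult_le_pos; [lra|]. apply Rmult_le_pos; lra.
      + rewrite L, sinh_0. lra.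
      + specialize (O2 ltac:(lra)). specialize (C2 ltac:(lra)).
        pose proof (sinh_gt_0 (Re u) L).
        apply Rmult_le_pos; [lra|]. apply Rmult_le_pos; [lra|]. apply Rmult_le_pos; lra. }
  pose proof (cube_root_close S sg Hquad) as D. rewrite HS, Hsg in D.
  assert (D2 : Cmod (S * S * S - sg * sg * sg) <= 1536 * (a * a * a * a * a)).
  { unfold S. rewrite (croot_cube _ Hsl).
    replace (Ci * w - sg * sg * sg)%C with (Ci * (w + kap * (s * s * s)))%C.
    - rewrite Cmod_mult, Cmod_Ci, Rmult_1_l. exact T3.
    - unfold sg. fold s. rewrite Hkap, !RtoC_mult.
      transitivity (Ci * w - Ci * (Ci * Ci) * (k3 * k3 * k3 * (s * s * s)))%C; [|ring].
      replace (Ci * Ci)%C with (- RtoC 1)%C by Cparts. ring. }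
  pose proof (Cmod_ge_0 (S - sg)) as H0. set (x := Cmod (S - sg)) in *.
  assert (D3 : p * (p / 2) * x <= 1536 * (a * a * a * a * a)).
  { eapply Rle_trans; [|eapply Rle_trans; [exact D|exact D2]].
    apply Rmult_le_compat_r; [exact H0|]. apply Rmult_le_compat_l; lra. }
  set (q := 2 * p / k3) in *. assert (Hq : 0 <= q) by lra.
  assert (D4 : a * a * a * a * a <= q * q * q * q * q).
  { repeat (apply Rmult_le_compat; repeat apply Rmult_le_pos; try assumption). }
  apply Rmult_le_reg_l with (p * (p / 2)); [apply Rmult_lt_0_compat; lra|].
  eapply Rle_trans; [exact D3|]. eapply Rle_trans; [apply Rmult_le_compat_l; [lra|exact D4]|].
  right. unfold q, Croot_const. field. lra.
Qed.

(** * Expansions in powers of t - iA *)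

Definition Klam : R := 3072 * 16 / (k3 * k3 * k3 * k3) + 9 * a0 * Croot_const.
Definition KLam : R := 16 * NN / k3 + 4 / 3 * a0 * Croot_const.

Lemma Croot_const_pos : 0 < Croot_const.
Proof.
  pose proof k3_pos. apply Rdiv_lt_0_compat; [lra|]. repeat (apply Rmult_lt_0_compat; [|assumption]).
  assumption.
Qed.

(** Each bound has two contributions, the corner remainder in s and the cost of replacing sg by the
    exact cube root S in the leading term. They are the two summands of [Klam] and of [KLam]. *)
Lemma corner_expansion (w : C) : Cmod w < nu0 -> (Re w = 0 -> Im w < 0) ->
  let t := ((0, AT) + w)%C in
  UU t /\
  Cmod (lamC t - (PI + 3 * alpha * pow_up (2 / 3) w)) <= Klam * Rpower (Cmod w) (4 / 3) /\
  Cmod (LamC t - (- 2 / 3)%R * alpha * pow_up (- 1 / 3) w) <= KLam * Rpower (Cmod w) (1 / 3).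
Proof.
  intros Hw1 Hw2 t. destruct (corner_onto w Hw1 Hw2) as (u & Hu & HOm & E).
  fold t in E. split; [exists (ipi2 + u)%C; split; assumption|].
  assert (EV : VV t = (ipi2 + u)%C) by (rewrite <- E; apply VV_TT, HOm).
  pose proof rad_le as Hrad. pose proof k3_pos as Hk. pose proof a0_pos as Ha0. pose proof mm_bounds as Hmm.
  pose proof Croot_const_pos as HC. pose proof NN_pos as HN.
  destruct (corner_root u w Hu HOm E Hw2) as (Hp & HS & [Hsg1 Hsg2] & Hs & HD).
  set (S := croot (Ci * w)) in *. set (p := Rpower (Cmod w) (1 / 3)) in *.
  set (s := csinh u) in *. set (sg := (Ci * k3 * s)%C) in *.
  assert (Hw0 : 0 < Cmod w).
  { apply Cmod_gt_0. intros E0. subst w. unfold Re, Im in Hw2. simpl in Hw2. lra. }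
  assert (Hsq : (sg * sg)%C = (- (k3 * k3)%R * (s * s))%C).
  { unfold sg. rewrite RtoC_mult. transitivity ((Ci * Ci) * (k3 * k3 * (s * s)))%C; [ring|].
    replace (Ci * Ci)%C with (- RtoC 1)%C by Cparts. ring. }
  assert (Hsg0 : sg <> 0) by (apply (proj2 (Cmod_gt_0 _)); lra).
  assert (Hs0 : s <> 0).
  { intros E0. apply Hsg0. unfold sg. rewrite E0. ring. }
  assert (HS0 : S <> 0) by (apply (proj2 (Cmod_gt_0 _)); lra).
  assert (Nk : RtoC k3 <> 0) by (apply RtoC_neq0; lra).
  assert (Nm : RtoC mm <> 0) by (apply RtoC_neq0; lra).
  unfold lamC, LamC. rewrite EV. split.
  - pose proof (corner_lamU lstar u ltac:(lra)) as L. rewrite lamU_ipi2 in L. fold s in L.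
    assert (E1 : (2 / mm * (s * s))%C = (- (3 * a0)%R * (sg * sg))%C).
    { rewrite Hsq. replace (3 * a0) with (2 / mm * / (k3 * k3)).
      - rewrite RtoC_mult, RtoC_div, RtoC_inv, !RtoC_mult by nra. field. split; assumption.
      - rewrite k3_sqr. field. split; lra. }
    rewrite E1 in L.
    assert (E2 : (3 * alpha * pow_up (2 / 3) w)%C = (- (3 * a0)%R * (S * S))%C).
    { rewrite <- Cmult_assoc, alpha_pow_23 by exact Hw0. fold S. rewrite RtoC_mult. ring. }
    rewrite E2.
    replace (lamU lstar (ipi2 + u) - (PI + - (3 * a0)%R * (S * S)))%C
      with ((lamU lstar (ipi2 + u) - PI - - (3 * a0)%R * (sg * sg)) + (3 * a0)%R * ((S + sg) * (S - sg)))%C by ring.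
    eapply Rle_trans; [apply Cmod_triangle|].
    assert (E4 : Rpower (Cmod w) (4 / 3) = p * p * p * p).
    { unfold p. rewrite <- !Rpower_plus. f_equal. field. }
    rewrite E4. unfold Klam. rewrite Rmult_plus_distr_r. apply Rplus_le_compat.
    + eapply Rle_trans; [exact L|].
      set (a := Cmod s) in *. assert (Ha : 0 <= a) by apply Cmod_ge_0.
      set (q := 2 * p / k3) in *. assert (Hq : 0 <= q) by lra.
      assert (D4 : a * a * a * a <= q * q * q * q).
      { repeat (apply Rmult_le_compat; repeat apply Rmult_le_pos; try assumption). }
      eapply Rle_trans; [apply Rmult_le_compat_l; [lra|exact D4]|]. right. unfold q. field. lra.
    + rewrite !Cmod_mult, Cmod_R, Rabs_pos_eq by nra.
      assert (Cmod (S + sg) <= 3 * p) by (eapply Rle_trans; [apply Cmod_triangle|lra]).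
      assert (Cmod (S + sg) * Cmod (S - sg) <= (3 * p) * (Croot_const * (p * p * p)))
        by (apply Rmult_le_compat; try apply Cmod_ge_0; assumption).
      eapply Rle_trans; [apply Rmult_le_compat_l; [nra|exact H0]|]. right. ring.
  - pose proof (corner_LamU u ltac:(lra) Hs0) as L. fold s in L.
    assert (E1 : (NN * sqrt dd / (mm * s))%C = ((2 / 3 * a0)%R * Ci / sg)%C).
    { rewrite <- k3_Lam. rewrite RtoC_div, !RtoC_mult by lra. unfold sg. field.
      repeat split; try assumption. apply Ci_nz. }
    rewrite E1 in L.
    assert (E2 : ((- 2 / 3)%R * alpha * pow_up (- 1 / 3) w)%C = ((2 / 3 * a0)%R * Ci / S)%C).
    { rewrite <- Cmult_assoc, alpha_pow_13 by exact Hw0. fold S.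
      replace (- 2 / 3) with (- (2 / 3)) by field. rewrite RtoC_opp, RtoC_mult. field. exact HS0. }
    rewrite E2.
    replace (LamU (ipi2 + u) - (2 / 3 * a0)%R * Ci / S)%C
      with ((LamU (ipi2 + u) - (2 / 3 * a0)%R * Ci / sg) + (2 / 3 * a0)%R * Ci * ((S - sg) / (sg * S)))%C
      by (field; split; assumption).
    eapply Rle_trans; [apply Cmod_triangle|].
    unfold KLam. rewrite Rmult_plus_distr_r. apply Rplus_le_compat.
    + eapply Rle_trans; [exact L|]. apply Rle_trans with (NN * 8 * (2 * p / k3)).
      * apply Rmult_le_compat_l; [lra|exact Hs].
      * right. field. lra.
    + rewrite !Cmod_mult, Cmod_Ci, Cmod_R, Rabs_pos_eq by lra.
      rewrite Cmod_div by (apply Cmult_neq_0; assumption). rewrite Cmod_mult, HS.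
      assert (Hden : p * p / 2 <= Cmod sg * p) by nra.
      assert (Cmod (S - sg) / (Cmod sg * p) <= Croot_const * (2 * p)).
      { apply Rle_div_l; [nra|]. eapply Rle_trans; [exact HD|].
        apply Rle_trans with (Croot_const * (2 * p) * (p * p / 2)); [right; field|].
        apply Rmult_le_compat_l; [nra|exact Hden]. }
      apply Rle_trans with (2 / 3 * a0 * 1 * (Croot_const * (2 * p))).
      * apply Rmult_le_compat_l; [lra|exact H].
      * right. field.
Qed.

(** The two branch cuts are mirror images, so the expansion at -iA is the conjugate of the one at
    iA. *)
Lemma pow_dn_conj (p : R) (w : C) : pow_dn p (Cconj w) = Cconj (pow_up p w).
Proof.
  unfold pow_dn, pow_up, cpow_br. rewrite Cmod_conj.
  replace (- Ci * Cconj w)%C with (Cconj (Ci * w)) by Cparts.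
  assert (E : ArgP (Cconj (Ci * w)) = - ArgP (Ci * w)).
  { unfold ArgP. rewrite Cmod_conj. change (Re (Cconj ?z)) with (Re z).
    change (Im (Cconj ?z)) with (- Im z).
    replace (- Im (Ci * w) / (Cmod (Ci * w) + Re (Ci * w))) with (- (Im (Ci * w) / (Cmod (Ci * w) + Re (Ci * w))))
      by (unfold Rdiv; ring).
    rewrite atan_opp. ring. }
  rewrite E. set (ph := ArgP (Ci * w)).
  replace (p * (- ph + PI / 2)) with (- (p * (ph + - PI / 2))) by field.
  rewrite cos_neg, sin_neg. unfold Cconj. simpl. f_equal. ring.
Qed.

(** * Singularities at +-iA and conclusion *)

Lemma LamC_unbounded (M r : R) : 0 < r ->
  exists t, Cmod (t - (0, AT)) < r /\ 0 <= Im t < AT /\ M < Cmod (LamC t).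
Proof.
  intros Hr. pose proof nu0_pos as Hn. pose proof a0_pos as Ha. pose proof k3_pos as Hk.
  pose proof NN_pos as HN. pose proof Croot_const_pos as HC. pose proof (Rabs_pos M) as HM.
  assert (HK : 0 < KLam).
  { unfold KLam. apply Rplus_lt_0_compat; [apply Rdiv_lt_0_compat; lra|]. apply Rmult_lt_0_compat; lra. }
  set (B := KLam + Rabs M + 1).
  set (q := Rmin (Rmin 1 (r / 2)) (Rmin (nu0 / 2) (2 / 3 * a0 / B))).
  assert (HB : 0 < B) by (unfold B; lra).
  assert (Hq : 0 < q) by (repeat apply Rmin_glb_lt; try lra; apply Rdiv_lt_0_compat; lra).
  assert (Hq1 : q <= 1) by (eapply Rle_trans; [apply Rmin_l|apply Rmin_l]).
  assert (Hq2 : q <= r / 2) by (eapply Rle_trans; [apply Rmin_l|apply Rmin_r]).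
  assert (Hq3 : q <= nu0 / 2) by (eapply Rle_trans; [apply Rmin_r|apply Rmin_l]).
  assert (Hq4 : q <= 2 / 3 * a0 / B) by (eapply Rle_trans; [apply Rmin_r|apply Rmin_r]).
  (* The approach is along the imaginary axis from below, with |w| a cube so that |w|^(1/3) = q. The
     leading term has modulus 2 a0 / (3 q) >= B, and the remainder is at most [KLam]. *)
  set (y := q * q * q). assert (Hy : 0 < y) by (unfold y; repeat apply Rmult_lt_0_compat; assumption).
  assert (Hyq : y <= q) by (unfold y; assert (q * q <= 1) by nra; nra).
  set (w := (0, - y)%R : C).
  assert (Hwm : Cmod w = y).
  { replace w with (Ci * RtoC (- y))%C by (apply Ceq; unfold w, Re, Im, Ci; simpl; ring).
    rewrite Cmod_mult, Cmod_Ci, Cmod_R, Rabs_Ropp, Rabs_pos_eq; lra. }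
  assert (Hnu : nu0 <= AT / 2) by apply Rmin_l.
  destruct (corner_expansion w) as (_ & _ & H); [rewrite Hwm; lra|unfold w, Re, Im; simpl; lra|].
  exists ((0, AT) + w)%C. split; [|split].
  - replace ((0, AT) + w - (0, AT))%C with w by ring. lra.
  - change (Im ((0, AT) + w)%C) with (AT + - y). lra.
  - set (t := ((0, AT) + w)%C) in *.
    assert (Hp : Rpower (Cmod w) (1 / 3) = q).
    { rewrite Hwm. replace y with (Rpower q (1 + 1 + 1)).
      - rewrite Rpower_mult. replace ((1 + 1 + 1) * (1 / 3)) with 1 by field. apply Rpower_1, Hq.
      - rewrite !Rpower_plus, Rpower_1 by exact Hq. reflexivity. }
    rewrite Hp in H. rewrite <- Cmult_assoc, alpha_pow_13 in H by (rewrite Hwm; exact Hy).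
    set (S := croot (Ci * w)) in *.
    assert (HS : Cmod S = q).
    { unfold S, croot. rewrite Cmod_pol by (left; apply exp_pos).
      rewrite Cmod_mult, Cmod_Ci, Rmult_1_l. exact Hp. }
    set (X := ((- 2 / 3)%R * - (a0 * Ci / S))%C) in *.
    assert (HX : Cmod X = 2 / 3 * a0 / q).
    { unfold X. rewrite Cmod_mult, Cmod_opp, Cmod_div by (apply croot_neq0).
      rewrite Cmod_mult, Cmod_Ci, !Cmod_R, HS, (Rabs_pos_eq a0), Rabs_left by lra. field. lra. }
    pose proof (Cmod_tri_inv X (LamC t)) as T. rewrite Cmod_sym, HX in T.
    assert (B <= 2 / 3 * a0 / q).
    { apply Rle_div_r; [exact Hq|]. apply Rle_div_r in Hq4; [lra|exact HB]. }
    pose proof (Rle_abs M). unfold B in *. nra.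
Qed.

(** An extension would be continuous at c, hence bounded nearby, while L takes arbitrarily large
    values near c inside the strip. *)
Lemma no_extension (c : C) (L : C -> C) (A : R) :
  (forall M r, 0 < r -> exists t, Cmod (t - c) < r /\ Rabs (Im t) < A /\ M < Cmod (L t)) ->
  ~ exists (r : R) (g1 g2 : C -> C), 0 < r /\
      (forall z, Cmod (z - c) < r -> Cderivable g1 z /\ Cderivable g2 z) /\
      (forall z, Cmod (z - c) < r -> Rabs (Im z) < A -> g1 z = lamC z /\ g2 z = L z).
Proof.
  intros H (r & g1 & g2 & Hr & H1 & H2).
  assert (Hc : Cmod (c - c) < r).
  { replace (c - c)%C with (RtoC 0) by ring. rewrite Cmod_0. exact Hr. }
  destruct (H1 c Hc) as [_ Hg]. apply Cderivable_Ccont in Hg.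
  destruct (proj1 (Ccont_eps _ _) Hg 1 Rlt_0_1) as (d & Hd & H3).
  destruct (H (Cmod (g2 c) + 1) (Rmin r d)) as (t & Ht1 & Ht2 & Ht3); [apply Rmin_glb_lt; assumption|].
  apply Rmin_Rgt_l in Ht1. destruct Ht1 as [Ht1 Ht4].
  destruct (H2 t Ht1 Ht2) as [_ E]. specialize (H3 t Ht4). rewrite E in H3.
  pose proof (Cmod_tri_inv (L t) (g2 c)). lra.
Qed.

Theorem theorem2p2
  (lam0 : R) (lamh Lamh : R -> R) (A : R)
  (Hl0 : 2 / 3 * PI < lam0 < PI)
  (Hsep : - 3 / 2 * 0 ^ 2 + Vpend lam0 = - 1 / 2)
  (Hode_l : forall t : R, is_derive lamh t (- 3 * Lamh t))
  (Hode_L : forall t : R, is_derive Lamh t (Fpend (lamh t)))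
  (Hinit : lamh 0 = lam0 /\ Lamh 0 = 0)
  (HA : is_RInt_gen A_integrand (at_point 0) (at_left a_plus) A) :
  let iA : C := (0, A) in
  let miA : C := (0, - A) in
  exists (U : C -> Prop) (lam Lam : C -> C),
    open U /\
    (forall z, U z -> Cderivable lam z /\ Cderivable Lam z) /\
    (forall x : R, lam (RtoC x) = RtoC (lamh x) /\ Lam (RtoC x) = RtoC (Lamh x)) /\
    (* (i) analytic extension to the strip Pi_A *)
    (forall z : C, Rabs (Im z) < A -> U z) /\
    (* (ii) the only singularities on the boundary are +-iA *)
    (forall z : C, Rabs (Im z) = A -> z <> iA -> z <> miA -> U z) /\
    (~ exists (r : R) (g1 g2 : C -> C), 0 < r /\
        (forall z, Cmod (Cminus z iA) < r -> Cderivable g1 z /\ Cderivable g2 z) /\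
        (forall z, Cmod (Cminus z iA) < r -> Rabs (Im z) < A ->
                   g1 z = lam z /\ g2 z = Lam z)) /\
    (~ exists (r : R) (g1 g2 : C -> C), 0 < r /\
        (forall z, Cmod (Cminus z miA) < r -> Cderivable g1 z /\ Cderivable g2 z) /\
        (forall z, Cmod (Cminus z miA) < r -> Rabs (Im z) < A ->
                   g1 z = lam z /\ g2 z = Lam z)) /\
    (* (iii) local expansions *)
    exists (nu : R) (alpha : C) (K : R),
      0 < nu /\ Cpow alpha 3 = RtoC (1 / 2) /\
      (forall t : C, Cmod (Cminus t iA) < nu -> in_sector Ci (Cminus t iA) ->
         let w := Cminus t iA in
         U t /\
         Cmod (Cminus (lam t)
                 (Cplus (RtoC PI) (Cmult (Cmult (RtoC 3) alpha) (pow_up (2 / 3) w))))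
           <= K * Rpower (Cmod w) (4 / 3) /\
         Cmod (Cminus (Lam t)
                 (Cmult (Cmult (RtoC (- 2 / 3)) alpha) (pow_up (- 1 / 3) w)))
           <= K * Rpower (Cmod w) (1 / 3)) /\
      (forall t : C, Cmod (Cminus t miA) < nu -> in_sector (Copp Ci) (Cminus t miA) ->
         let w := Cminus t miA in
         U t /\
         Cmod (Cminus (lam t)
                 (Cplus (RtoC PI) (Cmult (Cmult (RtoC 3) (Cconj alpha)) (pow_dn (2 / 3) w))))
           <= K * Rpower (Cmod w) (4 / 3) /\
         Cmod (Cminus (Lam t)
                 (Cmult (Cmult (RtoC (- 2 / 3)) (Cconj alpha)) (pow_dn (- 1 / 3) w)))
           <= K * Rpower (Cmod w) (1 / 3)).
Proof.
  rewrite (A_eq A HA). intros iA miA. clear A HA.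
  assert (Hturn : lam0 = lstar).
  { apply separatrix_turning_point; [exact Hl0|]. rewrite <- Hsep. ring. }
  destruct Hinit as [Hi1 Hi2]. rewrite Hturn in Hi1.
  pose proof AT_pos as HAT.
  assert (EmiA : miA = Cconj iA) by reflexivity.
  exists UU, lamC, LamC.
  split; [exact UU_open|]. split; [exact lamC_Cderivable|].
  split; [exact (lamC_real lamh Lamh Hode_l Hode_L Hi1 Hi2)|].
  split; [intros z Hz; apply UU_strip; lra|].
  split.
  (* A boundary point with Re z = 0 would be iA or -iA, both excluded. *)
  { intros z Hz H1 H2. apply UU_strip; [lra|]. intros H. exfalso.
    unfold Rabs in Hz. destruct Rcase_abs in Hz.
    - apply H2. apply Ceq; [exact H|]. change (Im miA) with (- AT). lra.
    - apply H1. apply Ceq; [exact H|]. exact Hz. }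
  split.
  { apply no_extension. intros M r Hr. destruct (LamC_unbounded M r Hr) as (t & H1 & H2 & H3).
    exists t. split; [exact H1|]. split; [rewrite Rabs_pos_eq; lra|exact H3]. }
  split.
  { apply no_extension. intros M r Hr. destruct (LamC_unbounded M r Hr) as (t & H1 & H2 & H3).
    assert (Ht : UU t) by (apply UU_strip; rewrite Rabs_pos_eq; lra).
    exists (Cconj t). split; [|split].
    - rewrite EmiA. replace (Cconj t - Cconj iA)%C with (Cconj (t - iA)) by Cparts.
      rewrite Cmod_conj. exact H1.
    - change (Im (Cconj t)) with (- Im t). rewrite Rabs_Ropp, Rabs_pos_eq; lra.
    - rewrite (proj2 (lamC_conj t Ht)), Cmod_conj. exact H3. }
  set (K := Rmax Klam KLam).
  assert (Hexp : forall t : C, Cmod (t - iA) < nu0 -> in_sector Ci (t - iA) ->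
    UU t /\
    Cmod (lamC t - (PI + 3 * alpha * pow_up (2 / 3) (t - iA))) <= K * Rpower (Cmod (t - iA)) (4 / 3) /\
    Cmod (LamC t - (- 2 / 3)%R * alpha * pow_up (- 1 / 3) (t - iA)) <= K * Rpower (Cmod (t - iA)) (1 / 3)).
  { intros t Ht Hs. set (w := (t - iA)%C) in *.
    assert (Hw : Re w = 0 -> Im w < 0).
    { intros H. apply Rnot_le_lt. intros H'. apply Hs. rewrite Im_Ci, Re_Ci. split; lra. }
    destruct (corner_expansion w Ht Hw) as (H1 & H2 & H3).
    replace ((0, AT) + w)%C with t in H1, H2, H3 by (unfold w, iA; ring).
    split; [exact H1|].
    assert (P1 : 0 < Rpower (Cmod w) (4 / 3)) by apply exp_pos.
    assert (P2 : 0 < Rpower (Cmod w) (1 / 3)) by apply exp_pos.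
    split.
    - eapply Rle_trans; [exact H2|]. apply Rmult_le_compat_r; [lra|apply Rmax_l].
    - eapply Rle_trans; [exact H3|]. apply Rmult_le_compat_r; [lra|apply Rmax_r]. }
  exists nu0, alpha, K. split; [exact nu0_pos|]. split; [exact alpha_cube|].
  split; [exact Hexp|].
  intros t Ht Hs w.
  (* The expansion at -iA is the one at iA for the conjugate of t, carried over by [lamC_conj] and
     [pow_dn_conj]. *)
  assert (Ew : w = Cconj (Cconj t - iA)) by (unfold w; rewrite EmiA; Cparts).
  assert (Et : t = Cconj (Cconj t)) by (symmetry; apply Cconj_conj).
  fold w in Ht, Hs.
  destruct (Hexp (Cconj t)) as (H1 & H2 & H3).
  { rewrite Ew, Cmod_conj in Ht. exact Ht. }
  { intros [I1 I2]. apply Hs. rewrite Ew. rewrite Im_Ci in I1. rewrite Re_Ci in I2.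
    destruct (Cconj t - iA)%C as [x y]. unfold Re, Im, Ci in *. simpl in *. split; lra. }
  set (v := (Cconj t - iA)%C) in *.
  assert (HU : UU t) by (rewrite Et; apply UU_conj, H1).
  split; [exact HU|].
  rewrite Et, (proj1 (lamC_conj _ H1)), (proj2 (lamC_conj _ H1)), Ew, !pow_dn_conj, Cmod_conj.
  split.
  - eapply Rle_trans; [|exact H2]. right. rewrite <- Cmod_conj. f_equal.
    rewrite <- (Cconj_conj (lamC (Cconj t))) at 2.
    unfold Cminus. rewrite Cconj_plus, Cconj_opp', Cconj_plus, !Cconj_mult', !Cconj_R, !Cconj_conj.
    reflexivity.
  - eapply Rle_trans; [|exact H3]. right. rewrite <- Cmod_conj. f_equal.
    rewrite <- (Cconj_conj (LamC (Cconj t))) at 2.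
    unfold Cminus. rewrite Cconj_plus, Cconj_opp', !Cconj_mult', !Cconj_R, !Cconj_conj. reflexivity.
Qed.
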